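(* Let $\epsilon\in\mathbb R$, let $I$ be an open interval and let $f:I\to(0,\infty)$ be a smooth function with $\dot f>0$ satisfying \[ \ddot f f - \frac 7 4 \dot f^2 + 4 f^4 - \frac 4 3 \epsilon f^2 = 0 . \] Let $(M^2 = I \times \mathbb R, g)$ be the abstract surface with metric $g(s,t)=ds^2+f^{-3/2}(s)\,dt^2$ and Gaussian curvature $K$. Then: a) there exists a $1$-parametric family of non-CMC biconservative W-surfaces $\varphi : (M^2, g) \to N^4 (\epsilon)$ with flat normal bundle satisfying $\langle \nabla ^\perp _{E_1} E_3, E_4 \rangle \langle \nabla ^\perp _{E_2} E_3, E_4 \rangle = 0$ and $K = \epsilon - 3 (f^\varphi)^2$ on $M$, and $\nabla^\perp E_3 \neq 0$, $A_4 \neq 0$, $\nabla_{E_2} E_2 \neq 0$ at any point. All the surfaces in this family have the same mean curvature, given by \[ (f^\varphi)^2 = \frac 1 3 (\epsilon - K); \] b) there exists a unique non-CMC biconservative surface $\psi : (M^2, g) \to N^3 (\epsilon)$. Its mean curvature is \[ (f^\psi)^2 = (f^\varphi)^2 = \frac 1 3 (\epsilon - K). \]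
   Context: $N^n(\epsilon)$ is the $n$-dimensional space form of constant sectional curvature $\epsilon$. Immersions are isometric. For a surface in $N^n(\epsilon)$: $B$ is the second fundamental form, $A_\eta$ the shape operator in the normal direction $\eta$, $\nabla$ the Levi-Civita connection, $\nabla^\perp$ the normal connection, $H=\frac12\operatorname{trace}B$; $f^\varphi=|H|$ denotes the mean curvature function of an immersion $\varphi$. Flat normal bundle means the curvature of $\nabla^\perp$ vanishes. Biconservative means $2\operatorname{trace}A_{\nabla^\perp_{(\cdot)}H}(\cdot)+\operatorname{grad}|H|^2=0$. A W-surface is one for which there is a smooth $W:\mathbb R^2\to\mathbb R$ with nowhere zero gradient such that $W(f^\varphi,K)=0$ on $M$. ''Non-CMC biconservative'' in $N^4(\epsilon)$ means biconservative with $H\neq0$, $\operatorname{grad}f^\varphi\neq0$ and $A_{H/f^\varphi}\neq f^\varphi\,\mathrm{Id}$ at every point; in $N^3(\epsilon)$ it means biconservative with $H\ne0$ and $\operatorname{grad}f^\psi\neq0$ at every point. For a surface in $N^4(\epsilon)$: $E_3=H/f^\varphi$, $E_4$ is a unit normal section orthogonal to $E_3$, $A_4=A_{E_4}$, and $\{E_1,E_2\}$ is an orthonormal tangent frame of eigenvectors of $A_{E_3}$, labelled (when $\langle \nabla ^\perp _{E_1} E_3, E_4 \rangle \langle \nabla ^\perp _{E_2} E_3, E_4 \rangle = 0$ on $M$ and $\nabla^\perp E_3\ne0$ everywhere) so that $\langle \nabla ^\perp _{E_1} E_3, E_4 \rangle\neq0$ everywhere and $\langle \nabla ^\perp _{E_2}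 E_3, E_4 \rangle=0$. The dot denotes $d/ds$.
   Formalization: Part a) is proved on each open subinterval J of I where f has a positive lower bound (J = I if inf f > 0); on all of I it is false when inf f = 0, as these surfaces force f ≥ C^4 > 0. Uniqueness in b) is up to isometries of N^3(ε). *)

(* Defs.v *)
From HB Require Import structures.
From mathcomp Require Import all_boot all_order all_algebra.
From mathcomp Require Import all_classical all_reals all_analysis.
Set Implicit Arguments.
Unset Strict Implicit.
Unset Printing Implicit Defensive.
Import Order.TTheory GRing.Theory Num.Theory.
Import numFieldNormedType.Exports.
Local Open Scope classical_set_scope.
Local Open Scope ring_scope.

Definition pt {R : realType} (x y : R) : 'rV[R]_2 :=
  \row_(i < 2) (if i == 0 then x else y).

Definition pd {R : realType} {W : normedModType R} (i : 'I_2)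
    (F : 'rV[R]_2 -> W) (p : 'rV[R]_2) : W :=
  'D_(delta_mx 0 i) F p.

Definition iter_pd {R : realType} {W : normedModType R} (l : seq 'I_2)
    (F : 'rV[R]_2 -> W) : 'rV[R]_2 -> W :=
  foldr (fun i G => pd i G) F l.

(* C^oo on M; used for open M only. *)
Definition smooth_on {R : realType} {W : normedModType R} (M : set 'rV[R]_2)
    (F : 'rV[R]_2 -> W) : Prop :=
  forall (l : seq 'I_2) (p : 'rV[R]_2), M p -> differentiable (iter_pd l F) p.

(* Intrinsic geometry of a metric g in the global coordinates of 'rV[R]_2.
   A vector field is the row of its components in the coordinate frame. *)

Definition christoffel {R : realType} (g : 'rV[R]_2 -> 'M[R]_2)
    (k i j : 'I_2) (p : 'rV[R]_2) : R :=
  2^-1 * \sum_(l < 2) invmx (g p) k l *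
    (pd i (fun q => g q j l) p + pd j (fun q => g q i l) p
     - pd l (fun q => g q i j) p).

Definition levi_civita_coord {R : realType} (g : 'rV[R]_2 -> 'M[R]_2)
    (i : 'I_2) (Y : 'rV[R]_2 -> 'rV[R]_2) (p : 'rV[R]_2) : 'rV[R]_2 :=
  \row_(k < 2) (pd i (fun q => Y q 0 k) p
                + \sum_(j < 2) christoffel g k i j p * Y p 0 j).

Definition levi_civita {R : realType} (g : 'rV[R]_2 -> 'M[R]_2)
    (X Y : 'rV[R]_2 -> 'rV[R]_2) (p : 'rV[R]_2) : 'rV[R]_2 :=
  \sum_(i < 2) X p 0 i *: levi_civita_coord g i Y p.

(* g(R(d_0, d_1) d_1, d_0) / det g *)
Definition gauss_curvature {R : realType} (g : 'rV[R]_2 -> 'M[R]_2)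
    (p : 'rV[R]_2) : R :=
  let d1 := fun _ : 'rV[R]_2 => delta_mx 0 1 : 'rV[R]_2 in
  let R011 := levi_civita_coord g 0 (levi_civita_coord g 1 d1) p
              - levi_civita_coord g 1 (levi_civita_coord g 0 d1) p in
  (R011 *m g p) 0 0 / \det (g p).

Definition grad {R : realType} (g : 'rV[R]_2 -> 'M[R]_2)
    (h : 'rV[R]_2 -> R) (p : 'rV[R]_2) : 'rV[R]_2 :=
  (\row_(i < 2) pd i h p) *m invmx (g p).

Definition strip {R : realType} (I : set R) : set 'rV[R]_2 :=
  [set p : 'rV[R]_2 | I (p 0 0)].

(* ds^2 + f(s)^{-3/2} dt^2, with s = p 0 0 and t = p 0 1 *)
Definition warped_metric {R : realType} (f : R -> R) (p : 'rV[R]_2) : 'M[R]_2 :=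
  diag_mx (pt 1 (f (p 0 0) `^ (- (3 / 2)))).

(* The space form N^n(eps) as a hypersurface of R^{n+1}: the sphere of radius
   eps^{-1/2} if eps > 0, the hyperplane x_0 = 0 of Euclidean space if
   eps = 0, and the sheet x_0 > 0 of <x, x> = 1/eps in Minkowski space
   if eps < 0. *)

Definition ambient_form {R : realType} {n : nat} (eps : R)
    (x y : 'rV[R]_n.+1) : R :=
  (if eps < 0 then -1 else 1) * (x 0 0 * y 0 0)
  + \sum_(i < n) x 0 (lift ord0 i) * y 0 (lift ord0 i).

Definition space_form {R : realType} {n : nat} (eps : R) : set 'rV[R]_n.+1 :=
  [set x : 'rV[R]_n.+1 | if eps == 0 then x 0 0 = 0
           else ambient_form eps x x = eps^-1 /\ (eps < 0 -> 0 < x 0 0)].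

Definition tangent_to_space_form {R : realType} {n : nat} (eps : R)
    (x v : 'rV[R]_n.+1) : Prop :=
  if eps == 0 then v 0 0 = 0 else ambient_form eps v x = 0.

(* The geodesic distance of N^n(eps) is a strictly increasing function of
   <x - y, x - y>, so these are exactly the isometries of N^n(eps). *)
Definition space_form_isometry {R : realType} {n : nat} (eps : R)
    (F : 'rV[R]_n.+1 -> 'rV[R]_n.+1) : Prop :=
  F @` space_form eps = space_form eps /\
  forall x y, space_form eps x -> space_form eps y ->
    ambient_form eps (F x - F y) (F x - F y) = ambient_form eps (x - y) (x - y).

Definition isometric_immersion {R : realType} {n : nat} (eps : R)
    (M : set 'rV[R]_2) (g : 'rV[R]_2 -> 'M[R]_2)
    (phi : 'rV[R]_2 -> 'rV[R]_n.+1) : Prop :=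
  [/\ smooth_on M phi,
      (forall p, M p -> space_form eps (phi p)) &
      (forall p i j, M p ->
        ambient_form eps (pd i phi p) (pd j phi p) = g p i j)].

Definition congruent_on {R : realType} {n : nat} (eps : R) (M : set 'rV[R]_2)
    (phi psi : 'rV[R]_2 -> 'rV[R]_n.+1) : Prop :=
  exists2 F, space_form_isometry eps F & forall p, M p -> psi p = F (phi p).

(* Levi-Civita connection of N^n(eps) along phi, in the direction d_i: the
   derivative in R^{n+1} projected on T_{phi p} N^n(eps).  As <x, x> = 1/eps,
   the projection is v - eps <v, x> x; it is the identity for eps = 0. *)
Definition space_form_conn {R : realType} {n : nat} (eps : R)
    (phi : 'rV[R]_2 -> 'rV[R]_n.+1) (i : 'I_2)
    (V : 'rV[R]_2 -> 'rV[R]_n.+1) (p : 'rV[R]_2) : 'rV[R]_n.+1 :=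
  pd i V p - (eps * ambient_form eps (pd i V p) (phi p)) *: phi p.

(* B(d_i, d_j) *)
Definition second_ff {R : realType} {n : nat} (eps : R)
    (g : 'rV[R]_2 -> 'M[R]_2) (phi : 'rV[R]_2 -> 'rV[R]_n.+1)
    (i j : 'I_2) (p : 'rV[R]_2) : 'rV[R]_n.+1 :=
  space_form_conn eps phi i (pd j phi) p
  - \sum_(k < 2) christoffel g k i j p *: pd k phi p.

Definition mean_vector {R : realType} {n : nat} (eps : R)
    (g : 'rV[R]_2 -> 'M[R]_2) (phi : 'rV[R]_2 -> 'rV[R]_n.+1)
    (p : 'rV[R]_2) : 'rV[R]_n.+1 :=
  2^-1 *: \sum_(i < 2) \sum_(j < 2)
    invmx (g p) i j *: second_ff eps g phi i j p.

Definition mean_curvature {R : realType} {n : nat} (eps : R)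
    (g : 'rV[R]_2 -> 'M[R]_2) (phi : 'rV[R]_2 -> 'rV[R]_n.+1)
    (p : 'rV[R]_2) : R :=
  Num.sqrt (ambient_form eps (mean_vector eps g phi p)
                             (mean_vector eps g phi p)).

(* A_eta acts on rows on the right, A_eta X = X *m shape eta:
   g(A_eta X, Y) = X *m shape eta *m g *m Y^T = <B(X, Y), eta>. *)
Definition shape {R : realType} {n : nat} (eps : R)
    (g : 'rV[R]_2 -> 'M[R]_2) (phi : 'rV[R]_2 -> 'rV[R]_n.+1)
    (eta : 'rV[R]_n.+1) (p : 'rV[R]_2) : 'M[R]_2 :=
  (\matrix_(i < 2, j < 2) ambient_form eps (second_ff eps g phi i j p) eta)
    *m invmx (g p).

Definition normal_part {R : realType} {n : nat} (eps : R)
    (g : 'rV[R]_2 -> 'M[R]_2) (phi : 'rV[R]_2 -> 'rV[R]_n.+1)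
    (p : 'rV[R]_2) (v : 'rV[R]_n.+1) : 'rV[R]_n.+1 :=
  v - \sum_(k < 2) \sum_(l < 2)
        (invmx (g p) k l * ambient_form eps v (pd k phi p)) *: pd l phi p.

Definition normal_conn_coord {R : realType} {n : nat} (eps : R)
    (g : 'rV[R]_2 -> 'M[R]_2) (phi : 'rV[R]_2 -> 'rV[R]_n.+1) (i : 'I_2)
    (eta : 'rV[R]_2 -> 'rV[R]_n.+1) (p : 'rV[R]_2) : 'rV[R]_n.+1 :=
  normal_part eps g phi p (space_form_conn eps phi i eta p).

Definition normal_conn {R : realType} {n : nat} (eps : R)
    (g : 'rV[R]_2 -> 'M[R]_2) (phi : 'rV[R]_2 -> 'rV[R]_n.+1)
    (X : 'rV[R]_2 -> 'rV[R]_2)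
    (eta : 'rV[R]_2 -> 'rV[R]_n.+1) (p : 'rV[R]_2) : 'rV[R]_n.+1 :=
  \sum_(i < 2) X p 0 i *: normal_conn_coord eps g phi i eta p.

Definition normal_section {R : realType} {n : nat} (eps : R)
    (M : set 'rV[R]_2) (phi eta : 'rV[R]_2 -> 'rV[R]_n.+1) : Prop :=
  smooth_on M eta /\
  forall p, M p -> tangent_to_space_form eps (phi p) (eta p) /\
    forall i, ambient_form eps (eta p) (pd i phi p) = 0.

Definition flat_normal_bundle {R : realType} {n : nat} (eps : R)
    (M : set 'rV[R]_2) (g : 'rV[R]_2 -> 'M[R]_2)
    (phi : 'rV[R]_2 -> 'rV[R]_n.+1) : Prop :=
  forall eta, normal_section eps M phi eta -> forall p, M p ->
    normal_conn_coord eps g phi 0 (normal_conn_coord eps g phi 1 eta) p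
    - normal_conn_coord eps g phi 1 (normal_conn_coord eps g phi 0 eta) p = 0.

(* Row i of a shape operator is its value at d_i. *)
Definition biconservative {R : realType} {n : nat} (eps : R)
    (M : set 'rV[R]_2) (g : 'rV[R]_2 -> 'M[R]_2)
    (phi : 'rV[R]_2 -> 'rV[R]_n.+1) : Prop :=
  forall p, M p ->
    2 *: (\sum_(i < 2) \sum_(j < 2) invmx (g p) i j *:
       row j (shape eps g phi
                (normal_conn_coord eps g phi i (mean_vector eps g phi) p) p))
    + grad g (fun q => mean_curvature eps g phi q ^+ 2) p = 0.

Definition E3 {R : realType} {n : nat} (eps : R)
    (g : 'rV[R]_2 -> 'M[R]_2) (phi : 'rV[R]_2 -> 'rV[R]_n.+1)
    (p : 'rV[R]_2) : 'rV[R]_n.+1 :=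
  (mean_curvature eps g phi p)^-1 *: mean_vector eps g phi p.

Definition non_CMC_biconservative3 {R : realType} (eps : R)
    (M : set 'rV[R]_2) (g : 'rV[R]_2 -> 'M[R]_2)
    (psi : 'rV[R]_2 -> 'rV[R]_4) : Prop :=
  biconservative eps M g psi /\
  forall p, M p -> mean_vector eps g psi p <> 0 /\
    grad g (mean_curvature eps g psi) p <> 0.

Definition non_CMC_biconservative4 {R : realType} (eps : R)
    (M : set 'rV[R]_2) (g : 'rV[R]_2 -> 'M[R]_2)
    (phi : 'rV[R]_2 -> 'rV[R]_5) : Prop :=
  biconservative eps M g phi /\
  forall p, M p -> [/\ mean_vector eps g phi p <> 0,
    grad g (mean_curvature eps g phi) p <> 0 &
    shape eps g phi (E3 eps g phi p) p
      <> (mean_curvature eps g phi p)%:M].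

Definition W_surface {R : realType} {n : nat} (eps : R)
    (M : set 'rV[R]_2) (g : 'rV[R]_2 -> 'M[R]_2)
    (phi : 'rV[R]_2 -> 'rV[R]_n.+1) : Prop :=
  exists W : 'rV[R]_2 -> R,
    [/\ smooth_on setT W,
        (forall x, exists i, pd i W x <> 0) &
        (forall p, M p ->
           W (pt (mean_curvature eps g phi p) (gauss_curvature g p)) = 0)].

(* In codimension 2 with A_{E3} non-umbilic, X1, X2 and E4 are unique up to
   signs once X1 is labelled. *)
Definition adapted_frame {R : realType} (eps : R)
    (M : set 'rV[R]_2) (g : 'rV[R]_2 -> 'M[R]_2)
    (phi : 'rV[R]_2 -> 'rV[R]_5)
    (X1 X2 : 'rV[R]_2 -> 'rV[R]_2) (E4 : 'rV[R]_2 -> 'rV[R]_5) : Prop :=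
  [/\ smooth_on M X1, smooth_on M X2, normal_section eps M phi E4,
      (forall p, M p ->
        [/\ (X1 p *m g p *m (X1 p)^T) 0 0 = 1,
            (X2 p *m g p *m (X2 p)^T) 0 0 = 1,
            (X1 p *m g p *m (X2 p)^T) 0 0 = 0,
            ambient_form eps (E4 p) (E4 p) = 1 &
            ambient_form eps (E4 p) (E3 eps g phi p) = 0]) &
      (forall p, M p ->
        let A3 := shape eps g phi (E3 eps g phi p) p in
        (exists a, X1 p *m A3 = a *: X1 p) /\
        (exists a, X2 p *m A3 = a *: X2 p))].

Definition flat_W_surface {R : realType} (eps : R)
    (M : set 'rV[R]_2) (g : 'rV[R]_2 -> 'M[R]_2)
    (phi : 'rV[R]_2 -> 'rV[R]_5) : Prop :=
  [/\ isometric_immersion eps M g phi,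
      non_CMC_biconservative4 eps M g phi,
      W_surface eps M g phi,
      flat_normal_bundle eps M g phi &
      exists X1 X2 E4, adapted_frame eps M g phi X1 X2 E4 /\
        forall p, M p ->
        let w X := ambient_form eps
                     (normal_conn eps g phi X (E3 eps g phi) p) (E4 p) in
        [/\ w X1 * w X2 = 0 /\ (w X1 <> 0 /\ w X2 = 0),
            gauss_curvature g p = eps - 3 * mean_curvature eps g phi p ^+ 2,
            (exists i, normal_conn_coord eps g phi i (E3 eps g phi) p <> 0),
            shape eps g phi (E4 p) p <> 0 &
            levi_civita g X2 X2 p <> 0]].

(* Main.v *)
Require Import Defs.
From mathcomp Require Import all_boot all_order all_algebra.
From mathcomp Require Import all_classical all_reals all_analysis.
From mathcomp Require Import ring lra.
Import Order.TTheory GRing.Theory Num.Theory.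
Import numFieldNormedType.Exports.
Local Open Scope classical_set_scope.
Local Open Scope ring_scope.
Set Implicit Arguments.
Unset Strict Implicit.
Unset Printing Implicit Defensive.

(** Write [h = f ^ (-3/4)], so that the metric is [ds^2 + h^2 dt^2].  The differential
    equation for [f] says exactly that [h'' = (3 f^2 - eps) h], that is
    [K = eps - 3 f^2] ([dhf_derive], [profile_curvature]).

    Surfaces are obtained from moving frames.  An orthonormal frame along the surface,
    with the position vector as an additional row, satisfies two linear equations
    [d_s F = Os F] and [d_t F = Ot F] in which [Os] and [Ot] depend on [s] only.  They are
    compatible as soon as [Ot' = Os Ot - Ot Os], and then [F = Psi(s) Z(t)] with [Psi] and
    [Z] solving ordinary linear equations ([moving_frame_exists]); the skewness of [Os] and
    [Ot] keeps the frame orthonormal and its first row on the space form.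

    For part (a), biconservativity and the equations of Gauss, Codazzi and Ricci leave one
    degree of freedom.  Let [2 theta] be the angle from [- E_3] to the traceless part of
    [B(E_1, E_1)], which has length [2 f].  The Codazzi equations hold when
    [sin theta = c f ^ (-1/4)], with a constant [c > 0] as the parameter of the family, and
    [<D_s E_3, E_4>] is then determined.  As [f] is bounded below on [J], the angle
    [2 theta] stays under a quarter turn for all small [c], which is what the
    nondegeneracy conditions ask for ([family_flat_W_surface]).  Chordal distances on the
    surface determine the length of the acceleration of the curve [t = 0], hence [c]
    ([family_not_congruent]).  All the frames start from the same value, so continuity in
    [c] is continuous dependence of linear equations on parameters
    ([linear_ode_continuous_param]).

    The surface of part (b) is the analogous construction with [c = 0], in [N^3].  For
    uniqueness take any non-CMC biconservative surface with this metric.  The biconservative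
    equation says that [grad |H|^2] is an eigenvector of the shape operator of [H / |H|] with
    eigenvalue [- |H|]; the trace is [2 |H|], so the other eigenvalue is [3 |H|], and the
    Gauss equation [K = eps - 3 |H|^2] gives [|H| = f] ([mean_square_eq]).  Since [f]
    depends on [s] only, the eigenvectors are the coordinate directions and the whole
    second fundamental form is known ([biconservative_second_ff]).  The frame of the surface
    therefore satisfies the same linear equations as the model ([biconservative_frame]), and
    two solutions differ by a rigid motion ([frames_congruent]). *)

(** * Derivatives of matrix-valued maps *)

Lemma is_derive_mxP {R : realType} {V : normedModType R} (m n : nat)
    (M : V -> 'M[R]_(m, n)) (x v : V) (D : 'M[R]_(m, n)) :
  is_derive x v M D <-> forall i j, is_derive x v (fun y => M y i j) (D i j).
Proof.
split=> [[dM <-] i j|H].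
  have dMij := (derivable_mxP M x v).1 dM i j.
  by apply: DeriveDef => //; rewrite derive_mx// mxE.
have dM : derivable M x v by apply/derivable_mxP => i j; case: (H i j).
apply: DeriveDef => //; rewrite derive_mx//.
by apply/matrixP => i j; rewrite mxE; case: (H i j).
Qed.

Lemma is_derive_mulmx {R : realType} {V : normedModType R} (m n p : nat)
    (M : V -> 'M[R]_(m, n)) (N : V -> 'M[R]_(n, p)) (x v : V) dM dN :
  is_derive x v M dM -> is_derive x v N dN ->
  is_derive x v (fun y => M y *m N y) (dM *m N x + M x *m dN).
Proof.
move=> /is_derive_mxP hM /is_derive_mxP hN; apply/is_derive_mxP => i j.
have -> : (fun y => (M y *m N y) i j) =
    \sum_k ((fun y => M y i k) * (fun y => N y k j)).
  by apply/funext => y; rewrite fct_sumE mxE.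
rewrite !mxE -big_split /=.
apply: is_derive_eq.
apply: eq_bigr => k _; rewrite -![_ *: _]/(_ * _); ring.
Qed.

Lemma is_derive_trmx {R : realType} {V : normedModType R} (m n : nat)
    (M : V -> 'M[R]_(m, n)) (x v : V) dM :
  is_derive x v M dM -> is_derive x v (fun y => (M y)^T) dM^T.
Proof.
move=> /is_derive_mxP hM; apply/is_derive_mxP => i j.
rewrite mxE; have -> : (fun y => (M y)^T i j) = (fun y => M y j i).
  by apply/funext => y; rewrite mxE.
exact: hM.
Qed.

Lemma is_derive_comb {R : realType} {V : normedModType R} (u w : V -> R)
    (x v : V) (du dw : R) :
  is_derive x v u du -> is_derive x v w dw ->
  is_derive x v (fun y => u y * w y) (du * w x + u x * dw).
Proof.
move=> hu hw; apply: (is_derive_eq (is_deriveM hu hw)).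
by rewrite -![_ *: _]/(_ * _); ring.
Qed.

Lemma is_derive_scale {R : realType} {V : normedModType R} (m n : nat)
    (u : V -> R) (w : V -> 'M[R]_(m, n)) (x v : V) (du : R) (dw : 'M[R]_(m, n)) :
  is_derive x v u du -> is_derive x v w dw ->
  is_derive x v (fun y => u y *: w y) (du *: w x + u x *: dw).
Proof.
move=> hu /is_derive_mxP hw; apply/is_derive_mxP => i j; rewrite !mxE.
have -> : (fun y => (u y *: w y) i j) = (fun y => u y * w y i j).
  by apply/funext => y; rewrite mxE.
exact: is_derive_comb.
Qed.

(** * Linear differential equations *)

Lemma mono_le {R : realType} (u v du dv : R -> R) (a b : R) : a <= b ->
  (forall s, a <= s <= b -> is_derive s 1 u (du s)) ->
  (forall s, a <= s <= b -> is_derive s 1 v (dv s)) ->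
  (forall s, a <= s <= b -> du s <= dv s) ->
  u b - u a <= v b - v a.
Proof.
move=> ab hu hv le.
have hw s : a <= s <= b -> is_derive s 1 (v - u) (dv s - du s).
  by move=> hs; have h1 := hu s hs; have h2 := hv s hs; exact: is_deriveB.
have [||c] := @MVT_segment R (v - u) (dv - du) a b ab.
- by move=> s /[!in_itv]/= /andP[s1 s2]; apply: hw; rewrite !ltW.
- apply: derivable_within_continuous => s /[!in_itv]/= hs.
  by have [] := hw s hs.
rewrite in_itv/= => hc E.
rewrite -subr_ge0; suff : 0 <= (v - u) b - (v - u) a.
  by rewrite !fctE; lra.
by rewrite E mulr_ge0 ?subr_ge0// le.
Qed.

Lemma is_derive_refl {R : realType} (u : R -> R) (s d : R) :
  is_derive (- s) 1 u d -> is_derive s 1 (fun y => u (- y)) (- d).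
Proof.
move=> h; apply: (is_derive_eq (is_derive1_comp (g := -%R) h (is_deriveNid _ _))).
by rewrite mulrN1.
Qed.

Definition btw {R : realType} (a b u : R) : bool :=
  (a <= u <= b) || (b <= u <= a).

Lemma is_derive_expl {R : realType} (k a s : R) :
  is_derive s 1 (fun y => expR (k * (y - a))) (k * expR (k * (s - a))).
Proof.
have h : is_derive s 1 (fun y : R => k * (y - a)) k.
  have h1 : is_derive s 1 (id - cst a) (1 : R) by apply: is_derive_eq; rewrite subr0.
  by apply: (is_derive_eq (is_deriveZ k h1)); rewrite -[_ *: _]/(_ * _) mulr1.
apply: (is_derive_eq (is_derive1_comp (f := expR) (is_derive_expR _) h)).
by rewrite mulrC.
Qed.

Lemma gronwall_right {R : realType} (N dN : R -> R) (a b k d : R) :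
  a <= b -> 0 < k ->
  (forall u, a <= u <= b -> is_derive u 1 N (dN u)) ->
  (forall u, a <= u <= b -> dN u <= k * N u + d) ->
  N b <= (N a + d / k) * expR (k * (b - a)) - d / k.
Proof.
move=> ab k0 hN le.
pose w (y : R) := (N y + d / k) * expR (- k * (y - a)).
pose dw (y : R) := (dN y - k * N y - d) * expR (- k * (y - a)).
have hw u : a <= u <= b -> is_derive u 1 w (dw u).
  move=> hu; have h1 := hN u hu.
  have h2 : is_derive u 1 (N + cst (d / k)) (dN u).
    by apply: is_derive_eq; rewrite addr0.
  apply: (is_derive_eq (is_derive_comb h2 (is_derive_expl (- k) a u))).
  by rewrite !fctE /dw; field; rewrite gt_eqF.
have := mono_le ab hw (fun s _ => is_derive_cst (0 : R) s 1).
have -> : cst 0 b - cst 0 a = 0 :> R by rewrite /= subrr.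
move=> H.
have {}H : w b - w a <= 0.
  apply: H => u hu /=; rewrite pmulr_lle0 ?expR_gt0//.
  by have := le u hu; lra.
have : (N b + d / k) * expR (- k * (b - a)) <= N a + d / k.
  by move: H; rewrite /w subrr mulr0 expR0 mulr1; lra.
rewrite mulNr expRN ler_pdivrMr ?expR_gt0//; lra.
Qed.

(** The equation is integrated in both directions from its initial point;
    the backward half follows from the forward one by reflection. *)
Lemma gronwall {R : realType} (N dN : R -> R) (a b k d : R) : 0 < k ->
  (forall u, btw a b u -> is_derive u 1 N (dN u)) ->
  (forall u, btw a b u -> `|dN u| <= k * N u + d) ->
  N b <= (N a + d / k) * expR (k * `|b - a|) - d / k.
Proof.
move=> k0 hN le; have [ab|/ltW ba] := leP a b.
  rewrite ger0_norm ?subr_ge0//; apply: gronwall_right => // [u hu|u hu].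
    by apply: hN; rewrite /btw hu.
  by apply: le_trans (ler_norm _) _; apply: le; rewrite /btw hu.
rewrite ler0_norm ?subr_le0// opprB.
have := @gronwall_right R (fun y => N (- y)) (fun y => - dN (- y))
  (- a) (- b) k d.
rewrite !opprK [- b + a]addrC; apply => //; rewrite ?lerN2// => u hu.
  by apply: is_derive_refl; apply: hN; rewrite /btw; apply/orP; right; lra.
apply: le_trans (ler_norm _) _; rewrite normrN.
by apply: le; rewrite /btw; apply/orP; right; lra.
Qed.

Lemma bielecki_right {R : realType} (D dD : R -> R) (a b k c : R) :
  a <= b -> 0 < k -> D a = 0 ->
  (forall u, a <= u <= b -> is_derive u 1 D (dD u)) ->
  (forall u, a <= u <= b -> `|dD u| <= c * expR (k * (u - a))) ->
  `|D b| <= c / k * expR (k * (b - a)).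
Proof.
move=> ab k0 Da hD le.
pose v (y : R) := c / k * expR (k * (y - a)).
have hv u : a <= u <= b -> is_derive u 1 v (c * expR (k * (u - a))).
  move=> _; apply: (is_derive_eq (is_deriveZ (c / k) (is_derive_expl k a u))).
  by rewrite -[_ *: _]/(_ * _) mulrA divfK ?gt_eqF.
have c0 : 0 <= c / k.
  apply: divr_ge0; last exact: ltW.
  have := le a; rewrite lexx ab => /(_ isT).
  by rewrite subrr mulr0 expR0 mulr1 => h; exact: le_trans (normr_ge0 _) h.
have va : v a = c / k by rewrite /v subrr mulr0 expR0 mulr1.
rewrite ler_norml; apply/andP; split.
  have := mono_le ab (fun s hs => is_deriveN (hD s hs)) hv.
  rewrite -/(v b) va !fctE Da oppr0 subr0 => H.
  suff : - D b <= v b - c / k by lra.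
  by apply: H => u hu; have := le u hu; rewrite ler_norml => /andP[]; lra.
have := mono_le ab hD hv.
rewrite -/(v b) va Da subr0 => H; suff : D b <= v b - c / k by lra.
by apply: H => u hu; apply: le_trans (ler_norm _) (le u hu).
Qed.

(** One integration gains the factor [c / k] when the growth is measured
    against [expR (k * `|u - a|)]; with [k] large this makes the Picard
    iteration a contraction on any segment, however long. *)
Lemma bielecki {R : realType} (D dD : R -> R) (a b k c : R) :
  0 < k -> D a = 0 ->
  (forall u, btw a b u -> is_derive u 1 D (dD u)) ->
  (forall u, btw a b u -> `|dD u| <= c * expR (k * `|u - a|)) ->
  `|D b| <= c / k * expR (k * `|b - a|).
Proof.
move=> k0 Da hD le; have [ab|/ltW ba] := leP a b.
  rewrite [`|b - a|]ger0_norm ?subr_ge0//.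
  apply: (bielecki_right (dD := dD)) => // [u hu|u hu].
    by apply: hD; rewrite /btw hu.
  have := le u; rewrite /btw hu => /(_ isT); rewrite [`|u - a|]ger0_norm//.
  by case/andP: hu; rewrite subr_ge0.
rewrite [`|b - a|]ler0_norm ?subr_le0// opprB.
have := @bielecki_right R (fun y => D (- y)) (fun y => - dD (- y))
  (- a) (- b) k c.
rewrite !opprK [- b + a]addrC; apply => //; rewrite ?lerN2// => u hu.
  by apply: is_derive_refl; apply: hD; rewrite /btw; apply/orP; right; lra.
rewrite normrN; have := le (- u); rewrite [`|- u - a|]ler0_norm; last by lra.
rewrite opprB opprK [a + u]addrC; apply.
by rewrite /btw; apply/orP; right; lra.
Qed.

Lemma open_interval_segment {R : realType} (J : set R) (s0 s : R) :
  open J -> is_interval J -> J s0 -> J s ->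
  exists a b, [/\ a < s0 < b, a < s < b & forall x, a <= x <= b -> J x].
Proof.
move=> oJ iJ J0 Js.
have ball1 x : J x -> exists2 e, 0 < e & J (x - e) /\ J (x + e).
  move=> Jx; have /nbhs_ballP[e /= e0 He] : nbhs x J by apply: open_nbhs_nbhs.
  exists (e / 2); first by rewrite divr_gt0.
  by split; apply: He; rewrite /ball /= ?opprD ?opprK ?addrA ?subrr ?add0r
    ?sub0r ?normrN ger0_norm; lra.
have [e1 e10 [Jm1 Jp1]] := ball1 _ J0.
have [e2 e20 [Jm2 Jp2]] := ball1 _ Js.
have [le|/ltW le] := leP s0 s.
  exists (s0 - e1), (s + e2); split; [lra|lra|].
  by move=> x hx; apply: (iJ _ _ Jm1 Jp2).
exists (s - e2), (s0 + e1); split; [lra|lra|].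
by move=> x hx; apply: (iJ _ _ Jm2 Jp1).
Qed.

Lemma continuous_in_J_within {R : realType} (J : set R) (g : R -> R) (a b : R) :
  (forall x, a <= x <= b -> J x) -> (forall s, J s -> {for s, continuous g}) ->
  {within `[a, b], continuous g}.
Proof.
move=> sub cg; apply: continuous_in_subspaceT => x /[1!inE] /=.
by rewrite in_itv /= => /sub/cg.
Qed.

(** A single primitive on all of [J], so that the iteration below never has to glue
    local solutions. *)
Lemma primitive_exists {R : realType} (J : set R) (s0 : R) (g : R -> R) :
  open J -> is_interval J -> J s0 -> (forall s, J s -> {for s, continuous g}) ->
  exists G : R -> R, G s0 = 0 /\ forall s, J s -> is_derive s 1 G (g s).
Proof.
move=> oJ iJ J0 cg.
pose mu := @lebesgue_measure R.
pose G s := if s0 <= s then (\int[mu]_(x in `]s0, s]) g x)%R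
            else - (\int[mu]_(x in `]s, s0]) g x)%R.
exists G; split; first by rewrite /G lexx set_itv_ge ?bnd_simp ?ltxx// Rintegral_set0.
move=> s Js; have [a [b [as0b asb sub]]] := open_interval_segment oJ iJ J0 Js.
have int x y : a <= x -> y <= b -> mu.-integrable `[x, y] (EFin \o g).
  move=> ax yb; apply: continuous_compact_integrable; first exact: segment_compact.
  apply: (continuous_in_J_within (J := J)) cg => z hz; apply: sub; lra.
pose F x := (\int[mu]_(t in `[a, x]) g t)%R.
have GE x : a < x < b -> F x - F s0 = G x.
  move=> hx; rewrite /G /F; have [le|lt] := leP s0 x.
    by rewrite Rintegral_itvB//; [apply: int; lra|rewrite bnd_simp; lra].
  rewrite -opprB Rintegral_itvB//; [apply: int; lra|rewrite bnd_simp; lra|].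
  by rewrite bnd_simp ltW.
have [dF F'] : derivable F s 1 /\ derive1 F s = g s.
  apply: (@continuous_FTC1_closed R g a s b); [lra|apply: int; lra|lra|exact: cg].
have hF : is_derive s 1 (F - cst (F s0)) (g s).
  have h1 : is_derive s 1 F (g s) by apply: DeriveDef; [exact: dF|rewrite -derive1E; exact: F'].
  by apply: is_derive_eq; rewrite subr0.
apply: near_eq_is_derive hF.
near=> x; apply: GE; apply/andP; split; near: x.
  by apply: lt_nbhsr; case/andP: asb.
by apply: lt_nbhsl; case/andP: asb.
Unshelve. all: by end_near. Qed.

Lemma continuous_bounded_mx {R : realType} (m n : nat) (A : R -> 'M[R]_(m, n))
    (J : set R) (a b : R) : a <= b ->
  (forall x, a <= x <= b -> J x) ->
  (forall s i j, J s -> {for s, continuous (fun u => A u i j)}) ->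
  exists2 K, 0 < K & forall s i j, a <= s <= b -> `|A s i j| <= K.
Proof.
move=> ab sub cA.
have bnd (ij : 'I_m * 'I_n) :
    exists K, forall s, a <= s <= b -> `|A s ij.1 ij.2| <= K.
  have /(EVT_max ab) [c cab Hc] : {within `[a, b], continuous
      (fun s => `|A s ij.1 ij.2|)}.
    apply: (continuous_in_J_within sub) => s Js.
    by apply: continuous_comp (cA s _ _ Js) (@norm_continuous _ _ _).
  by exists (`|A c ij.1 ij.2|) => s hs; apply: Hc; rewrite in_itv.
have [K HK] := choice bnd.
exists (1 + \sum_ij `|K ij|) => [|s i j hs].
  by rewrite ltr_pwDl// sumr_ge0.
apply: le_trans (HK (i, j) s hs) _; apply: le_trans (ler_norm _) _.
by rewrite (bigD1 (i, j))//= addrCA lerDl addr_ge0// sumr_ge0.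
Qed.

Lemma norm_mulmx_entry {R : realType} (m n p : nat) (A : 'M[R]_(m, n))
    (B : 'M[R]_(n, p)) (i : 'I_m) (j : 'I_p) (ca cb : R) :
  0 <= cb -> (forall i k, `|A i k| <= ca) -> (forall k j, `|B k j| <= cb) ->
  `|(A *m B) i j| <= n%:R * ca * cb.
Proof.
move=> cb0 hA hB; rewrite mxE; apply: le_trans (ler_norm_sum _ _ _) _.
apply: (@le_trans _ _ (\sum_(k < n) ca * cb)).
  by apply: ler_sum => k _; rewrite normrM ler_pM.
by rewrite sumr_const card_ord -mulrA mulr_natl.
Qed.

Lemma continuous_mulmx_entry {R : realType} {T : topologicalType} (m n p : nat)
    (A : T -> 'M[R]_(m, n)) (B : T -> 'M[R]_(n, p)) (s : T) :
  (forall i k, {for s, continuous (fun u => A u i k)}) ->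
  (forall k j, {for s, continuous (fun u => B u k j)}) ->
  forall i j, {for s, continuous (fun u => (A u *m B u) i j)}.
Proof.
move=> hA hB i j.
have -> : (fun u => (A u *m B u) i j) = (fun u => \sum_k A u i k * B u k j).
  by apply/funext => u; rewrite mxE.
by apply: cvg_big => [|k _]; [exact: add_continuous|apply: cvgM; [exact: hA|exact: hB]].
Qed.

Arguments continuous_mulmx_entry {R T m n p A B s} _ _ i j.

Lemma is_derive_continuous {R : realType} (g : R -> R) (s d : R) :
  is_derive s 1 g d -> {for s, continuous g}.
Proof. by move=> [/derivable1_diffP/differentiable_continuous]. Qed.

Lemma is_derive_entry {R : realType} {V : normedModType R} (m n : nat)
    (M : V -> 'M[R]_(m, n)) (x v : V) D i j :
  is_derive x v M D -> is_derive x v (fun y => M y i j) (D i j).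
Proof. by move=> /is_derive_mxP. Qed.

Lemma half_pow_small {R : realType} (x c : R) :
  (forall n, `|x| <= c * 2^-1 ^+ n) -> x = 0.
Proof.
move=> H; apply/normr0_eq0/eqP; rewrite eq_le normr_ge0 andbT.
have h : geometric c (2^-1 : R) @ \oo --> (0 : R).
  by apply: cvg_geometric; rewrite ger0_norm ?invr_ge0// invf_lt1 ?ltr1n.
by apply: (cvgr_to_ge h); near=> n; exact: H.
Unshelve. all: by end_near. Qed.

Lemma geometric_tail {R : realType} (d : nat -> R) (B : R) :
  (forall n, `|d n| <= B * 2^-1 ^+ n) ->
  forall n, `|limn (series d) - \sum_(0 <= k < n) d k| <= 2 * B * 2^-1 ^+ n.
Proof.
move=> hd n.
have B0 : 0 <= B by have := hd 0; rewrite expr0 mulr1; exact: le_trans.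
have cd : series d @ \oo --> limn (series d).
  apply: normed_cvg; apply: (@series_le_cvg _ _ (geometric B 2^-1)) => //.
  - by move=> k; exact: normr_ge0.
  - by move=> k; apply: (le_trans (normr_ge0 (d k))); exact: hd.
  - by apply: is_cvg_geometric_series; rewrite ger0_norm ?invr_ge0// invf_lt1 ?ltr1n.
have part p : `|\sum_(n <= k < n + p) d k|
    <= 2 * B * 2^-1 ^+ n - 2 * B * 2^-1 ^+ (n + p).
  elim: p => [|p IH]; first by rewrite addn0 big_geq// normr0 subrr.
  rewrite addnS big_nat_recr ?leq_addr//=.
  apply: le_trans (ler_normD _ _) _.
  by have := hd (n + p)%N; rewrite exprS; lra.
have c2 : (fun m => `|series d m - \sum_(0 <= k < n) d k|) @ \oo -->
    `|limn (series d) - \sum_(0 <= k < n) d k|.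
  by apply: cvg_norm; apply: cvgB => //; exact: cvg_cst.
apply: (cvgr_to_le c2); near=> m.
have nm : (n <= m)%N by near: m; exists n.
rewrite /series /= (big_cat_nat _ nm)//= addrAC subrr add0r -(subnKC nm).
apply: le_trans (part _) _.
by rewrite lerBlDr lerDl !mulr_ge0// exprn_ge0// invr_ge0.
Unshelve. all: by end_near. Qed.

(** Picard iteration, written as a series: measured against a growing exponential
    as in [bielecki], the terms [D n] decrease geometrically on every segment. *)
Lemma linear_ode_exists {R : realType} (m q : nat) (J : set R) (s0 : R)
    (A : R -> 'M[R]_m) (Y0 : 'M[R]_(m, q)) :
  open J -> is_interval J -> J s0 ->
  (forall s i j, J s -> {for s, continuous (fun u => A u i j)}) ->
  exists Y : R -> 'M[R]_(m, q),
    Y s0 = Y0 /\ forall s, J s -> is_derive s 1 Y (A s *m Y s).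
Proof.
move=> oJ iJ J0 cA.
have /choice[P HP] : forall g : R -> R, exists G : R -> R,
    (forall s, J s -> {for s, continuous g}) ->
    G s0 = 0 /\ forall s, J s -> is_derive s 1 G (g s).
  move=> g; have [cg|/asboolPn ncg] := asboolP (forall s, J s -> {for s, continuous g}).
    by have [G HG] := primitive_exists oJ iJ J0 cg; exists G.
  by exists g => /asboolP; rewrite (negbTE ncg).
pose fix D n : R -> 'M[R]_(m, q) := if n is n'.+1 then
  fun s => \matrix_(i, j) P (fun u => (A u *m D n' u) i j) s else cst Y0.
have cD n : forall s i j, J s -> {for s, continuous (fun u => D n u i j)}.
  elim: n => [|n IH] s i j Js; first exact: cst_continuous.
  have [_ H] := HP _ (fun s Js => continuous_mulmx_entry
    (fun i k => cA s i k Js) (fun k j => IH s k j Js) i j).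
  have -> : (fun u => D n.+1 u i j) = P (fun u => (A u *m D n u) i j).
    by apply/funext => u; rewrite mxE.
  exact: is_derive_continuous (H s Js).
have D0 n i j : D n.+1 s0 i j = 0.
  have [H _] := HP _ (fun s Js => continuous_mulmx_entry
    (fun i k => cA s i k Js) (fun k j => cD n s k j Js) i j).
  by rewrite mxE.
have dD n s : J s -> is_derive s 1 (D n.+1) (A s *m D n s).
  move=> Js; apply/is_derive_mxP => i j.
  have [_ H] := HP _ (fun s Js => continuous_mulmx_entry
    (fun i k => cA s i k Js) (fun k j => cD n s k j Js) i j).
  have -> : (fun u => D n.+1 u i j) = P (fun u => (A u *m D n u) i j).
    by apply/funext => u; rewrite mxE.
  exact: H.
pose S n s : 'M[R]_(m, q) := \sum_(0 <= k < n) D k s.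
have SS n : S n.+1 = S n + D n.
  by apply/funext => s; rewrite /S big_nat_recr.
have dS n s : J s -> is_derive s 1 (S n.+1) (A s *m S n s).
  move=> Js; elim: n => [|n IH].
    rewrite {2}/S big_geq// mulmx0.
    have -> : S 1%N = cst Y0 by apply/funext => u; rewrite /S big_nat1.
    exact: is_derive_cst.
  have -> : A s *m S n.+1 s = A s *m S n s + A s *m D n s.
    by rewrite SS fctE mulmxDr.
  by rewrite SS; exact: is_deriveD IH (dD n s Js).
pose Y s : 'M[R]_(m, q) := \matrix_(i, j) limn (series (fun k => D k s i j)).
have est a b : a <= s0 <= b -> (forall x, a <= x <= b -> J x) ->
    exists K B, [/\ 0 <= K, 0 <= B,
      (forall s i j, a <= s <= b -> `|A s i j| <= K) &
      forall n s i j, a <= s <= b -> `|(Y s - S n s) i j| <= B * 2^-1 ^+ n].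
  move=> as0b sub; have ab : a <= b by lra.
  have [K K0 HK] := continuous_bounded_mx ab sub cA.
  pose y0 := \sum_ij `|Y0 ij.1 ij.2|.
  have y00 : 0 <= y0 by apply: sumr_ge0.
  have hY0 i j : `|Y0 i j| <= y0.
    by rewrite /y0 (bigD1 (i, j))//= lerDl sumr_ge0.
  (* [l] is large enough for each integration to gain a factor 2 *)
  pose l := 2 * (m%:R * K + 1).
  have mK : 0 <= m%:R * K by rewrite mulr_ge0// ltW.
  have l0 : 0 < l by rewrite /l; lra.
  have bD n s i j : a <= s <= b ->
      `|D n s i j| <= y0 * 2^-1 ^+ n * expR (l * `|s - s0|).
    elim: n s i j => [|n IH] s i j hs.
      rewrite expr0 mulr1 /=; apply: le_trans (hY0 i j) _.
      by rewrite ler_peMr// -expR0 ler_expR mulr_ge0// ltW.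
    have btwE u : btw s0 s u -> a <= u <= b by rewrite /btw => /orP[]; lra.
    have := @bielecki R (fun u => D n.+1 u i j)
      (fun u => (A u *m D n u) i j) s0 s l (m%:R * K * (y0 * 2^-1 ^+ n)) l0
      (D0 n i j).
    move=> H; apply: le_trans (H _ _) _ => [u /btwE hu|u /btwE hu|].
    - exact: is_derive_entry (dD n u (sub u hu)).
    - rewrite -[_ * expR _]mulrA; apply: norm_mulmx_entry => [|i' k|k j'].
      + by rewrite !mulr_ge0// ?expR_ge0// exprn_ge0// invr_ge0.
      + exact: HK.
      + exact: IH.
    - rewrite ler_pM2r ?expR_gt0// exprS ler_pdivrMr//.
      have : 0 <= y0 * 2^-1 ^+ n by rewrite mulr_ge0// exprn_ge0// invr_ge0.
      by rewrite /l [y0 * (_ * _)]mulrCA; set z := y0 * _ => z0; nra.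
  pose B := y0 * expR (l * (b - a)).
  exists K, (2 * B); split => //; [exact: ltW|by rewrite !mulr_ge0// expR_ge0|].
  move=> n s i j hs.
  have -> : (Y s - S n s) i j = limn (series (fun k => D k s i j))
      - \sum_(0 <= k < n) D k s i j by rewrite !mxE summxE.
  apply: geometric_tail => k; apply: le_trans (bD k s i j hs) _.
  rewrite mulrAC ler_wpM2r ?exprn_ge0 ?invr_ge0// ler_wpM2l// ler_expR.
  by apply: ler_wpM2l; [exact: ltW|rewrite ler_norml; lra].
have cY s i j : J s -> {for s, continuous (fun u => Y u i j)}.
  move=> Js; have [a [b [h0 hs sub]]] := open_interval_segment oJ iJ J0 Js.
  have [||K [B [K0 B0 _ HB]]] := est a b => //; first by lra.
  apply/cvgrPdist_le => /= e e0.
  have [n Hn] : exists n, B * 2^-1 ^+ n <= e / 3.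
    have h : geometric B (2^-1 : R) @ \oo --> (0 : R).
      by apply: cvg_geometric; rewrite ger0_norm ?invr_ge0// invf_lt1 ?ltr1n.
    have e3 : 0 < e / 3 by rewrite divr_gt0.
    have /cvgrPdist_le/(_ _ e3)[n _ Hn] := h.
    exists n; have := Hn n (leqnn n); rewrite sub0r normrN.
    exact: le_trans (ler_norm _).
  have cS : {for s, continuous (fun u => S n u i j)}.
    case: n {Hn} => [|n].
      have -> : (fun u => S 0 u i j) = cst 0.
        by apply/funext => u; rewrite /S big_geq// mxE.
      exact: cst_continuous.
    exact: is_derive_continuous (is_derive_entry i j (dS n s Js)).
  have e3 : 0 < e / 3 by rewrite divr_gt0.
  have /cvgrPdist_le/(_ _ e3) cS' := cS.
  near=> x.
  have hx : a <= x <= b.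
    apply/andP; split; apply: ltW; near: x.
      by apply: lt_nbhsr; case/andP: hs.
    by apply: lt_nbhsl; case/andP: hs.
  have h1 : `|S n s i j - S n x i j| <= e / 3 by near: x.
  have h2 := HB n x i j hx; have h3 := HB n s i j; rewrite !mxE in h2 h3.
  have {}h3 := h3 (ltac:(lra)).
  have -> : Y s i j - Y x i j = (Y s i j - S n s i j) +
    (S n s i j - S n x i j) - (Y x i j - S n x i j) by ring.
  apply: le_trans (ler_normB _ _) _.
  have := ler_normD (Y s i j - S n s i j) (S n s i j - S n x i j).
  by rewrite !mxE; lra.
have YE s i j : J s -> Y s i j = Y0 i j + P (fun u => (A u *m Y u) i j) s.
  move=> Js; have [a [b [h0 hs sub]]] := open_interval_segment oJ iJ J0 Js.
  have [||K [B [K0 B0 HK HB]]] := est a b => //; first by lra.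
  have [P0 dP] := HP _ (fun s Js => continuous_mulmx_entry
    (fun i k => cA s i k Js) (fun k j => cY s k j Js) i j).
  set G := P _ in P0 dP *.
  apply/eqP; rewrite -subr_eq0; apply/eqP.
  apply: (@half_pow_small _ _ (B + m%:R * K * B * expR (1 * `|s - s0|))) => n.
  pose E u := S n.+1 u i j - Y0 i j - G u.
  have hE : `|E s| <= m%:R * K * (B * 2^-1 ^+ n) / 1 * expR (1 * `|s - s0|).
    have btwE u : btw s0 s u -> a <= u <= b by rewrite /btw => /orP[]; lra.
    apply: (@bielecki R E (fun u => - (A u *m (Y u - S n u)) i j)) => //.
    - rewrite /E P0 subr0 /S big_nat_recl//= mxE summxE.
      by rewrite big1 ?addr0 ?subrr// => k _; rewrite D0.
    - move=> u /btwE hu.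
      have d1 := is_derive_entry i j (dS n u (sub u hu)).
      have d2 := dP u (sub u hu).
      have -> : E = (fun u => S n.+1 u i j) - cst (Y0 i j) - G by [].
      by apply: is_derive_eq; rewrite mulmxBr !mxE subr0 opprB.
    - move=> u /btwE hu; rewrite normrN.
      have h1 : `|(A u *m (Y u - S n u)) i j| <= m%:R * K * (B * 2^-1 ^+ n).
        apply: norm_mulmx_entry => [|i' k|k j'].
        + by rewrite mulr_ge0// exprn_ge0// invr_ge0.
        + exact: HK.
        + exact: HB.
      apply: le_trans h1 _; rewrite ler_peMr//.
        by rewrite !mulr_ge0// exprn_ge0// invr_ge0.
      by rewrite mul1r -expR0 ler_expR.
  have h2 := HB n.+1 s i j (ltac:(lra)).
  have -> : Y s i j - (Y0 i j + G s) = (Y s - S n.+1 s) i j + E s.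
    by rewrite /E !mxE; ring.
  apply: le_trans (ler_normD _ _) _.
  rewrite mulrDl; apply: lerD.
    apply: le_trans h2 _; rewrite exprS; apply: ler_wpM2l => //.
    have : 0 <= 2^-1 ^+ n :> R by rewrite exprn_ge0// invr_ge0.
    by lra.
  by apply: le_trans hE _; rewrite divr1 mulrA mulrAC.
have dY s : J s -> is_derive s 1 Y (A s *m Y s).
  move=> Js; apply/is_derive_mxP => i j.
  have [P0 dP] := HP _ (fun s Js => continuous_mulmx_entry
    (fun i k => cA s i k Js) (fun k j => cY s k j Js) i j).
  have h : is_derive s 1 (cst (Y0 i j) + P (fun u => (A u *m Y u) i j))
      ((A s *m Y s) i j).
    by have h1 := dP s Js; apply: is_derive_eq; rewrite add0r.
  apply: near_eq_is_derive h.
  have : nbhs s J by apply: open_nbhs_nbhs.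
  by apply: filterS => x Jx; rewrite YE.
exists Y; split => //; apply/matrixP => i j; rewrite YE//.
have [-> _] := HP _ (fun s Js => continuous_mulmx_entry
    (fun i k => cA s i k Js) (fun k j => cY s k j Js) i j).
by rewrite addr0.
Unshelve. all: by end_near. Qed.

Lemma sum_mulmx_bound {R : realType} (m q : nat) (A : 'M[R]_m) (E : 'M[R]_(m, q))
    (a N : R) : (forall i k, `|A i k| <= a) ->
  (forall i j, E i j ^+ 2 <= N) ->
  `|\sum_ij E ij.1 ij.2 * (A *m E) ij.1 ij.2| <= (m * q)%:R * m%:R * a * N.
Proof.
move=> hA hE; apply: le_trans (ler_norm_sum _ _ _) _.
apply: (@le_trans _ _ (\sum_(ij : 'I_m * 'I_q) m%:R * a * N)); last first.
  by rewrite sumr_const card_prod !card_ord -[_ *+ (m * q)]mulr_natl !mulrA.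
apply: ler_sum => -[i j] _ /=; rewrite mxE mulr_sumr.
apply: le_trans (ler_norm_sum _ _ _) _.
apply: (@le_trans _ _ (\sum_(k < m) a * N)); last first.
  by rewrite sumr_const card_ord -[_ *+ m]mulr_natl mulrA.
apply: ler_sum => k _; rewrite mulrCA normrM.
apply: ler_pM => //; rewrite ler_norml.
by have := hE i j; have := hE k j; have := sqr_ge0 (E i j - E k j);
  have := sqr_ge0 (E i j + E k j); rewrite !expr2; lra.
Qed.

(** Energy estimate for the difference of two solutions; uniqueness and
    continuous dependence on parameters are its two uses. *)
Lemma linear_ode_stability {R : realType} (m q : nat) (A B : R -> 'M[R]_m)
    (Y Z : R -> 'M[R]_(m, q)) (s0 s a d z k : R) :
  k = 2 * ((m * q)%:R * m%:R * a) + 1 ->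
  (forall u, btw s0 s u -> is_derive u 1 Y (A u *m Y u)) ->
  (forall u, btw s0 s u -> is_derive u 1 Z (B u *m Z u)) ->
  (forall u i j, btw s0 s u -> `|A u i j| <= a) ->
  (forall u i j, btw s0 s u -> `|(A u - B u) i j| <= d) ->
  (forall u i j, btw s0 s u -> `|Z u i j| <= z) ->
  0 <= a -> 0 <= d -> 0 <= z ->
  forall i j, (Y s i j - Z s i j) ^+ 2 <=
  (\sum_ij (Y s0 ij.1 ij.2 - Z s0 ij.1 ij.2) ^+ 2 +
     (m * q)%:R * (m%:R * d * z) ^+ 2 / k) * expR (k * `|s - s0|).
Proof.
move=> kE dY dZ hA hd hz a0 d0 z0 i j.
have k0 : 0 < k by rewrite kE ltr_wpDl// !mulr_ge0.
pose E u := Y u - Z u.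
pose N u := \sum_ij E u ij.1 ij.2 ^+ 2.
pose G u := (A u - B u) *m Z u.
pose dN u := \sum_ij (2 * E u ij.1 ij.2) * (A u *m E u + G u) ij.1 ij.2.
have hN u : btw s0 s u -> is_derive u 1 N (dN u).
  move=> hu.
  have hE : is_derive u 1 E (A u *m E u + G u).
    have h1 := dY u hu; have h2 := dZ u hu.
    apply: is_derive_eq; rewrite /E /G mulmxBr mulmxBl.
    by rewrite addrA addrNK.
  have -> : N = \sum_ij (fun u => E u ij.1 ij.2 ^+ 2).
    by apply/funext => v; rewrite fct_sumE.
  have sq ij : is_derive u 1 (fun u => E u ij.1 ij.2 ^+ 2)
      ((2 * E u ij.1 ij.2) * (A u *m E u + G u) ij.1 ij.2).
    have h := is_derive_entry ij.1 ij.2 hE.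
    apply: (is_derive_eq (is_deriveX 2 h)).
    by rewrite -![_ *: _]/(_ * _) expr1.
  rewrite /dN; elim/big_ind2 : _ => [|f1 f2 g1 g2 h1 h2|ij _]; last exact: sq.
    exact: is_derive_cst.
  exact: is_deriveD.
have addE (U V : 'M[R]_(m, q)) i' j' : (U + V) i' j' = U i' j' + V i' j'.
  by rewrite mxE.
have sqN u i' j' : E u i' j' ^+ 2 <= N u.
  rewrite /N (bigD1 (i', j'))//= lerDl.
  by apply: sumr_ge0 => ij _; exact: sqr_ge0.
have bN u : btw s0 s u -> `|dN u| <= k * N u + (m * q)%:R * (m%:R * d * z) ^+ 2.
  move=> hu; have -> : dN u = 2 * (\sum_ij E u ij.1 ij.2 * (A u *m E u) ij.1 ij.2)
      + \sum_ij 2 * (E u ij.1 ij.2 * G u ij.1 ij.2).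
    rewrite /dN mulr_sumr -big_split; apply: eq_bigr => ij _ /=.
    by rewrite (addE (A u *m E u)) mulrDr -!mulrA.
  have h1 := sum_mulmx_bound (fun i' k' => hA u i' k' hu) (sqN u).
  have h2 : `|\sum_ij 2 * (E u ij.1 ij.2 * G u ij.1 ij.2)| <=
      N u + (m * q)%:R * (m%:R * d * z) ^+ 2.
    apply: le_trans (ler_norm_sum _ _ _) _.
    have -> : (m * q)%:R * (m%:R * d * z) ^+ 2 =
        \sum_(ij : 'I_m * 'I_q) (m%:R * d * z) ^+ 2.
      by rewrite sumr_const card_prod !card_ord mulr_natl.
    rewrite /N -big_split; apply: ler_sum => -[i' j'] _ /=.
    have hG : `|G u i' j'| <= m%:R * d * z.
      apply: norm_mulmx_entry => // [i1 k1|k1 j1]; [exact: hd|exact: hz].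
    have hG2 : G u i' j' ^+ 2 <= (m%:R * d * z) ^+ 2.
      by rewrite -real_normK ?num_real// lerXn2r ?nnegrE ?mulr_ge0.
    apply: (@le_trans _ _ (E u i' j' ^+ 2 + G u i' j' ^+ 2)); last by rewrite lerD2l.
    rewrite ler_norml; have := sqr_ge0 (E u i' j' - G u i' j').
    by have := sqr_ge0 (E u i' j' + G u i' j'); rewrite !expr2; lra.
  apply: le_trans (ler_normD _ _) _.
  rewrite normrM ger0_norm// kE; lra.
have := gronwall k0 hN bN.
have -> : (Y s i j - Z s i j) ^+ 2 = E s i j ^+ 2 by rewrite /E !mxE.
have -> : \sum_ij (Y s0 ij.1 ij.2 - Z s0 ij.1 ij.2) ^+ 2 = N s0.
  by apply: eq_bigr => ij _; rewrite /E !mxE.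
move=> H; apply: le_trans (sqN s i j) (le_trans H _).
by rewrite lerBlDr lerDl !mulr_ge0 ?invr_ge0 ?sqr_ge0// ltW.
Qed.

Lemma linear_ode_unique {R : realType} (m q : nat) (J : set R) (s0 : R)
    (A : R -> 'M[R]_m) (Y Z : R -> 'M[R]_(m, q)) :
  is_interval J -> J s0 ->
  (forall s i j, J s -> {for s, continuous (fun u => A u i j)}) ->
  (forall s, J s -> is_derive s 1 Y (A s *m Y s)) ->
  (forall s, J s -> is_derive s 1 Z (A s *m Z s)) ->
  Y s0 = Z s0 -> forall s, J s -> Y s = Z s.
Proof.
move=> iJ J0 cA dY dZ E0 s Js.
have sub u : btw s0 s u -> J u.
  by move=> /orP[]; [exact: iJ|exact: iJ].
have [K K0 HK] : exists2 K, 0 < K & forall u i j, btw s0 s u -> `|A u i j| <= K.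
  have [le|/ltW le] := leP s0 s.
    have [x hx|K K0 HK] := continuous_bounded_mx le _ cA.
      by apply: sub; rewrite /btw hx.
    by exists K => // u i j hu; apply: HK; move: hu => /orP[]; lra.
  have [x hx|K K0 HK] := continuous_bounded_mx le _ cA.
    by apply: sub; rewrite /btw hx orbT.
  by exists K => // u i j hu; apply: HK; move: hu => /orP[]; lra.
have dYZ u : btw s0 s u -> is_derive u 1 (Y - Z) (A u *m (Y - Z) u).
  move=> /sub Ju; have h1 := dY u Ju; have h2 := dZ u Ju.
  by apply: is_derive_eq; rewrite !fctE mulmxBr.
have d0 u : btw s0 s u -> is_derive u 1 (cst (0 : 'M[R]_(m, q))) (A u *m 0).
  by move=> _; rewrite mulmx0; exact: is_derive_cst.
have := @linear_ode_stability R m q A A (Y - Z) (cst 0) s0 s K 0 0 _ erefl dYZ d0 HK.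
move=> H; apply/eqP; rewrite -subr_eq0; apply/eqP/matrixP => i j; rewrite mxE.
have h1 u i' j' : btw s0 s u -> `|(A u - A u) i' j'| <= 0.
  by rewrite subrr mxE normr0.
have h2 u i' j' : btw s0 s u -> `|cst (0 : 'M[R]_(m, q)) u i' j'| <= 0.
  by rewrite mxE normr0.
have h := H h1 h2 (ltW K0) (lexx 0) (lexx 0) i j.
have E0' : \sum_ij ((Y - Z) s0 ij.1 ij.2 - cst (0 : 'M[R]_(m, q)) s0 ij.1 ij.2) ^+ 2
    = 0.
  by rewrite big1// => ij _; rewrite !fctE E0 subrr !mxE subr0 expr0n.
rewrite E0' mulr0 expr0n mulr0 mul0r addr0 mul0r in h.
apply/eqP; rewrite [X in _ == X]mxE -sqrf_eq0 eq_le sqr_ge0 andbT.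
by move: h; rewrite !fctE !mxE subr0.
Qed.

(** * Smooth maps on a strip *)

Lemma differentiable_near0 {R : realType} {V W : normedModType R} (d : V -> W) (x : V) :
  (\near x, d x = 0) -> differentiable d x.
Proof.
move=> d0; have dx0 : d x = 0 by apply: nbhs_singleton d0.
have E : continuous (0 : V -> W) /\ d \o shift x = cst (d x) + \0 +o_ 0 id.
  split; first exact: cst_continuous.
  apply/eqaddoP => e e0; near=> h => /=.
  rewrite !fctE /= dx0 addr0 subr0.
  have -> : d (h + x) = 0.
    by near: h; move: d0; rewrite (near_shift 0) /= subr0.
  by rewrite normr0 mulr_ge0// ltW.
have dE : ('d d x : V -> W) = 0 by apply/diff_unique; have [] := E.
by apply/diff_locallyP; rewrite dE.
Unshelve. all: by end_near. Qed.

Lemma near_differentiable {R : realType} {V W : normedModType R} (f g : V -> W)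
    (x : V) : (\near x, f x = g x) -> differentiable f x -> differentiable g x.
Proof.
move=> fg df.
have -> : g = f + (g - f) by apply/funext => y; rewrite !fctE addrC subrK.
apply: differentiableD => //; apply: differentiable_near0.
by apply: filterS fg => y fgy; rewrite !fctE fgy subrr.
Qed.

Lemma differentiable_mx {R : realType} {V : normedModType R} (n : nat)
    (F : V -> 'rV[R]_n) (x : V) :
  (forall j, differentiable (fun y => F y 0 j) x) -> differentiable F x.
Proof.
move=> h; have -> : F = \sum_(j < n) (fun y => F y 0 j *: (delta_mx 0 j : 'rV[R]_n)).
  by apply/funext => y; rewrite fct_sumE [LHS]row_sum_delta.
by apply: differentiable_sum => j; apply: differentiableZl.
Qed.

Lemma differentiable_entry {R : realType} {V : normedModType R} (m n : nat)
    (F : V -> 'M[R]_(m, n)) (x : V) i j :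
  differentiable F x -> differentiable (fun y => F y i j) x.
Proof.
move=> dF; exact: differentiable_comp dF (differentiable_coord (F x) i j).
Qed.

Lemma strip_open {R : realType} (J : set R) : open J -> open (strip J).
Proof.
move=> oJ; apply: (open_comp (f := fun p : 'rV[R]_2 => p 0 0)) => // p _.
exact: coord_continuous.
Qed.

Lemma strip_near {R : realType} (J : set R) p :
  open J -> strip J p -> \near p, strip J p.
Proof. by move=> /strip_open oS Jp; apply: open_nbhs_nbhs. Qed.

Lemma pd_eq_on {R : realType} {W : normedModType R} (M : set 'rV[R]_2) i
    (F G : 'rV[R]_2 -> W) p :
  open M -> M p -> (forall q, M q -> F q = G q) -> pd i F p = pd i G p.
Proof.
move=> oM Mp FG; apply: near_eq_derive.
have : \near p, M p by apply: open_nbhs_nbhs.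
exact: filterS.
Qed.

(** Iterated partial derivatives cannot leave a class of maps that is closed under
    the two partial derivatives up to equality on [M]. *)
Lemma smooth_on_coind {R : realType} {W : normedModType R} (M : set 'rV[R]_2)
    (P : ('rV[R]_2 -> W) -> Prop) : open M ->
  (forall F, P F -> forall p, M p -> differentiable F p) ->
  (forall F i, P F -> exists2 G, P G & forall p, M p -> pd i F p = G p) ->
  forall F, P F -> smooth_on M F.
Proof.
move=> oM Pd Pp F PF l p Mp.
have [G PG EG] : exists2 G, P G & forall p, M p -> iter_pd l F p = G p.
  elim: l => [|i l [G PG EG]]; first by exists F.
  have [G' PG' EG'] := Pp G i PG; exists G' => // q Mq /=.
  by rewrite (pd_eq_on i oM Mq EG) EG'.
apply: near_differentiable (Pd _ PG p Mp).
have : \near p, M p by apply: open_nbhs_nbhs.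
by apply: filterS => q Mq; rewrite EG.
Qed.

(** * Smooth functions of one variable *)

Definition smooth1 {R : realType} (J : set R) (u : R -> R) : Prop :=
  forall (k : nat) (s : R), J s -> derivable (derive1n k u) s 1.

(** Bounding the order makes the closure properties provable by induction on it. *)
Fixpoint Cn {R : realType} (n : nat) (J : set R) (u : R -> R) : Prop :=
  (forall s, J s -> derivable u s 1) /\
  (if n is n'.+1 then Cn n' J (derive1 u) else True).

Lemma smooth1_Cn {R : realType} (J : set R) (u : R -> R) :
  smooth1 J u <-> forall n, Cn n J u.
Proof.
split=> [h n|h k].
  elim: n u h => [|n IH] u h /=; first by split=> // s; exact: (h 0).
  by split=> [s|]; [exact: (h 0)|apply: IH => k s Js; have := h k.+1 s Js; rewrite derive1Sn].
suff H n v : Cn n J v -> forall s, J s -> derivable (derive1n n v) s 1 by exact: H.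
elim: n v => [|n IH] v [h1 h2]; first exact: h1.
by move=> s Js; rewrite derive1Sn; exact: IH.
Qed.

Lemma Cn_derivable {R : realType} n (J : set R) (u : R -> R) s :
  Cn n J u -> J s -> derivable u s 1.
Proof. by case: n => [|n] [h _] /h. Qed.

Lemma CnW {R : realType} n (J : set R) (u : R -> R) : Cn n.+1 J u -> Cn n J u.
Proof.
elim: n u => [|n IH] u [h1 h2]; first by split.
by split=> //; exact: IH.
Qed.

Lemma near_open {R : realType} (J : set R) s : open J -> J s -> \near s, J s.
Proof. by move=> oJ Js; apply: open_nbhs_nbhs. Qed.

Lemma Cn_ext {R : realType} n (J : set R) (u v : R -> R) : open J ->
  (forall s, J s -> u s = v s) -> Cn n J u -> Cn n J v.
Proof.
move=> oJ; elim: n u v => [|n IH] u v uv [h1 h2].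
  split=> // s Js; apply: near_eq_derivable (h1 s Js).
  by apply: filterS (near_open oJ Js).
split=> [s Js|].
  apply: near_eq_derivable (h1 s Js).
  by apply: filterS (near_open oJ Js).
apply: IH h2 => s Js; rewrite !derive1E; apply: near_eq_derive.
by apply: filterS (near_open oJ Js).
Qed.

Lemma CnS {R : realType} n (J : set R) (u u' : R -> R) : open J ->
  (forall s, J s -> is_derive s 1 u (u' s)) -> Cn n J u' -> Cn n.+1 J u.
Proof.
move=> oJ du h; split=> [s /du[]//|].
by apply: Cn_ext h => // s /du [_ <-]; rewrite derive1E.
Qed.

Lemma Cn_is_derive {R : realType} n (J : set R) (u : R -> R) s :
  Cn n J u -> J s -> is_derive s 1 u (derive1 u s).
Proof. by move=> h Js; rewrite derive1E; apply/derivableP/(Cn_derivable h). Qed.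

Lemma Cn_cst {R : realType} n (J : set R) (c : R) : open J -> Cn n J (fun=> c).
Proof.
move=> oJ; elim: n c => [|n IH] c; first by split=> // s _; exact: derivable_cst.
by apply: (CnS (u' := fun=> 0)) => // s _; exact: is_derive_cst.
Qed.

Lemma CnD {R : realType} n (J : set R) (u v : R -> R) : open J ->
  Cn n J u -> Cn n J v -> Cn n J (fun s => u s + v s).
Proof.
move=> oJ; elim: n u v => [|n IH] u v hu hv.
  by split=> // s Js; apply: derivableD; apply: Cn_derivable Js; eassumption.
apply: (CnS (u' := fun s => derive1 u s + derive1 v s)) => // [s Js|].
  by have h1 := Cn_is_derive hu Js; have h2 := Cn_is_derive hv Js; exact: is_deriveD.
by apply: IH; [case: hu|case: hv].
Qed.

Lemma CnM {R : realType} n (J : set R) (u v : R -> R) : open J ->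
  Cn n J u -> Cn n J v -> Cn n J (fun s => u s * v s).
Proof.
move=> oJ; elim: n u v => [|n IH] u v hu hv.
  by split=> // s Js; apply: derivableM; apply: Cn_derivable Js; eassumption.
apply: (CnS (u' := fun s => derive1 u s * v s + u s * derive1 v s)) => // [s Js|].
  by apply: is_derive_comb; apply: Cn_is_derive Js; eassumption.
by apply: CnD => //; apply: IH; by [exact: CnW|case: hu|case: hv].
Qed.

Lemma Cn_sum {R : realType} n (J : set R) (I : Type) (r : seq I)
    (u : I -> R -> R) : open J ->
  (forall i, Cn n J (u i)) -> Cn n J (fun s => \sum_(i <- r) u i s).
Proof.
move=> oJ hu; elim: r => [|i r IH].
  by apply: Cn_ext (Cn_cst n 0 oJ) => // s _; rewrite big_nil.
by apply: Cn_ext (CnD oJ (hu i) IH) => // s _; rewrite big_cons.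
Qed.

Lemma is_derive_powR_comp {R : realType} (u : R -> R) (a s d : R) : 0 < u s ->
  is_derive s 1 u d ->
  is_derive s 1 (fun y => u y `^ a) (a * u s `^ (a - 1) * d).
Proof.
move=> u0 hu.
exact: (is_derive1_comp (f := fun x => x `^ a) (is_derive1_powR a u0) hu).
Qed.

Lemma Cn_powR {R : realType} n (J : set R) (u : R -> R) (a : R) : open J ->
  (forall s, J s -> 0 < u s) -> Cn n J u -> Cn n J (fun s => u s `^ a).
Proof.
move=> oJ u0; elim: n a => [|n IH] a hu.
  split=> // s Js.
  by have [] := is_derive_powR_comp a (u0 s Js) (Cn_is_derive hu Js).
apply: (CnS (u' := fun s => a * u s `^ (a - 1) * derive1 u s)) => // [s Js|].
  by apply: is_derive_powR_comp; [exact: u0|exact: Cn_is_derive hu Js].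
apply: CnM => //; last by case: hu.
by apply: CnM => //; [exact: Cn_cst|apply: IH; exact: CnW].
Qed.

Lemma smooth1_ext {R : realType} (J : set R) (u v : R -> R) : open J ->
  (forall s, J s -> u s = v s) -> smooth1 J u -> smooth1 J v.
Proof.
by move=> oJ uv /smooth1_Cn h; apply/smooth1_Cn => n; apply: Cn_ext (h n).
Qed.

Lemma smooth1_cst {R : realType} (J : set R) (c : R) :
  open J -> smooth1 J (fun=> c).
Proof. by move=> oJ; apply/smooth1_Cn => n; exact: Cn_cst. Qed.

Lemma smooth1D {R : realType} (J : set R) (u v : R -> R) : open J ->
  smooth1 J u -> smooth1 J v -> smooth1 J (fun s => u s + v s).
Proof.
by move=> oJ /smooth1_Cn h1 /smooth1_Cn h2; apply/smooth1_Cn => n; exact: CnD.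
Qed.

Lemma smooth1M {R : realType} (J : set R) (u v : R -> R) : open J ->
  smooth1 J u -> smooth1 J v -> smooth1 J (fun s => u s * v s).
Proof.
by move=> oJ /smooth1_Cn h1 /smooth1_Cn h2; apply/smooth1_Cn => n; exact: CnM.
Qed.

Lemma smooth1_sum {R : realType} (J : set R) (I : Type) (r : seq I)
    (u : I -> R -> R) : open J ->
  (forall i, smooth1 J (u i)) -> smooth1 J (fun s => \sum_(i <- r) u i s).
Proof.
move=> oJ h; apply/smooth1_Cn => n; apply: Cn_sum => // i.
by have /smooth1_Cn := h i.
Qed.

Lemma smooth1_powR {R : realType} (J : set R) (u : R -> R) (a : R) : open J ->
  (forall s, J s -> 0 < u s) -> smooth1 J u -> smooth1 J (fun s => u s `^ a).
Proof.
by move=> oJ u0 /smooth1_Cn h; apply/smooth1_Cn => n; exact: Cn_powR.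
Qed.

Lemma smooth1_derive1 {R : realType} (J : set R) (u : R -> R) :
  smooth1 J u -> smooth1 J (derive1 u).
Proof. by move=> h k s Js; have := h k.+1 s Js; rewrite derive1Sn. Qed.

Lemma smooth1_is_derive {R : realType} (J : set R) (u : R -> R) s :
  smooth1 J u -> J s -> is_derive s 1 u (derive1 u s).
Proof. by move=> /smooth1_Cn h; apply: (Cn_is_derive (h 0)). Qed.

Lemma smooth1_continuous {R : realType} (J : set R) (u : R -> R) s :
  smooth1 J u -> J s -> {for s, continuous u}.
Proof. by move=> h Js; exact: is_derive_continuous (smooth1_is_derive h Js). Qed.

(** The equation itself expresses the derivative of a solution by functions
    one degree less regular than it is claimed to be. *)
Lemma smooth1_linear_ode {R : realType} (m q : nat) (J : set R)
    (A : R -> 'M[R]_m) (Y : R -> 'M[R]_(m, q)) : open J ->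
  (forall i j, smooth1 J (fun s => A s i j)) ->
  (forall s, J s -> is_derive s 1 Y (A s *m Y s)) ->
  forall i j, smooth1 J (fun s => Y s i j).
Proof.
move=> oJ hA dY i j; apply/smooth1_Cn => n.
have dYij i' j' s : J s ->
    is_derive s 1 (fun u => Y u i' j') (\sum_k A s i' k * Y s k j').
  by move=> Js; have := is_derive_entry i' j' (dY s Js); rewrite mxE.
elim: n i j => [|n IH] i j; first by split=> // s /(dYij i j)[].
apply: (CnS oJ (dYij i j)); apply: Cn_sum => // k; apply: CnM => //.
by have /smooth1_Cn := hA i k.
Qed.

(** * Maps of one coordinate *)

Lemma is_derive_coord_same {R : realType} {W : normedModType R} (u : R -> W)
    (i : 'I_2) (p : 'rV[R]_2) (d : W) :
  is_derive (p 0 i) 1 u d ->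
  is_derive p (delta_mx 0 i) (fun q : 'rV[R]_2 => u (q 0 i)) d.
Proof.
have E : (fun h : R => h^-1 *: (u ((h *: delta_mx 0 i + p) 0 i) - u (p 0 i))) =
    (fun h : R => h^-1 *: (u (h *: 1 + p 0 i) - u (p 0 i))).
  by apply/funext => h; rewrite !mxE !eqxx.
by move=> [h1 h2]; apply: DeriveDef; [rewrite /derivable E|rewrite /derive E].
Qed.

Lemma is_derive_coord_other {R : realType} {W : normedModType R} (u : R -> W)
    (i j : 'I_2) (p : 'rV[R]_2) : i != j ->
  is_derive p (delta_mx 0 j) (fun q : 'rV[R]_2 => u (q 0 i)) 0.
Proof.
move=> ij; have h := is_derive_cst (u (p 0 i)) p (delta_mx 0 j).
have E : (fun h : R => h^-1 *: (u ((h *: delta_mx 0 j + p) 0 i) - u (p 0 i))) =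
    (fun h : R => h^-1 *: (cst (u (p 0 i)) (h *: delta_mx 0 j + p)
      - cst (u (p 0 i)) p)).
  by apply/funext => k; rewrite !mxE (negbTE ij) andbF mulr0 add0r.
by case: h => h1 h2; apply: DeriveDef; [rewrite /derivable E|rewrite /derive E].
Qed.

Lemma differentiable_coord_comp {R : realType} (u : R -> R) (i : 'I_2)
    (p : 'rV[R]_2) : derivable u (p 0 i) 1 ->
  differentiable (fun q : 'rV[R]_2 => u (q 0 i)) p.
Proof.
move=> /derivable1_diffP du.
exact: differentiable_comp (differentiable_coord p 0 i) du.
Qed.

Lemma differentiable_mulmx {R : realType} {V : normedModType R} (m n : nat)
    (F : V -> 'rV[R]_m) (G : V -> 'M[R]_(m, n)) (x : V) :
  (forall k, differentiable (fun y => F y 0 k) x) ->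
  (forall k j, differentiable (fun y => G y k j) x) ->
  differentiable (fun y => F y *m G y) x.
Proof.
move=> dF dG; apply: differentiable_mx => j.
have -> : (fun y => (F y *m G y) 0 j) =
    \sum_(k < m) ((fun y => F y 0 k) * (fun y => G y k j)).
  by apply/funext => y; rewrite fct_sumE mxE.
by apply: differentiable_sum => k; apply: differentiableM.
Qed.

(** The class of maps [u(s) *m Z(t)], with [Z] solving a linear equation with
    constant coefficients, is closed under both partial derivatives. *)
Lemma smooth_on_mulmx {R : realType} (m n : nat) (J : set R)
    (u : R -> 'rV[R]_m) (Z : R -> 'M[R]_(m, n)) (M : 'M[R]_m) : open J ->
  (forall k, smooth1 J (fun s => u s 0 k)) ->
  (forall t : R, is_derive t (1 : R) Z (M *m Z t)) ->
  smooth_on (strip J) (fun p => u (p 0 0) *m Z (p 0 1)).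
Proof.
move=> oJ hu dZ; have oS := strip_open oJ.
pose P (F : 'rV[R]_2 -> 'rV[R]_n) := exists2 v : R -> 'rV[R]_m,
  (forall k, smooth1 J (fun s => v s 0 k)) &
  forall p, strip J p -> F p = v (p 0 0) *m Z (p 0 1).
apply: (@smooth_on_coind _ _ _ P) => //; last by exists u.
  move=> F [v hv EF] p Jp.
  have h : differentiable (fun q : 'rV[R]_2 => v (q 0 0) *m Z (q 0 1)) p.
    apply: differentiable_mulmx => [k|k j].
      apply: (differentiable_coord_comp (u := fun s => v s 0 k)).
      by have [] := smooth1_is_derive (hv k) Jp.
    apply: (differentiable_coord_comp (u := fun t => Z t k j)).
    by have [] := is_derive_entry k j (dZ (p 0 1)).
  apply: near_differentiable h.
  by apply: filterS (strip_near oJ Jp) => q Jq; rewrite EF.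
move=> F i [v hv EF].
pose dv s : 'rV[R]_m := \row_k derive1 (fun s => v s 0 k) s.
have hdv s : J s -> is_derive s 1 v (dv s).
  move=> Js; apply/is_derive_mxP => i' k; rewrite ord1 mxE.
  exact: smooth1_is_derive.
have [i0|i1] : i = 0 \/ i = 1.
  by case: i => [[|[|//]] hi]; [left|right]; apply/val_inj.
- exists (fun p => dv (p 0 0) *m Z (p 0 1)).
    exists dv => // k; apply: smooth1_ext (smooth1_derive1 (hv k)) => // s _.
    by rewrite mxE.
  move=> p Jp; rewrite i0 (pd_eq_on 0 oS Jp EF).
  have h1 := is_derive_coord_same (hdv _ Jp).
  have h2 := @is_derive_coord_other _ _ Z 1 0 p isT.
  rewrite /pd; have [_ ->] := is_derive_mulmx h1 h2.
  by rewrite mulmx0 addr0.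
- exists (fun p => (v (p 0 0) *m M) *m Z (p 0 1)).
    exists (fun s => v s *m M) => // k.
    apply: (@smooth1_ext _ _ (fun s => \sum_j v s 0 j * M j k)) => //.
      by move=> s _; rewrite mxE.
    apply: smooth1_sum => // j; apply: smooth1M => //; exact: smooth1_cst.
  move=> p Jp; rewrite i1 (pd_eq_on 1 oS Jp EF).
  have h1 := @is_derive_coord_other _ _ v 0 1 p isT.
  have h2 := is_derive_coord_same (i := 1) (p := p) (dZ (p 0 1)).
  rewrite /pd; have [_ ->] := is_derive_mulmx h1 h2.
  by rewrite mul0mx add0r mulmxA.
Qed.

Lemma smooth_on_row {R : realType} (n : nat) (J : set R) (u : R -> 'rV[R]_n) :
  open J -> (forall k, smooth1 J (fun s => u s 0 k)) ->
  smooth_on (strip J) (fun p => u (p 0 0)).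
Proof.
move=> oJ hu.
have -> : (fun p : 'rV[R]_2 => u (p 0 0)) =
    (fun p : 'rV[R]_2 => u (p 0 0) *m cst 1%:M (p 0 1)).
  by apply/funext => p; rewrite mulmx1.
apply: (smooth_on_mulmx (M := 0)) => // t.
by rewrite mul0mx; exact: is_derive_cst.
Qed.

(** * The ambient bilinear form *)

Definition sig {R : realType} {n : nat} (eps : R) (i : 'I_n.+1) : R :=
  if (i == 0) && (eps < 0) then -1 else 1.

Lemma ambient_formE {R : realType} {n : nat} (eps : R) (x y : 'rV[R]_n.+1) :
  ambient_form eps x y = \sum_i sig eps i * (x 0 i * y 0 i).
Proof.
rewrite big_ord_recl /ambient_form /sig eqxx /=; congr (_ + _).
by apply: eq_bigr => i _; rewrite mul1r.
Qed.

Lemma ambientC {R : realType} {n : nat} (eps : R) (x y : 'rV[R]_n.+1) :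
  ambient_form eps x y = ambient_form eps y x.
Proof.
by rewrite !ambient_formE; apply: eq_bigr => i _; rewrite [y _ _ * _]mulrC.
Qed.

Lemma ambientDl {R : realType} {n : nat} (eps : R) (x y z : 'rV[R]_n.+1) :
  ambient_form eps (x + y) z = ambient_form eps x z + ambient_form eps y z.
Proof.
rewrite !ambient_formE -big_split; apply: eq_bigr => i _ /=.
by rewrite mxE mulrDl mulrDr.
Qed.

Lemma ambientZl {R : realType} {n : nat} (eps a : R) (x z : 'rV[R]_n.+1) :
  ambient_form eps (a *: x) z = a * ambient_form eps x z.
Proof.
rewrite !ambient_formE mulr_sumr; apply: eq_bigr => i _ /=.
by rewrite mxE; ring.
Qed.

Lemma ambient0l {R : realType} {n : nat} (eps : R) (z : 'rV[R]_n.+1) :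
  ambient_form eps 0 z = 0.
Proof. by have := ambientZl eps 0 0 z; rewrite scale0r mul0r. Qed.

Lemma ambientNl {R : realType} {n : nat} (eps : R) (x z : 'rV[R]_n.+1) :
  ambient_form eps (- x) z = - ambient_form eps x z.
Proof. by rewrite -scaleN1r ambientZl mulN1r. Qed.

Lemma ambientDr {R : realType} {n : nat} (eps : R) (x y z : 'rV[R]_n.+1) :
  ambient_form eps z (x + y) = ambient_form eps z x + ambient_form eps z y.
Proof. by rewrite ambientC ambientDl ![ambient_form _ _ z]ambientC. Qed.

Lemma ambientZr {R : realType} {n : nat} (eps a : R) (x z : 'rV[R]_n.+1) :
  ambient_form eps z (a *: x) = a * ambient_form eps z x.
Proof. by rewrite ambientC ambientZl ambientC. Qed.

Lemma ambient0r {R : realType} {n : nat} (eps : R) (z : 'rV[R]_n.+1) :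
  ambient_form eps z 0 = 0.
Proof. by rewrite ambientC ambient0l. Qed.

Lemma ambientNr {R : realType} {n : nat} (eps : R) (x z : 'rV[R]_n.+1) :
  ambient_form eps z (- x) = - ambient_form eps z x.
Proof. by rewrite ambientC ambientNl ambientC. Qed.

Definition ambientE := (@ambientDl, @ambientDr, @ambientZl, @ambientZr,
  @ambientNl, @ambientNr, @ambient0l, @ambient0r).

Lemma is_derive_ambient {R : realType} {V : normedModType R} {n : nat} (eps : R)
    (X Y : V -> 'rV[R]_n.+1) (p v : V) dX dY :
  is_derive p v X dX -> is_derive p v Y dY ->
  is_derive p v (fun q => ambient_form eps (X q) (Y q))
    (ambient_form eps dX (Y p) + ambient_form eps (X p) dY).
Proof.
move=> hX hY.
have -> : (fun q => ambient_form eps (X q) (Y q)) =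
    \sum_i (fun q => sig eps i * (X q 0 i * Y q 0 i)).
  by apply/funext => q; rewrite fct_sumE ambient_formE.
have h i : is_derive p v (fun q => sig eps i * (X q 0 i * Y q 0 i))
    (sig eps i * (dX 0 i * Y p 0 i + X p 0 i * dY 0 i)).
  apply: (is_deriveZ (sig eps i)).
  by apply: is_derive_comb; exact: is_derive_entry.
apply: (is_derive_eq (is_derive_sum h)).
rewrite !ambient_formE -big_split; apply: eq_bigr => i _ /=.
by rewrite mulrDr.
Qed.

(** The matrix of the ambient form. *)
Definition Gmx {R : realType} {n : nat} (eps : R) : 'M[R]_n.+1 :=
  diag_mx (\row_i sig eps i).

(** The inverse of the Gram matrix of a frame; in this form it also makes sense
    for [eps = 0], where the first row of a frame carries no condition. *)
Definition Dmx {R : realType} {n : nat} (eps : R) : 'M[R]_n.+1 :=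
  diag_mx (\row_i if i == 0 then eps else 1).

(** For [eps = 0] the position vector is shifted off the hyperplane, so that
    the frame matrix is invertible in every space form. *)
Definition shiftmx {R : realType} {n : nat} (eps : R) : 'M[R]_n.+1 :=
  (eps == 0)%:R *: delta_mx 0 0.

Lemma ambient_rows {R : realType} {m n : nat} (eps : R) (F H : 'M[R]_(m, n.+1)) i j :
  ambient_form eps (row i F) (row j H) = (F *m Gmx eps *m H^T) i j.
Proof.
rewrite ambient_formE mxE; apply: eq_bigr => k _.
by rewrite mul_mx_diag !mxE; ring.
Qed.

(** Along a solution of a linear equation with skew coefficients the Gram matrix
    satisfies a linear equation of which it is a constant solution. *)
Lemma gram_const {R : realType} (m : nat) (J : set R) (s0 : R)
    (A Y : R -> 'M[R]_m) (D : 'M[R]_m) :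
  is_interval J -> J s0 ->
  (forall s, J s -> is_derive s 1 Y (A s *m Y s)) ->
  (forall s, J s -> (A s)^T *m D + D *m A s = 0) ->
  forall s, J s -> (Y s)^T *m D *m Y s = (Y s0)^T *m D *m Y s0.
Proof.
move=> iJ J0 dY skew.
apply: (@linear_ode_unique _ _ _ J s0 (fun=> 0) (fun s => (Y s)^T *m D *m Y s)
  (fun=> (Y s0)^T *m D *m Y s0)) => // [s i j _|s Js|s Js].
- exact: cst_continuous.
- have h1 := is_derive_trmx (dY s Js).
  have h2 := is_derive_mulmx h1 (is_derive_cst D s (1 : R)).
  apply: (is_derive_eq (is_derive_mulmx h2 (dY s Js))).
  rewrite mulmx0 addr0 mul0mx trmx_mul !mulmxA -mulmxDl.
  by rewrite -!mulmxA -mulmxDr skew // mulmx0 mul0mx.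
- by rewrite mul0mx; exact: is_derive_cst.
Qed.

(** * Adapted frames and their Gram matrices *)

(** The standard basis, its first vector rescaled to lie on the space form. *)
Definition Phi0 {R : realType} {n : nat} (eps : R) : 'M[R]_n.+1 :=
  diag_mx (\row_i if (i == 0) && (eps != 0) then (Num.sqrt `|eps|)^-1 else 1).

(** Row 0 is a point of the space form, the other rows an orthonormal basis of its
    tangent space there. *)
Definition onframe {R : realType} {n : nat} (eps : R) (F : 'M[R]_n.+1) : Prop :=
  [/\ (forall i j, i != 0 -> j != 0 ->
         ambient_form eps (row i F) (row j F) = (i == j)%:R),
      (eps != 0 -> ambient_form eps (row 0 F) (row 0 F) = eps^-1 /\
         forall i, i != 0 -> ambient_form eps (row 0 F) (row i F) = 0),
      (eps = 0 -> forall i, F i 0 = 0) &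
      (eps < 0 -> 0 < F 0 0)].

Lemma Gmx_id {R : realType} {n : nat} (eps : R) :
  ~~ (eps < 0) -> Gmx eps = 1%:M :> 'M[R]_n.+1.
Proof.
move=> e0; apply/matrixP => i j; rewrite !mxE /sig (negbTE e0) andbF.
by case: (i == j).
Qed.

Lemma Phi0_gram {R : realType} {n : nat} (eps : R) : eps != 0 ->
  (Phi0 eps)^T *m Dmx eps *m Phi0 eps = Gmx eps :> 'M[R]_n.+1.
Proof.
move=> e0; rewrite tr_diag_mx !mulmx_diag; congr diag_mx.
apply/rowP => i; rewrite !mxE e0 andbT /sig.
case: eqP => _ /=; last by rewrite !mul1r.
have s0 : Num.sqrt `|eps| != 0 by rewrite sqrtr_eq0 -ltNge normr_gt0.
have E : Num.sqrt `|eps| ^+ 2 = `|eps| by rewrite sqr_sqrtr.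
rewrite mulrAC -invfM -expr2 E; have [lt|ge] := ltP eps 0.
  by rewrite ltr0_norm// invrN mulNr mulVf.
by rewrite ger0_norm// mulVf.
Qed.

Lemma Gmx_sqr {R : realType} {n : nat} (eps : R) :
  Gmx eps *m Gmx eps = 1%:M :> 'M[R]_n.+1.
Proof.
rewrite mulmx_diag; apply/matrixP => i j; rewrite !mxE /sig.
by case: ifP; rewrite ?mulrNN mulr1.
Qed.

(** A frame satisfies [F^T D F = G] along the structure equations; inverting this
    relation gives the scalar products of the rows. *)
Lemma onframe_gram_neq0 {R : realType} {n : nat} (eps : R) (F : 'M[R]_n.+1) :
  eps != 0 -> F^T *m Dmx eps *m F = Gmx eps ->
  forall i j, ambient_form eps (row i F) (row j F) =
    if i == j then (if i == 0 then eps^-1 else 1) else 0.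
Proof.
move=> e0 H i j; rewrite ambient_rows.
pose D' : 'M[R]_n.+1 := diag_mx (\row_i if i == 0 then eps^-1 else 1).
have DD' : Dmx eps *m D' = 1%:M.
  rewrite mulmx_diag; apply/matrixP => k l; rewrite !mxE.
  by case: (k == 0); rewrite ?mulfV// ?mulr1.
have H1 : F *m Gmx eps *m F^T *m Dmx eps = 1%:M.
  have H0 : (Gmx eps *m F^T *m Dmx eps) *m F = 1%:M.
    by rewrite -!mulmxA [F^T *m _]mulmxA H Gmx_sqr.
  by have := mulmx1C H0; rewrite !mulmxA.
have -> : F *m Gmx eps *m F^T = D'.
  by rewrite -[LHS]mulmx1 -DD' mulmxA H1 mul1mx.
by rewrite !mxE; case: (i == j).
Qed.

(** For [eps = 0] only the projection of the frame to the hyperplane is orthogonal. *)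
Lemma onframe_gram_eq0 {R : realType} {n : nat} (F : 'M[R]_n.+1) :
  F^T *m Dmx 0 *m F = Dmx 0 -> F *m delta_mx 0 0 = delta_mx 0 0 :> 'M[R]_n.+1 ->
  forall i j : 'I_n.+1, i != 0 -> j != 0 ->
  ambient_form 0 (row i (F - delta_mx 0 0)) (row j (F - delta_mx 0 0)) = (i == j)%:R.
Proof.
set P : 'M[R]_n.+1 := Dmx 0; set O : 'M[R]_n.+1 := delta_mx 0 0 => FPF FO.
have PO1 : P + O = 1%:M.
  apply/matrixP => i j; rewrite !mxE.
  case: (eqVneq i 0) => [->|i0] /=; last by rewrite addr0.
  by rewrite mul0rn add0r eq_sym.
have OO : O *m O = O by rewrite mul_delta_mx.
have PE : P = 1%:M - O by rewrite -PO1 addrK.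
have PO : P *m O = 0 by rewrite PE mulmxBl mul1mx OO subrr.
have OP : O *m P = 0 by rewrite PE mulmxBr mulmx1 OO subrr.
have PP : P *m P = P by rewrite {2}PE mulmxBr mulmx1 PO subr0.
have PT : P^T = P by rewrite tr_diag_mx.
have OT : O^T = O by rewrite trmx_delta.
pose H := P *m F + O.
have HH : H^T *m H = 1%:M.
  have -> : H^T = F^T *m P + O by rewrite [LHS]raddfD /= trmx_mul PT OT.
  rewrite /H mulmxDl !mulmxDr.
  rewrite mulmxA -[F^T *m P *m P]mulmxA PP FPF -[F^T *m P *m O]mulmxA PO mulmx0 addr0.
  by rewrite mulmxA OP mul0mx add0r OO.
have HH' := mulmx1C HH.
have E : P *m (F *m F^T) *m P = P.
  have : P *m (H *m H^T) *m P = P by rewrite HH' mulmx1 PP.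
  have OFP : O *m F^T *m P = O *m P by rewrite -{1}OT -trmx_mul FO OT.
  have -> : P *m (H *m H^T) *m P = (P *m H) *m (P *m H)^T.
    by rewrite trmx_mul PT !mulmxA.
  have -> : P *m H = P *m F by rewrite /H mulmxDr mulmxA PP PO addr0.
  by rewrite trmx_mul PT !mulmxA.
move=> i j i0 j0.
have rowE k : k != 0 -> row k (F - O) = row k (P *m F).
  move=> k0; apply/rowP => l; rewrite PE mulmxBl mul1mx !mxE (negbTE k0) /=.
  rewrite [X in _ = _ - X]big1 ?subr0// => m _.
  by rewrite !mxE (negbTE k0) mul0r.
rewrite !rowE// ambient_rows Gmx_id ?ltxx// mulmx1 trmx_mul PT.
by rewrite mulmxA -[P *m F *m F^T]mulmxA E !mxE (negbTE i0).
Qed.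

(** Used to see that a frame does not leave its sheet of the hyperboloid. *)
Lemma positive_of_neq0 {R : realType} (J : set R) (u : R -> R) (s0 s : R) :
  is_interval J -> J s0 -> (forall s, J s -> {for s, continuous u}) ->
  (forall s, J s -> u s != 0) -> 0 < u s0 -> J s -> 0 < u s.
Proof.
move=> iJ J0 cu u0 us0 Js; rewrite ltNge; apply/negP => us.
have ls : u s <= u s0 by apply: le_trans us (ltW us0).
have sub a b : J a -> J b -> forall x, a <= x <= b -> J x by exact: iJ.
have [le|/ltW le] := leP s0 s.
  have [||c] := @IVT _ u s0 s 0 le; [exact: continuous_in_J_within (sub _ _ J0 Js) cu| |].
    by rewrite (min_r ls) (max_l ls) us ltW.
  by rewrite in_itv => /(sub _ _ J0 Js)/u0/eqP.
have [||c] := @IVT _ u s s0 0 le; [exact: continuous_in_J_within (sub _ _ Js J0) cu| |].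
  by rewrite (min_l ls) (max_r ls) us ltW.
by rewrite in_itv => /(sub _ _ Js J0)/u0/eqP.
Qed.

Lemma smooth_on_pd {R : realType} {W : normedModType R} (M : set 'rV[R]_2)
    (F : 'rV[R]_2 -> W) i : smooth_on M F -> smooth_on M (pd i F).
Proof.
move=> h l p Mp; have := h (rcons l i) p Mp.
by rewrite /iter_pd foldr_rcons.
Qed.

Lemma smooth_on_differentiable {R : realType} {W : normedModType R}
    (M : set 'rV[R]_2) (F : 'rV[R]_2 -> W) p :
  smooth_on M F -> M p -> differentiable F p.
Proof. by move=> h; exact: (h [::]). Qed.

Lemma is_derive_pd {R : realType} {W : normedModType R} (F : 'rV[R]_2 -> W) p i :
  differentiable F p -> is_derive p (delta_mx 0 i) F (pd i F p).
Proof. by move=> dF; apply/derivableP/diff_derivable. Qed.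

Lemma smooth_on_addc {R : realType} {W : normedModType R} (M : set 'rV[R]_2)
    (F : 'rV[R]_2 -> W) (c : W) : open M -> smooth_on M F ->
  smooth_on M (fun p => F p + c).
Proof.
move=> oM hF.
pose P (F : 'rV[R]_2 -> W) := exists2 G, smooth_on M G & exists c, F = G + cst c.
apply: (@smooth_on_coind _ _ _ P) => // [|G i|]; last by exists F => //; exists c.
  move=> _ [G hG [d ->]] p Mp; apply: differentiableD => //.
  exact: smooth_on_differentiable hG Mp.
move=> [H hH [d ->]]; exists (pd i H).
  exists (pd i H); first exact: smooth_on_pd.
  by exists 0; apply/funext => p; rewrite fctE addr0.
move=> p Mp; have h1 := is_derive_pd i (smooth_on_differentiable hH Mp).
rewrite /pd; have [_ ->] := is_deriveD h1 (is_derive_cst d p (delta_mx 0 i)).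
by rewrite addr0.
Qed.

(** * Integration of the structure equations *)

Lemma strip_pt {R : realType} (J : set R) (s t : R) : strip J (pt s t) = J s.
Proof. by rewrite /strip /= mxE. Qed.

Lemma pt0E {R : realType} (x y : R) : pt x y 0 0 = x.
Proof. by rewrite mxE. Qed.

Lemma pt1E {R : realType} (x y : R) : pt x y 0 1 = y.
Proof. by rewrite mxE. Qed.

Lemma ptE {R : realType} (p : 'rV[R]_2) : p = pt (p 0 0) (p 0 1).
Proof.
apply/rowP => i; rewrite mxE; case: i => [[|[|//]] hi] /=; congr (p _ _);
  exact/val_inj.
Qed.

Lemma smooth1_derivable_mx {R : realType} (m n : nat) (J : set R)
    (A : R -> 'M[R]_(m, n)) s i j :
  (forall i j, smooth1 J (fun s => A s i j)) -> J s ->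
  {for s, continuous (fun u => A u i j)}.
Proof. by move=> h; apply: smooth1_continuous. Qed.

Lemma mulmx_delta00 {R : realType} {n : nat} (F : 'M[R]_n.+1) (i : 'I_n.+1) :
  F *m delta_mx 0 0 = delta_mx 0 0 :> 'M[R]_n.+1 -> F i 0 = (i == 0)%:R.
Proof.
move=> /matrixP/(_ i 0); rewrite !mxE eqxx andbT => <-.
rewrite (bigD1 0)//= mxE !eqxx mulr1 big1 ?addr0// => k k0.
by rewrite mxE (negbTE k0) mulr0.
Qed.

(** Frobenius theorem for coefficients that do not depend on [t]: under the
    zero curvature equation the solution is [Psi(s) *m Z(t)], where [Psi]
    intertwines [Ot s] with the constant matrix [M]. *)
Lemma moving_frame_exists {R : realType} {n : nat} (eps : R) (J : set R) (s0 : R)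
    (Os Ot : R -> 'M[R]_n.+1) :
  open J -> is_interval J -> J s0 ->
  (forall i j, smooth1 J (fun s => Os s i j)) ->
  (forall i j, smooth1 J (fun s => Ot s i j)) ->
  (forall s, J s -> is_derive s 1 Ot (Os s *m Ot s - Ot s *m Os s)) ->
  (forall s, J s -> (Os s)^T *m Dmx eps + Dmx eps *m Os s = 0) ->
  (forall s, J s -> (Ot s)^T *m Dmx eps + Dmx eps *m Ot s = 0) ->
  (forall s, J s -> Os s *m shiftmx eps = 0) ->
  (forall s, J s -> Ot s *m shiftmx eps = 0) ->
  exists e : 'rV[R]_2 -> 'M[R]_n.+1,
  [/\ e (pt s0 0) = Phi0 eps - shiftmx eps,
      (forall p, strip J p ->
         is_derive p (delta_mx 0 0) e (Os (p 0 0) *m e p) /\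
         is_derive p (delta_mx 0 1) e (Ot (p 0 0) *m e p)),
      (forall i, smooth_on (strip J) (fun p => row i (e p))) &
      (forall p, strip J p -> onframe eps (e p))].
Proof.
move=> oJ iJ J0 sOs sOt dOt kOs kOt zOs zOt.
have cOs s i j := @smooth1_derivable_mx _ _ _ J Os s i j sOs.
pose P0 : 'M[R]_n.+1 := Phi0 eps.
pose P0i : 'M[R]_n.+1 :=
  diag_mx (\row_i if (i == 0) && (eps != 0) then Num.sqrt `|eps| else 1).
have P0V : P0 *m P0i = 1%:M.
  rewrite mulmx_diag; apply/matrixP => i j; rewrite !mxE.
  case: ifP => [/andP[_ e0]|]; last by rewrite mulr1.
  by rewrite mulVf// sqrtr_eq0 -ltNge normr_gt0.
have [Psi [Psi0 dPsi]] := linear_ode_exists P0 oJ iJ J0 cOs.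
pose M := P0i *m Ot s0 *m P0.
have cM (s : R) (i j : 'I_n.+1) :
    [set: R] s -> {for s, continuous (fun u : R => cst M u i j)}.
  by move=> _; exact: cst_continuous.
have iT : is_interval [set: R] by [].
have [Z [Z0 dZ]] := linear_ode_exists (1%:M : 'M[R]_n.+1) openT iT
  (I : [set: R] (0 : R)) cM.
have tw s : J s -> Ot s *m Psi s = Psi s *m M.
  apply: (@linear_ode_unique _ _ _ J s0 Os (fun s => Ot s *m Psi s)
    (fun s => Psi s *m M)) => //.
  - move=> u Ju; apply: (is_derive_eq (is_derive_mulmx (dOt u Ju) (dPsi u Ju))).
    by rewrite mulmxBl !mulmxA subrK.
  - move=> u Ju.
    apply: (is_derive_eq (is_derive_mulmx (dPsi u Ju) (is_derive_cst M u (1 : R)))).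
    by rewrite mulmx0 addr0 mulmxA.
  - by rewrite Psi0 /M !mulmxA P0V mul1mx.
pose Phi (p : 'rV[R]_2) := Psi (p 0 0) *m Z (p 0 1).
have dPhi0 p : strip J p -> is_derive p (delta_mx 0 0) Phi (Os (p 0 0) *m Phi p).
  move=> Jp; have h1 := is_derive_coord_same (dPsi _ Jp).
  have h2 := @is_derive_coord_other _ _ Z 1 0 p isT.
  by apply: (is_derive_eq (is_derive_mulmx h1 h2)); rewrite mulmx0 addr0 mulmxA.
have dPhi1 p : strip J p -> is_derive p (delta_mx 0 1) Phi (Ot (p 0 0) *m Phi p).
  move=> Jp; have h1 := @is_derive_coord_other _ _ Psi 0 1 p isT.
  have h2 := is_derive_coord_same (i := 1) (p := p) (dZ (p 0 1) I).
  apply: (is_derive_eq (is_derive_mulmx h1 h2)).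
  by rewrite mul0mx add0r /Phi mulmxA -tw // -mulmxA.
have gram p : strip J p ->
    (Phi p)^T *m Dmx eps *m Phi p = P0^T *m Dmx eps *m P0.
  move=> Jp; set s := p 0 0.
  have h1 : (Psi s)^T *m Dmx eps *m Psi s = P0^T *m Dmx eps *m P0.
    by rewrite (gram_const iJ J0 dPsi kOs) // Psi0.
  have h2 (t : R) : [set: R] t ->
      is_derive t 1 (fun t => Psi s *m Z t) (Ot s *m (Psi s *m Z t)).
    move=> _.
    apply: (is_derive_eq (is_derive_mulmx (is_derive_cst (Psi s) t (1 : R)) (dZ t I))).
    by rewrite mul0mx add0r mulmxA -tw // -mulmxA.
  rewrite -h1 /Phi.
  have := gram_const (D := Dmx eps) iT (I : [set: R] (0 : R)) h2
    (fun t _ => kOt s Jp).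
  by move=> ->//; rewrite Z0 mulmx1.
have Phi_shift p : strip J p -> Phi p *m shiftmx eps = shiftmx eps.
  move=> Jp; set s := p 0 0.
  have h1 : Psi s *m shiftmx eps = shiftmx eps.
    apply: (@linear_ode_unique _ _ _ J s0 Os (fun s => Psi s *m shiftmx eps)
      (fun=> shiftmx eps)) => //.
    - move=> u Ju.
      apply: (is_derive_eq (is_derive_mulmx (dPsi u Ju)
        (is_derive_cst (shiftmx eps : 'M[R]_n.+1) u (1 : R)))).
      by rewrite mulmx0 addr0 mulmxA.
    - by move=> u Ju; rewrite zOs//; exact: is_derive_cst.
    - rewrite Psi0 /P0 /shiftmx /Phi0; have [->|e0] := eqVneq eps 0.
        rewrite scale1r mul_diag_mx; apply/matrixP => i j; rewrite !mxE ?eqxx /=.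
        by rewrite andbF mul1r.
      by rewrite scale0r mulmx0.
  have h2 : forall t : R, [set: R] t ->
      Psi s *m Z t *m shiftmx eps = shiftmx eps.
    apply: (@linear_ode_unique _ _ _ setT 0 (fun=> Ot s)
      (fun t => Psi s *m Z t *m shiftmx eps) (fun=> shiftmx eps)) => //.
    - by move=> t i j _; exact: cst_continuous.
    - move=> t _.
      have d1 := is_derive_mulmx (is_derive_cst (Psi s) t (1 : R)) (dZ t I).
      apply: (is_derive_eq (is_derive_mulmx d1
        (is_derive_cst (shiftmx eps : 'M[R]_n.+1) t (1 : R)))).
      by rewrite mul0mx add0r mulmx0 addr0 [Psi s *m (_ *m _)]mulmxA -tw // !mulmxA.
    - by move=> t _; rewrite zOt//; exact: is_derive_cst.
    - by rewrite Z0 mulmx1.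
  exact: h2.
pose e p := Phi p - shiftmx eps.
have de i p d : is_derive p (delta_mx 0 i) Phi d -> is_derive p (delta_mx 0 i) e d.
  move=> h; apply: (is_derive_eq (is_deriveB h
    (is_derive_cst (shiftmx eps : 'M[R]_n.+1) p (delta_mx 0 i)))).
  by rewrite subr0.
have fr p : strip J p ->
  [/\ (forall i j, i != 0 -> j != 0 ->
         ambient_form eps (row i (e p)) (row j (e p)) = (i == j)%:R),
      (eps != 0 -> ambient_form eps (row 0 (e p)) (row 0 (e p)) = eps^-1 /\
         forall i, i != 0 -> ambient_form eps (row 0 (e p)) (row i (e p)) = 0) &
      (eps = 0 -> forall i, e p i 0 = 0)].
  move=> Jp; have [E0|e0] := eqVneq eps 0.
    have sh : shiftmx eps = delta_mx 0 0 :> 'M[R]_n.+1.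
      by rewrite /shiftmx E0 eqxx scale1r.
    split => //.
      move=> i j i0 j0; rewrite /e sh E0; apply: onframe_gram_eq0 => //.
        rewrite -E0 gram// /P0.
        rewrite tr_diag_mx !mulmx_diag; congr diag_mx; apply/rowP => k.
        by rewrite !mxE E0 eqxx andbF mulr1 mul1r.
      by rewrite -sh; exact: Phi_shift.
    move=> _ i; have := Phi_shift p Jp; rewrite /e sh.
    by move/(mulmx_delta00 i) => H; rewrite [LHS]mxE H !mxE andbT subrr.
  have eE : e p = Phi p by rewrite /e /shiftmx (negbTE e0) scale0r subr0.
  have H := onframe_gram_neq0 e0 (etrans (gram p Jp) (Phi0_gram e0)).
  rewrite eE; split=> [i j i0 j0|_|E]; last by rewrite E eqxx in e0.
    by rewrite H (negbTE i0); case: (i == j).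
  by split=> [|i i0]; rewrite H // eq_sym (negbTE i0).
have smooth_e i : smooth_on (strip J) (fun p => row i (e p)).
  have -> : (fun p => row i (e p)) =
      (fun p => row i (Psi (p 0 0)) *m Z (p 0 1) + row i (- shiftmx eps)).
    by apply/funext => p; rewrite /e linearD /= row_mul.
  apply: (smooth_on_addc (F := fun p : 'rV[R]_2 => row i (Psi (p 0 0)) *m Z (p 0 1))
    (row i (- shiftmx eps)) (strip_open oJ)).
  apply: (smooth_on_mulmx (u := fun s => row i (Psi s)) (M := M) oJ) => [k|t].
    have h : smooth1 J (fun s => Psi s i k).
      by apply: smooth1_linear_ode dPsi _ _.
    by apply: (smooth1_ext oJ _ h) => s _; rewrite mxE.
  exact: dZ.
exists e; split=> //.
- by rewrite /e /Phi pt0E pt1E Psi0 Z0 mulmx1.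
- by move=> p Jp; rewrite {2 4}/e !mulmxBr zOs// zOt// !subr0; split; apply: de; auto.
move=> p Jp; have [f1 f2 f3] := fr p Jp; split=> // en.
have sh : shiftmx eps = 0 :> 'M[R]_n.+1.
  by rewrite /shiftmx lt_eqF// scale0r.
have nz q : strip J q -> e q 0 0 != 0.
  move=> Jq; have [_ h _] := fr q Jq; have [] := h (ltr0_neq0 en).
  move=> H _; apply/negP => /eqP E.
  have : 0 <= eps^-1.
    rewrite -H ambient_formE; apply: sumr_ge0 => i _; rewrite mxE.
    rewrite /sig; case: (eqVneq i 0) => [->|_] /=.
      by rewrite E mul0r mulr0.
    by rewrite mul1r -expr2 sqr_ge0.
  by rewrite invr_ge0 leNgt en.
have e00 s t : e (pt s t) 0 0 = (Psi s *m Z t) 0 0.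
  by rewrite /e sh subr0 /Phi pt0E pt1E.
have cont_s s : J s -> {for s, continuous (fun s => e (pt s 0) 0 0)}.
  move=> Js; have -> : (fun s => e (pt s 0) 0 0) = (fun s => Psi s 0 0).
    by apply/funext => u; rewrite e00 Z0 mulmx1.
  exact: is_derive_continuous (is_derive_entry 0 0 (dPsi s Js)).
have cont_t t : {for t, continuous (fun t => e (pt (p 0 0) t) 0 0)}.
  have -> : (fun t => e (pt (p 0 0) t) 0 0) = (fun t => (Psi (p 0 0) *m Z t) 0 0).
    by apply/funext => u; rewrite e00.
  have d1 := is_derive_mulmx (is_derive_cst (Psi (p 0 0)) t (1 : R)) (dZ t I).
  exact: is_derive_continuous (is_derive_entry 0 0 d1).
have pos_s : 0 < e (pt (p 0 0) 0) 0 0.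
  apply: (positive_of_neq0 iJ J0 cont_s) => // [s Js|].
    by apply: nz; rewrite strip_pt.
  rewrite e00 Psi0 Z0 mulmx1 /P0 /Phi0 !mxE eqxx lt_eqF//=.
  by rewrite invr_gt0 sqrtr_gt0 normr_gt0 lt_eqF.
rewrite [p]ptE.
apply: (positive_of_neq0 iT (I : setT (0 : R)) (fun t _ => cont_t t)) => // t _.
by apply: nz; rewrite strip_pt.
Qed.

(** * Warped product metrics *)

Definition warped {R : realType} (J : set R) (g : 'rV[R]_2 -> 'M[R]_2)
    (h dh : R -> R) : Prop :=
  [/\ open J, (forall s, J s -> 0 < h s),
      (forall s, J s -> is_derive s 1 h (dh s)) &
      (forall p, strip J p -> g p = diag_mx (pt 1 (h (p 0 0) ^+ 2)))].

Lemma sum2 {V : nmodType} (F : 'I_2 -> V) : \sum_(i < 2) F i = F 0 + F 1.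
Proof.
rewrite big_ord_recl big_ord1; congr (_ + F _); exact/val_inj.
Qed.

Lemma sum22 {V : nmodType} (F : 'I_2 -> 'I_2 -> V) :
  \sum_(i < 2) \sum_(j < 2) F i j = F 0 0 + F 0 1 + (F 1 0 + F 1 1).
Proof. by rewrite !sum2. Qed.

Lemma ord2_cases (i : 'I_2) : i = 0 \/ i = 1.
Proof. by case: i => [[|[|//]] hi]; [left|right]; apply/val_inj. Qed.

Lemma warped_inv {R : realType} (J : set R) g h dh p :
  warped J g h dh -> strip J p ->
  invmx (g p) = diag_mx (pt 1 ((h (p 0 0) ^+ 2)^-1)) :> 'M[R]_2.
Proof.
move=> [_ h0 _ gE] Jp; have hp : h (p 0 0) ^+ 2 != 0.
  by rewrite sqrf_eq0 gt_eqF// h0.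
have E : diag_mx (pt 1 ((h (p 0 0) ^+ 2)^-1)) *m g p = 1%:M.
  rewrite gE// mulmx_diag; apply/matrixP => i j; rewrite !mxE.
  by case: (i == 0); rewrite ?mulr1// mulVf.
have [_ gu] := mulmx1_unit E.
by rewrite -[LHS]mul1mx -E mulmxK.
Qed.

Lemma warped_entry {R : realType} (J : set R) g h dh p i j :
  warped J g h dh -> strip J p ->
  g p i j = if i == j then (if i == 0 then 1 else h (p 0 0) ^+ 2) else 0 :> R.
Proof.
move=> [_ _ _ gE] Jp; rewrite gE// !mxE; by case: (eqVneq i j) => [->|].
Qed.

Lemma warped_inv_entry {R : realType} (J : set R) g h dh p i j :
  warped J g h dh -> strip J p ->
  invmx (g p) i j =
    if i == j then (if i == 0 then 1 else (h (p 0 0) ^+ 2)^-1) else 0 :> R.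
Proof.
move=> w Jp; rewrite (warped_inv w Jp) !mxE; by case: (eqVneq i j) => [->|].
Qed.

Lemma warped_invE {R : realType} (J : set R) g h dh p :
  warped J g h dh -> strip J p ->
  ((invmx (g p) 0 0 = 1 :> R) * (invmx (g p) 0 1 = 0 :> R)
   * (invmx (g p) 1 0 = 0 :> R) * (invmx (g p) 1 1 = (h (p 0 0) ^+ 2)^-1 :> R))%type.
Proof. by move=> w Jp; rewrite !(warped_inv_entry _ _ w Jp). Qed.

Lemma pd_is_derive {R : realType} {W : normedModType R} (F : 'rV[R]_2 -> W) p i d :
  is_derive p (delta_mx 0 i) F d -> pd i F p = d.
Proof. by case. Qed.

Lemma near_strip_is_derive {R : realType} {W : normedModType R} (J : set R)
    (F G : 'rV[R]_2 -> W) p v d : open J -> strip J p ->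
  (forall q, strip J q -> F q = G q) -> is_derive p v F d -> is_derive p v G d.
Proof.
move=> oJ Jp FG; apply: near_eq_is_derive.
by apply: filterS (strip_near oJ Jp) => q; exact: FG.
Qed.

Lemma warped_pd {R : realType} (J : set R) g h dh p (k i j : 'I_2) :
  warped J g h dh -> strip J p ->
  pd k (fun q => g q i j) p =
    if [&& k == 0, i == 1 & j == 1] then 2 * h (p 0 0) * dh (p 0 0) else 0 :> R.
Proof.
move=> w Jp; have [oJ h0 hd _] := w.
rewrite (pd_eq_on k (strip_open oJ) Jp (fun q Jq => warped_entry i j w Jq)).
have cst0 (c : R) : pd k (fun=> c) p = 0.
  by apply: pd_is_derive; exact: is_derive_cst.
have [i0|i1] := ord2_cases i; have [j0|j1] := ord2_cases j;
  rewrite ?i0 ?i1 ?j0 ?j1 /= ?cst0 ?andbF //.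
have d : is_derive (p 0 0) 1 (fun s => h s ^+ 2) (2 * h (p 0 0) * dh (p 0 0)).
  apply: (is_derive_eq (is_deriveX 2 (hd _ Jp))).
  by rewrite -![_ *: _]/(_ * _) expr1.
have [k0|k1] := ord2_cases k; rewrite ?k0 ?k1 /=.
  by apply: pd_is_derive; exact: is_derive_coord_same.
by apply: pd_is_derive; exact: (@is_derive_coord_other _ _ (fun s => h s ^+ 2) 0 1 p isT).
Qed.

Lemma warped_christoffel {R : realType} (J : set R) g h dh p (k i j : 'I_2) :
  warped J g h dh -> strip J p ->
  christoffel g k i j p =
    if k == 0 then (if (i == 1) && (j == 1) then - (h (p 0 0) * dh (p 0 0)) else 0)
    else (if i != j then dh (p 0 0) / h (p 0 0) else 0) :> R.
Proof.
move=> w Jp; have [_ h0 _ _] := w.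
have hp : h (p 0 0) != 0 by rewrite gt_eqF// h0.
rewrite /christoffel sum2 !(warped_inv_entry _ _ w Jp) !(warped_pd _ _ _ w Jp).
have [k0|k1] := ord2_cases k; have [i0|i1] := ord2_cases i;
  have [j0|j1] := ord2_cases j; rewrite ?k0 ?k1 ?i0 ?i1 ?j0 ?j1 /=; by field.
Qed.

Lemma warped_lc {R : realType} (J : set R) g h dh (i : 'I_2)
    (Y : 'rV[R]_2 -> 'rV[R]_2) p :
  warped J g h dh -> strip J p ->
  levi_civita_coord g i Y p =
    pt (pd i (fun q => Y q 0 0) p
        - (if i == 1 then h (p 0 0) * dh (p 0 0) * Y p 0 1 else 0))
       (pd i (fun q => Y q 0 1) p
        + dh (p 0 0) / h (p 0 0) * (if i == 0 then Y p 0 1 else Y p 0 0)).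
Proof.
move=> w Jp; apply/rowP => k; rewrite /levi_civita_coord !mxE sum2.
rewrite !(warped_christoffel _ _ _ w Jp).
have [k0|k1] := ord2_cases k; have [i0|i1] := ord2_cases i;
  rewrite ?k0 ?k1 ?i0 ?i1 /=; ring.
Qed.

Lemma warped_curvature {R : realType} (J : set R) g h dh ddh p :
  warped J g h dh -> strip J p ->
  is_derive (p 0 0) 1 dh (ddh : R) ->
  gauss_curvature g p = - (ddh / h (p 0 0)).
Proof.
move=> w Jp hdd; have [oJ h0 hd gE] := w; have oS := strip_open oJ.
have hp : h (p 0 0) != 0 by rewrite gt_eqF// h0.
pose d1 := fun _ : 'rV[R]_2 => delta_mx 0 1 : 'rV[R]_2.
have pdc i (c : R) q : pd i (fun=> c) q = 0.
  by apply: pd_is_derive; exact: is_derive_cst.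
have d1E j q : d1 q 0 j = (j == 1)%:R by rewrite mxE eqxx.
have pd1 i j q : pd i (fun q => d1 q 0 j) q = 0.
  have -> : (fun q => d1 q 0 j) = (fun=> (j == 1)%:R) by apply/funext => r.
  exact: pdc.
have n11 q : strip J q -> levi_civita_coord g 1 d1 q
    = pt (- (h (q 0 0) * dh (q 0 0))) 0.
  move=> Jq; rewrite (warped_lc _ _ w Jq) !pd1 !d1E /=.
  by rewrite mulr0 addr0 mulr1 sub0r.
have n01 q : strip J q -> levi_civita_coord g 0 d1 q
    = pt 0 (dh (q 0 0) / h (q 0 0)).
  move=> Jq; rewrite (warped_lc _ _ w Jq) !pd1 !d1E /=.
  by rewrite subr0 add0r mulr1.
rewrite /gauss_curvature -/d1; cbv zeta.
rewrite (warped_lc 0 (levi_civita_coord g 1 d1) w Jp).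
rewrite (warped_lc 1 (levi_civita_coord g 0 d1) w Jp) /=.
rewrite n11// n01// !pt0E !pt1E.
rewrite (pd_eq_on 0 oS Jp (fun q Jq => congr1 (fun M : 'rV_2 => M 0 0) (n11 q Jq))).
rewrite (pd_eq_on 1 oS Jp (fun q Jq => congr1 (fun M : 'rV_2 => M 0 0) (n01 q Jq))).
have -> : pd 1 (fun q : 'rV[R]_2 => pt 0 (dh (q 0 0) / h (q 0 0)) 0 0) p = 0.
  have -> : (fun q : 'rV[R]_2 => pt 0 (dh (q 0 0) / h (q 0 0)) 0 0) = (fun=> 0).
    by apply/funext => q; rewrite pt0E.
  exact: pdc.
have -> : pd 0 (fun q : 'rV[R]_2 => pt (- (h (q 0 0) * dh (q 0 0))) 0 0 0) p
    = - (dh (p 0 0) * dh (p 0 0) + h (p 0 0) * ddh).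
  have -> : (fun q : 'rV[R]_2 => pt (- (h (q 0 0) * dh (q 0 0))) 0 0 0)
      = (fun q : 'rV_2 => - (h (q 0 0) * dh (q 0 0))).
    by apply/funext => q; rewrite pt0E.
  apply: pd_is_derive.
  apply: (@is_derive_coord_same _ _ (fun s => - (h s * dh s)) 0).
  by apply: is_deriveN; apply: is_derive_comb => //; exact: hd.
rewrite gE// det_diag mxE sum2 big_ord_recl big_ord1 !mxE /= mul1r.
rewrite !mulr1n mulr0n !mulr0 addr0 mulr1.
by move: (h _) (dh _) hp => u v u0; field.
Qed.

Lemma warped_grad {R : realType} (J : set R) g h dh (u : 'rV[R]_2 -> R) p :
  warped J g h dh -> strip J p ->
  grad g u p = pt (pd 0 u p) (pd 1 u p / h (p 0 0) ^+ 2).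
Proof.
move=> w Jp; apply/rowP => j; rewrite /grad mxE sum2 !mxE.
rewrite !(warped_inv_entry _ _ w Jp).
by have [->|->] := ord2_cases j; rewrite /= ?mulr1 ?mulr0 ?addr0 ?add0r.
Qed.

Lemma warped_mean {R : realType} {n : nat} (eps : R) (J : set R) g h dh
    (phi : 'rV[R]_2 -> 'rV[R]_n.+1) p :
  warped J g h dh -> strip J p ->
  mean_vector eps g phi p = 2^-1 *: (second_ff eps g phi 0 0 p
    + (h (p 0 0) ^+ 2)^-1 *: second_ff eps g phi 1 1 p).
Proof.
move=> w Jp; rewrite /mean_vector; move: (second_ff eps g phi) => B.
rewrite (sum22 (fun i j => invmx (g p) i j *: B i j p)) !(warped_invE w Jp).
by rewrite !scale0r scale1r addr0 add0r.
Qed.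

Lemma warped_shape {R : realType} {n : nat} (eps : R) (J : set R) g h dh
    (phi : 'rV[R]_2 -> 'rV[R]_n.+1) eta p (i j : 'I_2) :
  warped J g h dh -> strip J p ->
  Defs.shape eps g phi eta p i j = ambient_form eps (second_ff eps g phi i j p) eta
    * (if j == 0 then 1 else (h (p 0 0) ^+ 2)^-1).
Proof.
move=> w Jp; rewrite /Defs.shape; move: (second_ff eps g phi) => B.
have E k l : (\matrix_(i, j) ambient_form eps (B i j p) eta) k l
    = ambient_form eps (B k l p) eta by rewrite mxE.
rewrite [LHS]mxE sum2 !E.
by have [->|->] := ord2_cases j; rewrite !(warped_invE w Jp) /= mulr0 ?addr0 ?add0r.
Qed.

Lemma warped_normal_part {R : realType} {n : nat} (eps : R) (J : set R) g h dh
    (phi : 'rV[R]_2 -> 'rV[R]_n.+1) p v :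
  warped J g h dh -> strip J p ->
  normal_part eps g phi p v = v - (ambient_form eps v (pd 0 phi p) *: pd 0 phi p
    + ((h (p 0 0) ^+ 2)^-1 * ambient_form eps v (pd 1 phi p)) *: pd 1 phi p).
Proof.
move=> w Jp; rewrite /normal_part; congr (v - _).
have key (D : 'I_2 -> 'rV[R]_n.+1) :
    \sum_(k < 2) \sum_(l < 2) (invmx (g p) k l * ambient_form eps v (D k)) *: D l
    = ambient_form eps v (D 0) *: D 0
      + ((h (p 0 0) ^+ 2)^-1 * ambient_form eps v (D 1)) *: D 1.
  rewrite (sum22 (fun k l => (invmx (g p) k l * ambient_form eps v (D k)) *: D l)).
  by rewrite !(warped_invE w Jp) !mul0r !scale0r mul1r addr0 add0r.
exact: (key (fun k => pd k phi p)).
Qed.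

Lemma warped_second_ff {R : realType} {n : nat} (eps : R) (J : set R) g h dh
    (phi : 'rV[R]_2 -> 'rV[R]_n.+1) p (i j : 'I_2) :
  warped J g h dh -> strip J p ->
  second_ff eps g phi i j p = space_form_conn eps phi i (pd j phi) p
    - (if i == j then (if i == 0 then 0 else (- (h (p 0 0) * dh (p 0 0))) *: pd 0 phi p)
       else (dh (p 0 0) / h (p 0 0)) *: pd 1 phi p).
Proof.
move=> w Jp; rewrite /second_ff; congr (_ - _).
have key (D : 'I_2 -> 'rV[R]_n.+1) : \sum_(k < 2) christoffel g k i j p *: D k
    = if i == j then (if i == 0 then 0 else (- (h (p 0 0) * dh (p 0 0))) *: D 0)
      else (dh (p 0 0) / h (p 0 0)) *: D 1.
  rewrite (sum2 (fun k => christoffel g k i j p *: D k)).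
  rewrite !(warped_christoffel _ _ _ w Jp).
  by have [->|->] := ord2_cases i; have [->|->] := ord2_cases j;
    rewrite /= ?scale0r ?addr0 ?add0r.
exact: (key (fun k => pd k phi p)).
Qed.

(** The two components of the biconservative tensor, [N i] standing for the
    normal derivative of the mean curvature vector along the i-th coordinate. *)
Lemma warped_biconservative {R : realType} {n : nat} (eps : R) (J : set R) g h dh
    (phi : 'rV[R]_2 -> 'rV[R]_n.+1) p (N : 'I_2 -> 'rV[R]_n.+1) (u : 'rV[R]_2 -> R) :
  warped J g h dh -> strip J p ->
  let k := (h (p 0 0) ^+ 2)^-1 in
  let B i j := second_ff eps g phi i j p in
  2 *: (\sum_(i < 2) \sum_(j < 2) invmx (g p) i j *: row j (Defs.shape eps g phi (N i) p))
    + grad g u p =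
  pt (2 * (ambient_form eps (B 0 0) (N 0) + k * ambient_form eps (B 1 0) (N 1))
        + pd 0 u p)
     ((2 * (ambient_form eps (B 0 1) (N 0) + k * ambient_form eps (B 1 1) (N 1))
        + pd 1 u p) * k).
Proof.
move=> w Jp k B; rewrite (warped_grad _ w Jp).
have key (S : 'I_2 -> 'M[R]_2) :
    \sum_(i < 2) \sum_(j < 2) invmx (g p) i j *: row j (S i)
    = row 0 (S 0) + k *: row 1 (S 1).
  rewrite (sum22 (fun i j => invmx (g p) i j *: row j (S i))).
  by rewrite !(warped_invE w Jp) !scale0r scale1r addr0 add0r.
rewrite (key (fun i => Defs.shape eps g phi (N i) p)) => {key}.
have E v i j : Defs.shape eps g phi v p i j =
    ambient_form eps (B i j) v * (if j == 0 then 1 else k).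
  exact: warped_shape w Jp.
move: (Defs.shape eps g phi) B E => S B E.
apply/rowP => j; rewrite !mxE !E.
by have [->|->] := ord2_cases j; rewrite /= -/k; ring.
Qed.

(** * Symmetry of second derivatives *)

Definition grid {R : realType} (p : 'rV[R]_2) (x y : R) : 'rV[R]_2 :=
  p + x *: delta_mx 0 0 + y *: delta_mx 0 1.

Lemma grid_derive0 {R : realType} (u : 'rV[R]_2 -> R) p (x y : R) :
  differentiable u (grid p x y) ->
  is_derive x 1 (fun x => u (grid p x y)) (pd 0 u (grid p x y)).
Proof.
move=> du; have [h1 h2] := is_derive_pd 0 du.
have E : (fun h : R => h^-1 *: (u (grid p (h *: 1 + x) y) - u (grid p x y))) =
    (fun h : R => h^-1 *: (u (h *: delta_mx 0 0 + grid p x y) - u (grid p x y))).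
  apply/funext => h; congr (_ *: (u _ - _)).
  by rewrite /grid -[h *: 1]/(h * 1) mulr1 scalerDl addrCA !addrA addrC !addrA.
by apply: DeriveDef; [rewrite /derivable E|rewrite /derive E].
Qed.

Lemma grid_derive1 {R : realType} (u : 'rV[R]_2 -> R) p (x y : R) :
  differentiable u (grid p x y) ->
  is_derive y 1 (fun y => u (grid p x y)) (pd 1 u (grid p x y)).
Proof.
move=> du; have [h1 h2] := is_derive_pd 1 du.
have E : (fun h : R => h^-1 *: (u (grid p x (h *: 1 + y)) - u (grid p x y))) =
    (fun h : R => h^-1 *: (u (h *: delta_mx 0 1 + grid p x y) - u (grid p x y))).
  apply/funext => h; congr (_ *: (u _ - _)).
  by rewrite /grid -[h *: 1]/(h * 1) mulr1 scalerDl [RHS]addrCA.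
by apply: DeriveDef; [rewrite /derivable E|rewrite /derive E].
Qed.

Lemma MVT_closed {R : realType} (u du : R -> R) (k : R) : 0 < k ->
  (forall x, 0 <= x <= k -> is_derive x 1 u (du x)) ->
  exists2 c, 0 <= c <= k & u k - u 0 = du c * k.
Proof.
move=> k0 h; have [||c] := @MVT_segment R u du 0 k (ltW k0).
- by move=> x /[!in_itv]/= /andP[x0 xk]; apply: h; rewrite !ltW.
- apply: derivable_within_continuous => s /[!in_itv]/= hs.
  by have [] := h s hs.
by rewrite in_itv/= subr0 => hc E; exists c.
Qed.

(** The second difference of [u] over a small square is, by two mean value theorems
    in either order, a value of each of the two mixed derivatives. *)
Lemma schwarz {R : realType} (M : set 'rV[R]_2) (u : 'rV[R]_2 -> R) p :
  open M -> smooth_on M u -> M p -> pd 0 (pd 1 u) p = pd 1 (pd 0 u) p.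
Proof.
move=> oM su Mp.
have su0 := smooth_on_pd 0 su; have su1 := smooth_on_pd 1 su.
have c01 : {for p, continuous (pd 0 (pd 1 u))}.
  apply: differentiable_continuous.
  exact: smooth_on_differentiable (smooth_on_pd 0 su1) Mp.
have c10 : {for p, continuous (pd 1 (pd 0 u))}.
  apply: differentiable_continuous.
  exact: smooth_on_differentiable (smooth_on_pd 1 su0) Mp.
apply/eqP; rewrite -subr_eq0 -normr_eq0 eq_le normr_ge0 andbT.
apply/ler_addgt0Pr => e e0; rewrite add0r.
have e2 : 0 < e / 2 by rewrite divr_gt0.
have /cvgrPdist_le/(_ _ e2) n01 := c01.
have /cvgrPdist_le/(_ _ e2) n10 := c10.
have nM : \near p, M p by apply: open_nbhs_nbhs.
have : \forall q \near p, [/\ M q, `|pd 0 (pd 1 u) q - pd 0 (pd 1 u) p| <= e / 2 &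
    `|pd 1 (pd 0 u) q - pd 1 (pd 0 u) p| <= e / 2].
  apply: filterS (filterI nM (filterI n01 n10)) => q [h1 [h2 h3]].
  by split; [exact: h1|rewrite distrC; exact: h2|rewrite distrC; exact: h3].
move=> /nbhs_ballP[r /= r0 Hr]; pose k := r / 2.
have k0 : 0 < k by rewrite /k divr_gt0.
have inb x y : 0 <= x <= k -> 0 <= y <= k ->
   [/\ M (grid p x y), `|pd 0 (pd 1 u) (grid p x y) - pd 0 (pd 1 u) p| <= e / 2 &
    `|pd 1 (pd 0 u) (grid p x y) - pd 1 (pd 0 u) p| <= e / 2].
  move=> hx hy; apply: Hr; split=> // i j; rewrite /ball /= /grid !mxE.
  have [->|->] := ord2_cases j; rewrite ord1 /= ?mulr1 ?mulr0 ?addr0;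
    rewrite opprD addNKr normrN ger0_norm; rewrite /k in hx hy; lra.
pose D := u (grid p k k) - u (grid p k 0) - (u (grid p 0 k) - u (grid p 0 0)).
have kk : (0 : R) <= k <= k by rewrite lexx ltW.
have k00 : (0 : R) <= 0 <= k by rewrite lexx ltW.
have [x [y [hx hy E1]]] : exists x y, [/\ 0 <= x <= k, 0 <= y <= k &
    D = pd 1 (pd 0 u) (grid p x y) * k * k].
  have [|x hx E] := @MVT_closed R (fun x => u (grid p x k) - u (grid p x 0))
    (fun x => pd 0 u (grid p x k) - pd 0 u (grid p x 0)) k k0.
    move=> x hx; have [Mk _ _] := inb x k hx kk; have [M0 _ _] := inb x 0 hx k00.
    by apply: (is_derive_eq (is_deriveB (grid_derive0 (smooth_on_differentiable su Mk))
      (grid_derive0 (smooth_on_differentiable su M0)))).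
  have [|y hy E'] := @MVT_closed R (fun y => pd 0 u (grid p x y))
    (fun y => pd 1 (pd 0 u) (grid p x y)) k k0.
    move=> y hy; have [Mxy _ _] := inb x y hx hy.
    exact: grid_derive1 (smooth_on_differentiable su0 Mxy).
  by exists x, y; split=> //; rewrite /D E E'.
have [x' [y' [hx' hy' E2]]] : exists x y, [/\ 0 <= x <= k, 0 <= y <= k &
    D = pd 0 (pd 1 u) (grid p x y) * k * k].
  have [|y' hy' E] := @MVT_closed R (fun y => u (grid p k y) - u (grid p 0 y))
    (fun y => pd 1 u (grid p k y) - pd 1 u (grid p 0 y)) k k0.
    move=> y' hy'; have [Mk _ _] := inb k y' kk hy'.
    have [M0 _ _] := inb 0 y' k00 hy'.
    by apply: (is_derive_eq (is_deriveB (grid_derive1 (smooth_on_differentiable su Mk))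
      (grid_derive1 (smooth_on_differentiable su M0)))).
  have [|x' hx' E'] := @MVT_closed R (fun x => pd 1 u (grid p x y'))
    (fun x => pd 0 (pd 1 u) (grid p x y')) k k0.
    move=> x' hx'; have [Mxy _ _] := inb x' y' hx' hy'.
    exact: grid_derive0 (smooth_on_differentiable su1 Mxy).
  exists x', y'; split; [exact: hx'|exact: hy'|].
  rewrite -E' -E /D; clear; move: (u _) (u _) (u _) (u _) => a b c d.
  by ring.
have EE : pd 1 (pd 0 u) (grid p x y) = pd 0 (pd 1 u) (grid p x' y').
  have kn : k != 0 by rewrite gt_eqF.
  exact: (mulIf kn (mulIf kn (etrans (esym E1) E2))).
have [_ _ h1] := inb x y hx hy; have [_ h2 _] := inb x' y' hx' hy'.
move: h1 h2; rewrite EE; move: (pd 0 (pd 1 u) (grid p x' y')) => a.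
move: (pd 0 (pd 1 u) p) (pd 1 (pd 0 u) p) => b c h1 h2.
clear -h1 h2; have -> : b - c = (a - c) - (a - b) by ring.
by apply: le_trans (ler_normB _ _) _; lra.
Unshelve. all: by end_near. Qed.

Lemma pd_entry {R : realType} {n : nat} (F : 'rV[R]_2 -> 'rV[R]_n) p i (j : 'I_n) :
  differentiable F p -> pd i F p 0 j = pd i (fun q => F q 0 j) p.
Proof. by move=> dF; have [_ <-] := is_derive_entry 0 j (is_derive_pd i dF). Qed.

Lemma smooth_on_entry {R : realType} {n : nat} (M : set 'rV[R]_2)
    (F : 'rV[R]_2 -> 'rV[R]_n) (j : 'I_n) : open M ->
  smooth_on M F -> smooth_on M (fun q => F q 0 j).
Proof.
move=> oM sF.
apply: (@smooth_on_coind _ _ _ (fun H => exists2 F' : 'rV[R]_2 -> 'rV[R]_n,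
  smooth_on M F' & H = (fun q => F' q 0 j))) => //; last by exists F.
  move=> _ [F' sF' ->] p Mp; apply: differentiable_entry.
  exact: smooth_on_differentiable sF' Mp.
move=> _ i [F' sF' ->]; exists (fun q => pd i F' q 0 j).
  by exists (pd i F') => //; exact: smooth_on_pd.
by move=> p Mp; rewrite pd_entry//; exact: smooth_on_differentiable sF' Mp.
Qed.

Lemma schwarz_row {R : realType} {n : nat} (M : set 'rV[R]_2)
    (F : 'rV[R]_2 -> 'rV[R]_n) p :
  open M -> smooth_on M F -> M p -> pd 0 (pd 1 F) p = pd 1 (pd 0 F) p.
Proof.
move=> oM sF Mp; apply/rowP => j.
have dF i q : M q -> differentiable (pd i F) q.
  exact: smooth_on_differentiable (smooth_on_pd i sF).
have E i k : pd i (pd k F) p 0 j = pd i (pd k (fun q => F q 0 j)) p.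
  rewrite (pd_entry _ _ (dF k p Mp)).
  apply: (pd_eq_on i oM Mp) => q Mq.
  exact: (pd_entry _ _ (smooth_on_differentiable sF Mq)).
exact: (etrans (E 0 1) (etrans (schwarz oM (smooth_on_entry j oM sF) Mp) (esym (E 1 0)))).
Qed.

(** * Immersions with diagonal second fundamental form *)

Opaque pd ambient_form.

(** Normal vectors at a point with position [x] and tangent frame [E1], [E2]. *)
Definition nrm {R : realType} {n : nat} (eps : R) (x E1 E2 v : 'rV[R]_n.+1) : Prop :=
  [/\ ambient_form eps v E1 = 0, ambient_form eps v E2 = 0 &
      eps != 0 -> ambient_form eps v x = 0].

(** The Gauss formulas of an isometric immersion [x] of the warped metric with
    unit tangent frame [E1], [E2] along the coordinate directions, when the
    second fundamental form is diagonal: [b1 = B(E1, E1)], [b2 = B(E2, E2)]. *)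
Definition adapted {R : realType} {n : nat} (eps : R) (J : set R) (h dh : R -> R)
    (x E1 E2 b1 b2 : 'rV[R]_2 -> 'rV[R]_n.+1) : Prop :=
  forall p, strip J p ->
  [/\ is_derive p (delta_mx 0 0) x (E1 p) /\
      is_derive p (delta_mx 0 1) x (h (p 0 0) *: E2 p),
      is_derive p (delta_mx 0 0) E1 (b1 p - eps *: x p) /\
      is_derive p (delta_mx 0 1) E1 (dh (p 0 0) *: E2 p),
      is_derive p (delta_mx 0 0) E2 0 /\
      is_derive p (delta_mx 0 1) E2 (- (dh (p 0 0) *: E1 p) + h (p 0 0) *: b2 p
        - (eps * h (p 0 0)) *: x p),
      [/\ ambient_form eps (E1 p) (E1 p) = 1, ambient_form eps (E2 p) (E2 p) = 1 &
          ambient_form eps (E1 p) (E2 p) = 0] &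
      [/\ (eps != 0 -> ambient_form eps (x p) (x p) = eps^-1 /\
             ambient_form eps (E1 p) (x p) = 0 /\ ambient_form eps (E2 p) (x p) = 0),
          nrm eps (x p) (E1 p) (E2 p) (b1 p) & nrm eps (x p) (E1 p) (E2 p) (b2 p)]].

(** The projection to the tangent space of the space form only removes the component
    along the position vector. *)
Lemma project_position {R : realType} {n : nat} (eps a : R) (x w : 'rV[R]_n.+1) :
  (eps != 0 -> ambient_form eps x x = eps^-1) ->
  (eps != 0 -> ambient_form eps w x = 0) ->
  w + (eps * a) *: x - (eps * ambient_form eps (w + (eps * a) *: x) x) *: x = w.
Proof.
move=> hx hw; have [->|e0] := eqVneq eps 0.
  by rewrite !mul0r !scale0r subr0 addr0.
rewrite !ambientE hw// hx// add0r.
have -> : eps * (eps * a / eps) = eps * a by rewrite [_ / eps]mulrC mulKf.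
by rewrite addrK.
Qed.

Lemma adapted_pd {R : realType} {n : nat} (eps : R) (J : set R) h dh
    (x E1 E2 b1 b2 : 'rV[R]_2 -> 'rV[R]_n.+1) p :
  adapted eps J h dh x E1 E2 b1 b2 -> strip J p ->
  pd 0 x p = E1 p /\ pd 1 x p = h (p 0 0) *: E2 p.
Proof. by move=> ad Jp; have [[h1 h2] _ _ _ _] := ad p Jp; split; apply: pd_is_derive. Qed.

Lemma adapted_conn {R : realType} {n : nat} (eps a : R) (J : set R) h dh
    (x E1 E2 b1 b2 V : 'rV[R]_2 -> 'rV[R]_n.+1) p i w :
  adapted eps J h dh x E1 E2 b1 b2 -> strip J p ->
  is_derive p (delta_mx 0 i) V (w + (eps * a) *: x p) ->
  (eps != 0 -> ambient_form eps w (x p) = 0) ->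
  space_form_conn eps x i V p = w.
Proof.
move=> ad Jp dV hw; rewrite /space_form_conn (pd_is_derive dV).
apply: project_position => // e0.
by have [_ _ _ _ [/(_ e0)[]]] := ad p Jp.
Qed.

Lemma adapted_second_ff {R : realType} {n : nat} (eps : R) (J : set R) g h dh
    (x E1 E2 b1 b2 : 'rV[R]_2 -> 'rV[R]_n.+1) p :
  warped J g h dh -> adapted eps J h dh x E1 E2 b1 b2 -> strip J p ->
  [/\ second_ff eps g x 0 0 p = b1 p, second_ff eps g x 0 1 p = 0,
      second_ff eps g x 1 0 p = 0 & second_ff eps g x 1 1 p = h (p 0 0) ^+ 2 *: b2 p].
Proof.
move=> w ad Jp; have [oJ h0 hd gE] := w.
have [[dx0 dx1] [dE10 dE11] [dE20 dE21] _ [hx [_ _ hb1] [_ _ hb2]]] := ad p Jp.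
have [px0 px1] := adapted_pd ad Jp.
have hp : h (p 0 0) != 0 by rewrite gt_eqF// h0.
have near0 v d : is_derive p v E1 d -> is_derive p v (pd 0 x) d.
  apply: (near_strip_is_derive oJ Jp) => q Jq.
  by have [] := adapted_pd ad Jq.
have near1 v d : is_derive p v (fun q => h (q 0 0) *: E2 q) d ->
    is_derive p v (pd 1 x) d.
  apply: (near_strip_is_derive oJ Jp) => q Jq.
  by have [] := adapted_pd ad Jq.
have tan2 : eps != 0 -> ambient_form eps (dh (p 0 0) *: E2 p) (x p) = 0.
  by move=> /hx[_ [_ hE2]]; rewrite ambientZl hE2 mulr0.
have d00 : is_derive p (delta_mx 0 0) (pd 0 x) (b1 p + (eps * -1) *: x p).
  by rewrite mulrN1 scaleNr; exact: near0.
have d10 : is_derive p (delta_mx 0 1) (pd 0 x) (dh (p 0 0) *: E2 p + (eps * 0) *: x p).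
  by rewrite mulr0 scale0r addr0; exact: near0.
have d01 : is_derive p (delta_mx 0 0) (pd 1 x) (dh (p 0 0) *: E2 p + (eps * 0) *: x p).
  rewrite mulr0 scale0r addr0; apply: near1.
  apply: (is_derive_eq (is_derive_scale (is_derive_coord_same (hd _ Jp)) dE20)).
  by rewrite scaler0 addr0.
pose w11 := - (h (p 0 0) * dh (p 0 0)) *: E1 p + h (p 0 0) ^+ 2 *: b2 p.
have d11 : is_derive p (delta_mx 0 1) (pd 1 x)
    (w11 + (eps * - h (p 0 0) ^+ 2) *: x p).
  apply: near1.
  have d1 := @is_derive_coord_other _ _ h 0 1 p isT.
  apply: (is_derive_eq (is_derive_scale d1 dE21)).
  rewrite scale0r add0r !scalerDr !scalerN !scalerA /w11.
  by rewrite mulrN !scaleNr expr2 mulrCA.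
have hw11 : eps != 0 -> ambient_form eps w11 (x p) = 0.
  move=> e0; have [_ [hE1 _]] := hx e0.
  by rewrite /w11 !ambientE hE1 hb2// !mulr0 addr0.
have c00 := adapted_conn ad Jp d00 hb1.
have c10 := adapted_conn ad Jp d10 tan2.
have c01 := adapted_conn ad Jp d01 tan2.
have c11 := adapted_conn ad Jp d11 hw11.
rewrite /w11 in c11.
split; rewrite (warped_second_ff _ _ _ _ w Jp) /=.
- by rewrite c00 subr0.
- by rewrite c01 px1 scalerA divfK// subrr.
- by rewrite c10 px1 scalerA divfK// subrr.
- by rewrite c11 px0 [X in X - _]addrC addrK.
Qed.

Lemma adapted_mean {R : realType} {n : nat} (eps : R) (J : set R) g h dh
    (x E1 E2 b1 b2 : 'rV[R]_2 -> 'rV[R]_n.+1) p :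
  warped J g h dh -> adapted eps J h dh x E1 E2 b1 b2 -> strip J p ->
  mean_vector eps g x p = 2^-1 *: (b1 p + b2 p).
Proof.
move=> w ad Jp; have [_ h0 _ _] := w.
rewrite (warped_mean _ _ w Jp).
have [-> _ _ ->] := adapted_second_ff w ad Jp.
by rewrite scalerA mulVf ?scale1r// sqrf_eq0 gt_eqF// h0.
Qed.

Lemma adapted_normal_part {R : realType} {n : nat} (eps : R) (J : set R) g h dh
    (x E1 E2 b1 b2 : 'rV[R]_2 -> 'rV[R]_n.+1) p v :
  warped J g h dh -> adapted eps J h dh x E1 E2 b1 b2 -> strip J p ->
  normal_part eps g x p v =
    v - (ambient_form eps v (E1 p) *: E1 p + ambient_form eps v (E2 p) *: E2 p).
Proof.
move=> w ad Jp; have [_ h0 _ _] := w.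
rewrite (warped_normal_part _ _ _ w Jp).
have [-> ->] := adapted_pd ad Jp.
have key (c : R) : ((h (p 0 0) ^+ 2)^-1 * (h (p 0 0) * c)) * h (p 0 0) = c.
  by have hp := h0 _ Jp; field; rewrite gt_eqF.
by rewrite ambientZr scalerA key.
Qed.

Lemma adapted_normal_conn {R : realType} {n : nat} (eps a b : R) (J : set R) g h dh
    (x E1 E2 b1 b2 N : 'rV[R]_2 -> 'rV[R]_n.+1) p i nu :
  warped J g h dh -> adapted eps J h dh x E1 E2 b1 b2 -> strip J p ->
  is_derive p (delta_mx 0 i) N (a *: E1 p + b *: E2 p + nu) ->
  nrm eps (x p) (E1 p) (E2 p) nu ->
  normal_conn_coord eps g x i N p = nu.
Proof.
move=> w ad Jp dN [n1 n2 nx].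
have [_ _ _ [e11 e22 e12] [hx _ _]] := ad p Jp.
have e21 : ambient_form eps (E2 p) (E1 p) = 0 by rewrite ambientC.
rewrite /normal_conn_coord.
have -> : space_form_conn eps x i N p = a *: E1 p + b *: E2 p + nu.
  have dN' : is_derive p (delta_mx 0 i) N
      (a *: E1 p + b *: E2 p + nu + (eps * 0) *: x p).
    by rewrite mulr0 scale0r addr0.
  apply: (adapted_conn ad Jp dN') => e0; have [_ [hE1 hE2]] := hx e0.
  by rewrite !ambientE hE1 hE2 nx// !mulr0 !addr0.
rewrite (adapted_normal_part _ w ad Jp) !ambientE e11 e22 e12 e21 n1 n2.
by rewrite !mulr0 !mulr1 !addr0 add0r addrC addKr.
Qed.

(** A diagonal second fundamental form commutes with all shape operators, so
    the Ricci equation leaves no normal curvature. *)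
Lemma adapted_flat {R : realType} {n : nat} (eps : R) (J : set R) g h dh
    (x E1 E2 b1 b2 : 'rV[R]_2 -> 'rV[R]_n.+1) :
  warped J g h dh -> adapted eps J h dh x E1 E2 b1 b2 ->
  flat_normal_bundle eps (strip J) g x.
Proof.
move=> w ad eta [seta neta] p Jp; have [oJ h0 _ _] := w.
have oS := strip_open oJ.
pose Pn q v := normal_part eps g x q (v - (eps * ambient_form eps v (x q)) *: x q).
have deta i q : strip J q -> is_derive q (delta_mx 0 i) eta (pd i eta q).
  by move=> Jq; apply: is_derive_pd; exact: smooth_on_differentiable seta Jq.
have eE q : strip J q -> ambient_form eps (eta q) (E1 q) = 0 /\
    ambient_form eps (eta q) (E2 q) = 0.
  move=> Jq; have [_ H] := neta q Jq; have [px0 px1] := adapted_pd ad Jq.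
  have := H 0; have := H 1; rewrite px0 px1 ambientZr => /eqP.
  by rewrite mulf_eq0 gt_eqF ?h0//= => /eqP.
have ex q : strip J q -> eps != 0 -> ambient_form eps (eta q) (x q) = 0.
  move=> Jq e0; have [] := neta q Jq.
  by rewrite /tangent_to_space_form (negbTE e0).
have dz (u : 'rV[R]_2 -> R) q i d : strip J q ->
    (forall q, strip J q -> u q = 0) -> is_derive q (delta_mx 0 i) u d -> d = 0.
  move=> Jq u0 /(pd_is_derive) <-.
  by rewrite (pd_eq_on i oS Jq u0); apply: pd_is_derive; exact: is_derive_cst.
have ix i q : strip J q -> eps != 0 -> ambient_form eps (pd i eta q) (x q) = 0.
  move=> Jq e0; have [[dx0 dx1] _ _ _ _] := ad q Jq; have [e1 e2] := eE q Jq.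
  have [->|->] := ord2_cases i.
    have H := dz _ _ _ _ Jq (fun q Jq => ex q Jq e0)
      (is_derive_ambient eps (deta 0 q Jq) dx0).
    by rewrite e1 addr0 in H.
  have H := dz _ _ _ _ Jq (fun q Jq => ex q Jq e0)
    (is_derive_ambient eps (deta 1 q Jq) dx1).
  by rewrite ambientZr e2 mulr0 addr0 in H.
have [z02 z11] : (forall q, strip J q -> ambient_form eps (pd 0 eta q) (E2 q) = 0) /\
    (forall q, strip J q -> ambient_form eps (pd 1 eta q) (E1 q) = 0).
  split=> q Jq; have [_ [dE10 dE11] [dE20 dE21] _ _] := ad q Jq.
    have H := dz _ _ _ _ Jq (fun q Jq => (eE q Jq).2)
      (is_derive_ambient eps (deta 0 q Jq) dE20).
    by rewrite ambient0r addr0 in H.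
  have H := dz _ _ _ _ Jq (fun q Jq => (eE q Jq).1)
    (is_derive_ambient eps (deta 1 q Jq) dE11).
  by rewrite ambientZr (eE q Jq).2 mulr0 addr0 in H.
have conn_eta i q : strip J q -> space_form_conn eps x i eta q = pd i eta q.
  move=> Jq; rewrite /space_form_conn; have [->|e0] := eqVneq eps 0.
    by rewrite mul0r scale0r subr0.
  by rewrite ix// mulr0 scale0r subr0.
have n0 q : strip J q -> normal_conn_coord eps g x 0 eta q =
    pd 0 eta q - ambient_form eps (pd 0 eta q) (E1 q) *: E1 q.
  move=> Jq; rewrite /normal_conn_coord conn_eta// (adapted_normal_part _ w ad Jq).
  by rewrite z02// scale0r addr0.
have n1 q : strip J q -> normal_conn_coord eps g x 1 eta q =
    pd 1 eta q - ambient_form eps (pd 1 eta q) (E2 q) *: E2 q.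
  move=> Jq; rewrite /normal_conn_coord conn_eta// (adapted_normal_part _ w ad Jq).
  by rewrite z11// scale0r add0r.
have PnE v : Pn p v = v - (eps * ambient_form eps v (x p)) *: x p
    - (ambient_form eps (v - (eps * ambient_form eps v (x p)) *: x p) (E1 p) *: E1 p
      + ambient_form eps (v - (eps * ambient_form eps v (x p)) *: x p) (E2 p) *: E2 p).
  exact: adapted_normal_part w ad Jp.
have [[dx0 dx1] [dE10 dE11] [dE20 dE21] [e11 e22 e12] [hx _ _]] := ad p Jp.
have e21 : ambient_form eps (E2 p) (E1 p) = 0 by rewrite ambientC.
have exE : eps * ambient_form eps (E1 p) (x p) = 0 /\
    eps * ambient_form eps (E2 p) (x p) = 0.
  have [->|/hx[_ [-> ->]]] := eqVneq eps 0; by rewrite ?mul0r ?mulr0.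
have Pn_tan v (a b : R) : Pn p (v - (a *: E1 p + b *: E2 p)) = Pn p v.
  rewrite !PnE !ambientE; case: exE => exE1 exE2.
  have -> : eps * (ambient_form eps v (x p) - (a * ambient_form eps (E1 p) (x p)
      + b * ambient_form eps (E2 p) (x p))) = eps * ambient_form eps v (x p).
    by rewrite mulrBr (mulrDr eps (a * _)) (mulrCA eps a) (mulrCA eps b) exE1 exE2 !mulr0 addr0 subr0.
  rewrite e11 e22 e12 e21; move: (ambient_form _ _ _) => c.
  move: (ambient_form _ _ _) (ambient_form _ _ _) => d e.
  move: (ambient_form _ _ _) (ambient_form _ _ _) => d' e'.
  apply/rowP => k; rewrite !mxE; ring.
have d1 i := is_derive_pd i (smooth_on_differentiable (smooth_on_pd 1 seta) Jp).
have d0 i := is_derive_pd i (smooth_on_differentiable (smooth_on_pd 0 seta) Jp).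
have L : normal_conn_coord eps g x 0 (normal_conn_coord eps g x 1 eta) p
    = Pn p (pd 0 (pd 1 eta) p).
  rewrite {1}/normal_conn_coord /space_form_conn.
  rewrite (pd_eq_on 0 oS Jp n1).
  have := is_derive_scale (is_derive_ambient eps (d1 0) dE20) dE20.
  rewrite scaler0 addr0; set c := _ + _ => dc.
  rewrite (pd_is_derive (is_deriveB (d1 0) dc)).
  by rewrite -(Pn_tan (pd 0 (pd 1 eta) p) 0 c) scale0r add0r.
have Rr : normal_conn_coord eps g x 1 (normal_conn_coord eps g x 0 eta) p
    = Pn p (pd 1 (pd 0 eta) p).
  rewrite {1}/normal_conn_coord /space_form_conn.
  rewrite (pd_eq_on 1 oS Jp n0).
  have dc := is_derive_scale (is_derive_ambient eps (d0 1) dE11) dE11.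
  rewrite (pd_is_derive (is_deriveB (d0 1) dc)) scalerA.
  exact: Pn_tan.
by rewrite L Rr (schwarz_row oS seta Jp) subrr.
Qed.

(** * The profile function *)

Definition profile {R : realType} (eps : R) (J : set R) (f : R -> R) : Prop :=
  [/\ open J, smooth1 J f, (forall s, J s -> 0 < f s),
      (forall s, J s -> 0 < derive1 f s) &
      (forall s, J s -> derive1n 2 f s * f s - 7 / 4 * derive1 f s ^+ 2
         + 4 * f s ^+ 4 - 4 / 3 * eps * f s ^+ 2 = 0)].

(** The warping function: the metric is [ds^2 + hf(s)^2 dt^2]. *)
Definition hf {R : realType} (f : R -> R) (s : R) : R := f s `^ (- (3 / 4)).

Definition dhf {R : realType} (f : R -> R) (s : R) : R :=
  - (3 / 4) * (derive1 f s / f s) * hf f s.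

Lemma profile_df {R : realType} (eps : R) J f (s : R) :
  profile eps J f -> J s -> is_derive s 1 f (derive1 f s).
Proof. by move=> [_ sf _ _ _] Js; exact: smooth1_is_derive sf Js. Qed.

Lemma is_derive_powRf {R : realType} (eps : R) J f (a s : R) :
  profile eps J f -> J s ->
  is_derive s 1 (fun s => f s `^ a) (a * (derive1 f s / f s) * f s `^ a).
Proof.
move=> pf Js; have [_ _ f0 _ _] := pf.
apply: (is_derive_eq (is_derive_powR_comp a (f0 s Js) (profile_df pf Js))).
have fn : f s != 0 by rewrite gt_eqF// f0.
rewrite powRB ?fn ?implybT//.
by rewrite powRr1 ?ltW ?f0//; field.
Qed.

Lemma hf_derive {R : realType} (eps : R) J f (s : R) :
  profile eps J f -> J s -> is_derive s 1 (hf f) (dhf f s).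
Proof. by move=> pf Js; exact: is_derive_powRf pf Js. Qed.

Lemma hf_gt0 {R : realType} (eps : R) J f (s : R) :
  profile eps J f -> J s -> 0 < hf f s.
Proof. by move=> [_ _ f0 _ _] Js; rewrite powR_gt0 ?f0. Qed.

(** The differential equation for [f] says that the curvature of the metric
    is [eps - 3 * f ^ 2]. *)
Lemma dhf_derive {R : realType} (eps : R) J f (s : R) :
  profile eps J f -> J s ->
  is_derive s 1 (dhf f) ((3 * f s ^+ 2 - eps) * hf f s).
Proof.
move=> pf Js; have [_ sf f0 _ ode] := pf.
have fn : f s != 0 by rewrite gt_eqF// f0.
have d1 : is_derive s 1 (fun s => derive1 f s * f s `^ (-1))
    (derive1n 2 f s * f s `^ (-1) + derive1 f s * (-1 * (derive1 f s / f s) * f s `^ (-1))).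
  apply: is_derive_comb; last exact: is_derive_powRf pf Js.
  exact: smooth1_is_derive (smooth1_derive1 sf) Js.
have d2 := is_derive_comb d1 (hf_derive pf Js).
have d3 := is_deriveZ (- (3 / 4)) d2.
have [oJ _ _ _ _] := pf.
apply: (near_eq_is_derive (f := - (3 / 4) *: (fun y => derive1 f y * f y `^ (-1) * hf f y))).
  apply: filterS (near_open oJ Js) => y Jy.
  rewrite -[LHS]/(- (3 / 4) * (derive1 f y * f y `^ (-1) * hf f y)).
  by rewrite powR_inv1; [rewrite mulrA|exact: ltW (f0 y Jy)].
apply: (is_derive_eq d3); rewrite -[_ *: _]/(_ * _) /dhf powR_inv1; last exact: ltW (f0 s Js).
have E : derive1n 2 f s = (7 / 4 * derive1 f s ^+ 2 - 4 * f s ^+ 4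
    + 4 / 3 * eps * f s ^+ 2) / f s.
  by apply: (mulIf fn); rewrite divfK//; have := ode s Js; clear; lra.
rewrite E; move: (hf f s) (derive1 f s) (f s) fn => a b c c0; field.
exact: c0.
Qed.

Lemma profile_warped {R : realType} (eps : R) J f :
  profile eps J f -> warped J (warped_metric f) (hf f) (dhf f).
Proof.
move=> pf; have [oJ _ f0 _ _] := pf; split=> //.
- by move=> s; exact: hf_gt0 pf.
- by move=> s; exact: hf_derive pf.
move=> p Jp; rewrite /warped_metric; congr (diag_mx (pt 1 _)).
rewrite /hf -powR_mulrn ?powR_ge0// -powRrM; congr (_ `^ _).
by field.
Qed.

Lemma profile_curvature {R : realType} (eps : R) J f p :
  profile eps J f -> strip J p ->
  gauss_curvature (warped_metric f) p = eps - 3 * f (p 0 0) ^+ 2.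
Proof.
move=> pf Jp.
rewrite (warped_curvature (profile_warped pf) Jp (dhf_derive pf Jp)).
rewrite mulfK; last by rewrite gt_eqF// (hf_gt0 pf).
by rewrite opprB.
Qed.

Lemma smooth1_hf {R : realType} (eps : R) J f :
  profile eps J f -> smooth1 J (hf f).
Proof. by move=> [oJ sf f0 _ _]; exact: smooth1_powR. Qed.

Lemma smooth1_ratio {R : realType} (eps : R) J f :
  profile eps J f -> smooth1 J (fun s => derive1 f s / f s).
Proof.
move=> [oJ sf f0 _ _].
have h := smooth1M oJ (smooth1_derive1 sf) (smooth1_powR (a := -1) oJ f0 sf).
apply: (smooth1_ext oJ _ h) => s Js; congr (_ * _).
exact: powR_inv1 (ltW (f0 s Js)).
Qed.

Lemma smooth1_dhf {R : realType} (eps : R) J f :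
  profile eps J f -> smooth1 J (dhf f).
Proof.
move=> pf; have [oJ _ _ _ _] := pf.
exact: (smooth1M oJ (smooth1M oJ (smooth1_cst (c := _) oJ) (smooth1_ratio pf)) (smooth1_hf pf)).
Qed.

(** Matrices are given by tables, so that smoothness and differentiation can be
    checked entry by entry with [allp] and [all2p]. *)
Definition fmx {R : realType} (n : nat) (tbl : seq (seq (R -> R))) (s : R) : 'M[R]_n :=
  \matrix_(i, j) nth (fun=> 0) (nth [::] tbl i) j s.

Lemma fmx_entry {R : realType} n (tbl : seq (seq (R -> R))) (i j : 'I_n) :
  (fun s => fmx n tbl s i j) = nth (fun=> 0) (nth [::] tbl i) j.
Proof. by apply/funext => s; rewrite mxE. Qed.

Lemma is_derive_row {R : realType} {V : normedModType R} (m n : nat)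
    (M : V -> 'M[R]_(m, n)) (x v : V) D i :
  is_derive x v M D -> is_derive x v (fun y => row i (M y)) (row i D).
Proof.
move=> h; apply/is_derive_mxP => k j; rewrite mxE.
have -> : (fun y => row i (M y) k j) = (fun y => M y i j).
  by apply/funext => y; rewrite mxE.
exact: is_derive_entry.
Qed.

Lemma row_mulmx_sum {R : realType} (m n q : nat) (A : 'M[R]_(m, n))
    (B : 'M[R]_(n, q)) i :
  row i (A *m B) = \sum_k A i k *: row k B.
Proof.
by apply/rowP => j; rewrite summxE !mxE; apply: eq_bigr => k _; rewrite !mxE.
Qed.

(** * Coefficients of the family *)

Lemma is_derive_cmul {R : realType} (k : R) (u : R -> R) (s d : R) :
  is_derive s 1 u d -> is_derive s 1 (fun y => k * u y) (k * d).
Proof. exact: is_deriveZ. Qed.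

Lemma is_derive_sq {R : realType} (u : R -> R) (s d : R) :
  is_derive s 1 u d -> is_derive s 1 (fun y => u y ^+ 2) (2 * u s * d).
Proof.
move=> h; apply: (is_derive_eq (is_deriveX 2 h)).
by rewrite -[_ *: _]/(_ * _) expr1.
Qed.

Lemma is_derive_sub {R : realType} (u w : R -> R) (s d e : R) :
  is_derive s 1 u d -> is_derive s 1 w e ->
  is_derive s 1 (fun y => u y - w y) (d - e).
Proof. exact: is_deriveB. Qed.

(** The sine and cosine of [theta], where [2 theta] is the angle from [- E_3] to the
    traceless part of [B(E_1, E_1)]. *)
Definition sa {R : realType} (c : R) (f : R -> R) (s : R) : R := c * f s `^ (- (1 / 4)).

Definition ca {R : realType} (c : R) (f : R -> R) (s : R) : R :=
  (1 - sa c f s ^+ 2) `^ (2^-1).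

(** [B(E_1, E_1) = lam E_3 + mu E_4]; choosing the norm of its traceless part to be
    [2 f] is what the Gauss equation requires, by [gauss_identity]. *)
Definition lam {R : realType} (c : R) (f : R -> R) (s : R) : R :=
  - f s + 4 * f s * sa c f s ^+ 2.

Definition mu {R : realType} (c : R) (f : R -> R) (s : R) : R :=
  4 * f s * sa c f s * ca c f s.

(** The normal connection form on [d_s], the only value for which the resulting
    surface is biconservative. *)
Definition nw {R : realType} (c : R) (f : R -> R) (s : R) : R :=
  - (derive1 f s / f s) * sa c f s / ca c f s.

(** [h B(E_2, E_2) = u3 E_3 - u4 E_4]. *)
Definition u3 {R : realType} (c : R) (f : R -> R) (s : R) : R :=
  hf f s * (3 * f s - 4 * f s * sa c f s ^+ 2).

Definition u4 {R : realType} (c : R) (f : R -> R) (s : R) : R := hf f s * mu c f s.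

(** [theta] stays acute. *)
Definition admissible {R : realType} (J : set R) (c : R) (f : R -> R) : Prop :=
  forall s, J s -> 0 < 1 - sa c f s ^+ 2.

Lemma ca_gt0 {R : realType} (J : set R) (c : R) f s :
  admissible J c f -> J s -> 0 < ca c f s.
Proof. by move=> ac Js; rewrite powR_gt0// ac. Qed.

Lemma ca_sqr {R : realType} (J : set R) (c : R) f s :
  admissible J c f -> J s -> ca c f s ^+ 2 = 1 - sa c f s ^+ 2.
Proof.
move=> ac Js; rewrite /ca -powR_mulrn ?powR_ge0// -powRrM mulVf//.
by rewrite powRr1// ltW// ac.
Qed.

Lemma sa_derive {R : realType} (eps : R) J (c : R) f s :
  profile eps J f -> J s ->
  is_derive s 1 (sa c f) (- (1 / 4) * (derive1 f s / f s) * sa c f s).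
Proof.
move=> pf Js; apply: (is_derive_eq (is_derive_cmul c (is_derive_powRf (- (1 / 4)) pf Js))).
by rewrite /sa; ring.
Qed.

Lemma ca_derive {R : realType} (eps : R) J (c : R) f s :
  profile eps J f -> admissible J c f -> J s ->
  is_derive s 1 (ca c f) ((1 / 4) * (derive1 f s / f s) * sa c f s ^+ 2 / ca c f s).
Proof.
move=> pf ac Js; have pos := ac s Js.
have d1 : is_derive s 1 (fun y => 1 - sa c f y ^+ 2)
    (0 - 2 * sa c f s * (- (1 / 4) * (derive1 f s / f s) * sa c f s)).
  exact: is_derive_sub (is_derive_cst (1 : R) s (1 : R))
    (is_derive_sq (sa_derive c pf Js)).
apply: (is_derive_eq (@is_derive_powR_comp R
  (fun y => 1 - sa c f y ^+ 2) (2^-1) s _ pos d1)).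
have c0 := ca_gt0 ac Js; have c2 := ca_sqr ac Js.
have -> : (1 - sa c f s ^+ 2) `^ (2^-1 - 1) = (ca c f s)^-1.
  have xn : 1 - sa c f s ^+ 2 != 0 by rewrite gt_eqF.
  rewrite powRB ?xn ?implybT// (powRr1 (ltW pos)) -/(ca c f s) -c2.
  by rewrite expr2 invfM mulrA mulfV ?mul1r// gt_eqF.
move: (ca c f s) c0 => T T0; move: (sa c f s) (derive1 f s / f s) => S b.
by field; rewrite gt_eqF.
Qed.

(** The Codazzi equations; they force [sa] to be a multiple of [f ^ (-1/4)]. *)
Lemma u3_derive {R : realType} (eps : R) J (c : R) f s :
  profile eps J f -> admissible J c f -> J s ->
  is_derive s 1 (u3 c f) (dhf f s * lam c f s - u4 c f s * nw c f s).
Proof.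
move=> pf ac Js; have c0 := ca_gt0 ac Js; have [_ _ f0 _ _] := pf.
have fn : f s != 0 by rewrite gt_eqF// f0.
have cn : ca c f s != 0 by rewrite gt_eqF.
have df := profile_df pf Js.
have ds := is_derive_sq (sa_derive c pf Js).
have d1 := is_derive_comb (is_derive_cmul 4 df) ds.
have d2 := is_derive_comb (hf_derive pf Js) (is_derive_sub (is_derive_cmul 3 df) d1).
apply: (is_derive_eq d2).
rewrite /dhf /lam /u4 /mu /nw.
move: (hf f s) (derive1 f s) (f s) (sa c f s) (ca c f s) fn cn.
by move=> h f' a S T a0 T0; field; rewrite a0 T0.
Qed.

Lemma u4_derive {R : realType} (eps : R) J (c : R) f s :
  profile eps J f -> admissible J c f -> J s ->
  is_derive s 1 (u4 c f) (u3 c f s * nw c f s - dhf f s * mu c f s).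
Proof.
move=> pf ac Js; have c0 := ca_gt0 ac Js; have [_ _ f0 _ _] := pf.
have fn : f s != 0 by rewrite gt_eqF// f0.
have cn : ca c f s != 0 by rewrite gt_eqF.
have c2 := ca_sqr ac Js.
have df := profile_df pf Js.
have d1 := is_derive_comb (is_derive_comb (is_derive_cmul 4 df) (sa_derive c pf Js))
  (ca_derive pf ac Js).
have d2 := is_derive_comb (hf_derive pf Js) d1.
apply: (is_derive_eq d2).
rewrite /dhf /u3 /mu /nw.
move: (hf f s) (derive1 f s) (f s) (sa c f s) (ca c f s) fn cn c2.
move=> h f' a S T a0 T0 T2.
have -> : h * (3 * a - 4 * a * S ^+ 2) * (- (f' / a) * S / T)
   = - (h * f' * S * (3 - 4 * S ^+ 2)) / T by field; rewrite a0 T0.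
apply: (mulIf T0); rewrite mulrBl divfK//.
have -> : (- (3 / 4) * (f' / a) * h * (4 * a * S * T)
  + h * ((4 * f' * S + 4 * a * (- (1 / 4) * (f' / a) * S)) * T
  + 4 * a * S * (1 / 4 * (f' / a) * S ^+ 2 / T))) * T
  = h * f' * S * (S ^+ 2) by field; rewrite a0 T0.
have -> : - (3 / 4) * (f' / a) * h * (4 * a * S * T) * T = - 3 * f' * h * S * T ^+ 2.
  by field.
by rewrite T2; ring.
Qed.

(** The Gauss equation for curvature [eps - 3 * f ^ 2]. *)
Lemma gauss_identity {R : realType} (J : set R) (c : R) f s :
  admissible J c f -> J s ->
  - lam c f s * (3 * f s - 4 * f s * sa c f s ^+ 2) + mu c f s ^+ 2 = 3 * f s ^+ 2.
Proof.
move=> ac Js; rewrite /lam /mu.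
move: (f s) (sa c f s) (ca c f s) (ca_sqr ac Js) => a S T T2.
have -> : (4 * a * S * T) ^+ 2 = 16 * a ^+ 2 * S ^+ 2 * T ^+ 2 by ring.
by rewrite T2; ring.
Qed.

Lemma smooth1_sa {R : realType} (eps : R) J (c : R) f :
  profile eps J f -> smooth1 J (sa c f).
Proof.
move=> [oJ sf f0 _ _].
exact: (smooth1M oJ (smooth1_cst (c := c) oJ) (smooth1_powR (a := _) oJ f0 sf)).
Qed.

Lemma smooth1_sa2 {R : realType} (eps : R) J (c : R) f :
  profile eps J f -> smooth1 J (fun s => sa c f s ^+ 2).
Proof.
move=> pf; have [oJ _ _ _ _] := pf.
have h := smooth1M oJ (smooth1_sa (c := c) pf) (smooth1_sa (c := c) pf).
by apply: (smooth1_ext oJ _ h) => s _; rewrite expr2.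
Qed.

Lemma smooth1N {R : realType} (J : set R) (u : R -> R) : open J ->
  smooth1 J u -> smooth1 J (fun s => - u s).
Proof.
move=> oJ su; apply: (smooth1_ext oJ _ (smooth1M oJ (smooth1_cst (c := (-1)) oJ) su)) => s _.
by rewrite mulN1r.
Qed.

Lemma smooth1_ca {R : realType} (eps : R) J (c : R) f a :
  profile eps J f -> admissible J c f -> smooth1 J (fun s => ca c f s `^ a).
Proof.
move=> pf ac; have [oJ _ _ _ _] := pf.
have h := smooth1D oJ (smooth1_cst (c := 1) oJ) (smooth1N oJ (smooth1_sa2 (c := c) pf)).
apply: (smooth1_powR (a := a) oJ (fun s Js => ca_gt0 ac Js)).
exact: (smooth1_powR (a := _) oJ ac h).
Qed.

Lemma smooth1_lam {R : realType} (eps : R) J (c : R) f :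
  profile eps J f -> smooth1 J (lam c f).
Proof.
move=> pf; have [oJ sf _ _ _] := pf.
exact: (smooth1D oJ (smooth1N oJ sf) (smooth1M oJ (smooth1M oJ (smooth1_cst (c := 4) oJ) sf)
  (smooth1_sa2 (c := c) pf))).
Qed.

Lemma smooth1_mu {R : realType} (eps : R) J (c : R) f :
  profile eps J f -> admissible J c f -> smooth1 J (mu c f).
Proof.
move=> pf ac; have [oJ sf _ _ _] := pf.
have h := smooth1M oJ (smooth1M oJ (smooth1M oJ (smooth1_cst (c := 4) oJ) sf)
  (smooth1_sa (c := c) pf)) (smooth1_ca (a := 1) pf ac).
apply: (smooth1_ext oJ _ h) => s Js; congr (_ * _).
exact: powRr1 (powR_ge0 _ _).
Qed.

Lemma smooth1_nw {R : realType} (eps : R) J (c : R) f :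
  profile eps J f -> admissible J c f -> smooth1 J (nw c f).
Proof.
move=> pf ac; have [oJ sf _ _ _] := pf.
have h := smooth1M oJ (smooth1M oJ (smooth1N oJ (smooth1_ratio pf)) (smooth1_sa (c := c) pf))
  (smooth1_ca (a := -1) pf ac).
apply: (smooth1_ext oJ _ h) => s Js; congr (_ * _).
exact: powR_inv1 (powR_ge0 _ _).
Qed.

Lemma smooth1_u3 {R : realType} (eps : R) J (c : R) f :
  profile eps J f -> smooth1 J (u3 c f).
Proof.
move=> pf; have [oJ sf _ _ _] := pf.
exact: (smooth1M oJ (smooth1_hf pf) (smooth1D oJ (smooth1M oJ (smooth1_cst (c := 3) oJ) sf)
  (smooth1N oJ (smooth1M oJ (smooth1M oJ (smooth1_cst (c := 4) oJ) sf) (smooth1_sa2 (c := c) pf))))).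
Qed.

Lemma smooth1_u4 {R : realType} (eps : R) J (c : R) f :
  profile eps J f -> admissible J c f -> smooth1 J (u4 c f).
Proof.
move=> pf ac; have [oJ _ _ _ _] := pf.
exact: (smooth1M oJ (smooth1_hf pf) (smooth1_mu pf ac)).
Qed.

(** * Connection matrices and zero curvature *)

Definition cmx {R : realType} (n : nat) (tbl : seq (seq R)) : 'M[R]_n :=
  \matrix_(i, j) nth 0 (nth [::] tbl i) j.

Fixpoint allp {T : Type} (P : T -> Prop) (s : seq T) : Prop :=
  if s is x :: s' then P x /\ allp P s' else True.

Fixpoint all2p {T U : Type} (P : T -> U -> Prop) (s : seq T) (t : seq U) : Prop :=
  match s, t with
  | x :: s', y :: t' => P x y /\ all2p P s' t'
  | [::], [::] => True
  | _, _ => False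
  end.

Lemma allp_nth {T : Type} (P : T -> Prop) d s i : P d -> allp P s -> P (nth d s i).
Proof. by move=> Pd; elim: s i => [|x s IH] [|i] //= [Px /IH]. Qed.

Lemma all2p_nth {T U : Type} (P : T -> U -> Prop) d e s t i :
  P d e -> all2p P s t -> P (nth d s i) (nth e t i).
Proof.
by move=> Pde; elim: s t i => [|x s IH] [|y t] [|i] //= [Pxy /IH].
Qed.

Lemma fmx_cmx {R : realType} (n : nat) (tbl : seq (seq (R -> R))) (s : R) :
  fmx n tbl s = cmx n (map (map (fun u => u s)) tbl).
Proof.
apply/matrixP => i j; rewrite !mxE.
have -> : nth [::] [seq [seq u s | u <- i] | i <- tbl] i = [seq u s | u <- nth [::] tbl i].
  by elim: tbl (i : nat) => [|r tbl IH] [|k] //=.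
by elim: (nth _ _ _) (j : nat) => [|u r IH] [|k] //=.
Qed.

Lemma smooth_fmx {R : realType} (n : nat) (J : set R) (tbl : seq (seq (R -> R))) :
  open J -> allp (allp (smooth1 J)) tbl ->
  forall i j, smooth1 J (fun s => fmx n tbl s i j).
Proof.
move=> oJ h i j; rewrite fmx_entry; apply: allp_nth; first exact: smooth1_cst.
by apply: (allp_nth (P := allp (smooth1 J))).
Qed.

Lemma derive_fmx {R : realType} (n : nat) (s : R) (tbl : seq (seq (R -> R)))
    (dtbl : seq (seq R)) :
  all2p (all2p (fun (u : R -> R) (d : R) => is_derive s 1 u d)) tbl dtbl ->
  is_derive s 1 (fmx n tbl) (cmx n dtbl).
Proof.
move=> h; apply/is_derive_mxP => i j; rewrite fmx_entry mxE.
apply: (all2p_nth (P := fun (u : R -> R) (d : R) => is_derive s 1 u d)).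
  exact: is_derive_cst.
exact: (all2p_nth (P := all2p (fun (u : R -> R) (d : R) => is_derive s 1 u d))).
Qed.

Lemma mul_shift0 {R : realType} {n : nat} (eps : R) (A : 'M[R]_n.+1) :
  (eps = 0 -> forall i, A i 0 = 0) -> A *m shiftmx eps = 0.
Proof.
move=> h; rewrite /shiftmx; have [e0|_] := eqVneq eps 0; last by rewrite scale0r mulmx0.
rewrite scale1r; apply/matrixP => i j; rewrite !mxE big1// => k _.
by rewrite mxE; case: (eqVneq k 0) => [->|]; rewrite ?h// ?mul0r ?mulr0.
Qed.

(** The connection forms in the directions of [s] and [t], in the frame made of
    the position, the two tangent vectors and the normal vectors. *)
Definition Os5 {R : realType} (eps c : R) (f : R -> R) : seq (seq (R -> R)) :=
  [:: [:: fun=> 0; fun=> 1; fun=> 0; fun=> 0; fun=> 0];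
      [:: fun=> - eps; fun=> 0; fun=> 0; lam c f; mu c f];
      [:: fun=> 0; fun=> 0; fun=> 0; fun=> 0; fun=> 0];
      [:: fun=> 0; fun s => - lam c f s; fun=> 0; fun=> 0; nw c f];
      [:: fun=> 0; fun s => - mu c f s; fun=> 0; fun s => - nw c f s; fun=> 0]].

Definition Ot5 {R : realType} (eps c : R) (f : R -> R) : seq (seq (R -> R)) :=
  [:: [:: fun=> 0; fun=> 0; hf f; fun=> 0; fun=> 0];
      [:: fun=> 0; fun=> 0; dhf f; fun=> 0; fun=> 0];
      [:: fun s => - eps * hf f s; fun s => - dhf f s; fun=> 0; u3 c f; fun s => - u4 c f s];
      [:: fun=> 0; fun=> 0; fun s => - u3 c f s; fun=> 0; fun=> 0];
      [:: fun=> 0; fun=> 0; u4 c f; fun=> 0; fun=> 0]].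

Definition Os4 {R : realType} (eps : R) (f : R -> R) : seq (seq (R -> R)) :=
  [:: [:: fun=> 0; fun=> 1; fun=> 0; fun=> 0];
      [:: fun=> - eps; fun=> 0; fun=> 0; fun s => - f s];
      [:: fun=> 0; fun=> 0; fun=> 0; fun=> 0];
      [:: fun=> 0; f; fun=> 0; fun=> 0]].

Definition Ot4 {R : realType} (eps : R) (f : R -> R) : seq (seq (R -> R)) :=
  [:: [:: fun=> 0; fun=> 0; hf f; fun=> 0];
      [:: fun=> 0; fun=> 0; dhf f; fun=> 0];
      [:: fun s => - eps * hf f s; fun s => - dhf f s; fun=> 0; fun s => 3 * (hf f s * f s)];
      [:: fun=> 0; fun=> 0; fun s => - (3 * (hf f s * f s)); fun=> 0]].

(** The integrability condition [Ot' = Os Ot - Ot Os]: the hypothesis is the Gauss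
    equation, [a'] and [b'] are the derivatives in the Codazzi equations. *)
Lemma zero_curvature5 {R : realType} (eps h d l m w a b dd : R) :
  dd = - eps * h - l * a + m * b ->
  let Os := cmx 5 [:: [:: 0; 1; 0; 0; 0]; [:: - eps; 0; 0; l; m]; [:: 0; 0; 0; 0; 0];
                      [:: 0; - l; 0; 0; w]; [:: 0; - m; 0; - w; 0]] in
  let Ot := cmx 5 [:: [:: 0; 0; h; 0; 0]; [:: 0; 0; d; 0; 0];
                      [:: - eps * h; - d; 0; a; - b];
                      [:: 0; 0; - a; 0; 0]; [:: 0; 0; b; 0; 0]] in
  let a' := d * l - b * w in let b' := a * w - d * m in
  cmx 5 [:: [:: 0; 0; d; 0; 0]; [:: 0; 0; dd; 0; 0];
            [:: - eps * d; - dd; 0; a'; - b'];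
            [:: 0; 0; - a'; 0; 0]; [:: 0; 0; b'; 0; 0]] = Os *m Ot - Ot *m Os.
Proof.
move=> -> Os Ot a' b'; rewrite /Os /Ot /a' /b'; apply/matrixP => i j.
rewrite !mxE !big_ord_recl !big_ord0 !mxE.
case: i => [[|[|[|[|[|//]]]]] hi]; case: j => [[|[|[|[|[|//]]]]] hj] /=; ring.
Qed.

Lemma zero_curvature4 {R : realType} (eps h d l a dd : R) :
  dd = - eps * h - l * a ->
  let Os := cmx 4 [:: [:: 0; 1; 0; 0]; [:: - eps; 0; 0; l]; [:: 0; 0; 0; 0];
                      [:: 0; - l; 0; 0]] in
  let Ot := cmx 4 [:: [:: 0; 0; h; 0]; [:: 0; 0; d; 0];
                      [:: - eps * h; - d; 0; a]; [:: 0; 0; - a; 0]] in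
  let a' := d * l in
  cmx 4 [:: [:: 0; 0; d; 0]; [:: 0; 0; dd; 0];
            [:: - eps * d; - dd; 0; a']; [:: 0; 0; - a'; 0]] = Os *m Ot - Ot *m Os.
Proof.
move=> -> Os Ot a'; rewrite /Os /Ot /a'; apply/matrixP => i j.
rewrite !mxE !big_ord_recl !big_ord0 !mxE.
case: i => [[|[|[|[|//]]]] hi]; case: j => [[|[|[|[|//]]]] hj] /=; ring.
Qed.

(** Both connection matrices preserve the Gram matrix of the frame; [y = 1] with
    [h = d = a = b = 0] gives the first one, [y = l = m = w = 0] the second one. *)
Lemma skew5 {R : realType} (eps h d l m w a b y : R) :
  let O := cmx 5 [:: [:: 0; y; h; 0; 0]; [:: - eps * y; 0; d; l; m];
                     [:: - eps * h; - d; 0; a; - b];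
                     [:: 0; - l; - a; 0; w]; [:: 0; - m; b; - w; 0]] in
  O^T *m Dmx eps + Dmx eps *m O = 0.
Proof.
move=> O; rewrite /O mul_mx_diag mul_diag_mx; apply/matrixP => i j; rewrite !mxE.
case: i => [[|[|[|[|[|//]]]]] hi]; case: j => [[|[|[|[|[|//]]]]] hj] /=; ring.
Qed.

Lemma skew4 {R : realType} (eps h d l a y : R) :
  let O := cmx 4 [:: [:: 0; y; h; 0]; [:: - eps * y; 0; d; l];
                     [:: - eps * h; - d; 0; a]; [:: 0; - l; - a; 0]] in
  O^T *m Dmx eps + Dmx eps *m O = 0.
Proof.
move=> O; rewrite /O mul_mx_diag mul_diag_mx; apply/matrixP => i j; rewrite !mxE.
case: i => [[|[|[|[|//]]]] hi]; case: j => [[|[|[|[|//]]]] hj] /=; ring.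
Qed.

(** * Frames with prescribed structure equations *)

Lemma family_frame {R : realType} (eps : R) (J : set R) (s0 c : R) f :
  profile eps J f -> is_interval J -> J s0 -> admissible J c f ->
  exists e : 'rV[R]_2 -> 'M[R]_5,
  [/\ e (pt s0 0) = Phi0 eps - shiftmx eps,
      (forall p, strip J p ->
         is_derive p (delta_mx 0 0) e (fmx 5 (Os5 eps c f) (p 0 0) *m e p) /\
         is_derive p (delta_mx 0 1) e (fmx 5 (Ot5 eps c f) (p 0 0) *m e p)),
      (forall i, smooth_on (strip J) (fun p => row i (e p))) &
      (forall p, strip J p -> onframe eps (e p))].
Proof.
move=> pf iJ J0 ac; have [oJ sf f0 _ _] := pf.
have sc (k : R) : smooth1 J (fun=> k) := smooth1_cst (c := k) oJ.
have z := sc 0; have sl := smooth1_lam (c := c) pf; have sm := smooth1_mu pf ac.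
have sw := smooth1_nw pf ac; have sh := smooth1_hf pf; have sd := smooth1_dhf pf.
have s3 := smooth1_u3 (c := c) pf; have s4 := smooth1_u4 pf ac.
have sOs : allp (allp (smooth1 J)) (Os5 eps c f).
  exact: (conj (conj z (conj (sc 1) (conj z (conj z (conj z I)))))
    (conj (conj (sc (- eps)) (conj z (conj z (conj sl (conj sm I)))))
    (conj (conj z (conj z (conj z (conj z (conj z I)))))
    (conj (conj z (conj (smooth1N oJ sl) (conj z (conj z (conj sw I)))))
    (conj (conj z (conj (smooth1N oJ sm) (conj z (conj (smooth1N oJ sw) (conj z I))))) I))))).
have sOt : allp (allp (smooth1 J)) (Ot5 eps c f).
  exact: (conj (conj z (conj z (conj sh (conj z (conj z I)))))
    (conj (conj z (conj z (conj sd (conj z (conj z I)))))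
    (conj (conj (smooth1M oJ (sc (- eps)) sh) (conj (smooth1N oJ sd) (conj z (conj s3
       (conj (smooth1N oJ s4) I)))))
    (conj (conj z (conj z (conj (smooth1N oJ s3) (conj z (conj z I)))))
    (conj (conj z (conj z (conj s4 (conj z (conj z I))))) I))))).
have dN (u : R -> R) (s d : R) :
    is_derive s 1 u d -> is_derive s 1 (fun y => - u y) (- d) by exact: is_deriveN.
have dOt s : J s -> is_derive s 1 (fmx 5 (Ot5 eps c f))
    (fmx 5 (Os5 eps c f) s *m fmx 5 (Ot5 eps c f) s
     - fmx 5 (Ot5 eps c f) s *m fmx 5 (Os5 eps c f) s).
  move=> Js.
  have h0 := hf_derive pf Js; have h1 := dhf_derive pf Js.
  have h3 := u3_derive pf ac Js; have h4 := u4_derive pf ac Js.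
  have zz := is_derive_cst (0 : R) s (1 : R).
  have E : (3 * f s ^+ 2 - eps) * hf f s =
      - eps * hf f s - lam c f s * u3 c f s + mu c f s * u4 c f s.
    by rewrite -(gauss_identity ac Js) /u3 /u4; ring.
  have Z := @zero_curvature5 R eps (hf f s) (dhf f s) (lam c f s) (mu c f s)
    (nw c f s) (u3 c f s) (u4 c f s) _ E.
  have D := derive_fmx 5 (conj (conj zz (conj zz (conj h0 (conj zz (conj zz I)))))
    (conj (conj zz (conj zz (conj h1 (conj zz (conj zz I)))))
    (conj (conj (is_derive_cmul (- eps) h0) (conj (dN _ _ _ h1) (conj zz (conj h3
       (conj (dN _ _ _ h4) I)))))
    (conj (conj zz (conj zz (conj (dN _ _ _ h3) (conj zz (conj zz I)))))
    (conj (conj zz (conj zz (conj h4 (conj zz (conj zz I))))) I))))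
    : all2p (all2p (fun (u : R -> R) (d : R) => is_derive s 1 u d)) (Ot5 eps c f)
      [:: [:: _; _; _; _; _]; [:: _; _; _; _; _]; [:: _; _; _; _; _];
          [:: _; _; _; _; _]; [:: _; _; _; _; _]]).
  by apply: (is_derive_eq D); rewrite !fmx_cmx; exact: Z.
have kOs s : J s -> (fmx 5 (Os5 eps c f) s)^T *m Dmx eps
    + Dmx eps *m fmx 5 (Os5 eps c f) s = 0.
  move=> Js; rewrite fmx_cmx.
  have := @skew5 R eps 0 0 (lam c f s) (mu c f s) (nw c f s) 0 0 1.
  by rewrite mulr1 mulr0 oppr0; exact: id.
have kOt s : J s -> (fmx 5 (Ot5 eps c f) s)^T *m Dmx eps
    + Dmx eps *m fmx 5 (Ot5 eps c f) s = 0.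
  move=> Js; rewrite fmx_cmx.
  have := @skew5 R eps (hf f s) (dhf f s) 0 0 0 (u3 c f s) (u4 c f s) 0.
  by rewrite mulr0 oppr0; exact: id.
have zOs s : J s -> fmx 5 (Os5 eps c f) s *m shiftmx eps = 0.
  move=> Js; apply: mul_shift0 => -> i; rewrite mxE.
  by case: i => [[|[|[|[|[|//]]]]] hi]; rewrite /= ?oppr0.
have zOt s : J s -> fmx 5 (Ot5 eps c f) s *m shiftmx eps = 0.
  move=> Js; apply: mul_shift0 => -> i; rewrite mxE.
  by case: i => [[|[|[|[|[|//]]]]] hi]; rewrite /= ?oppr0 ?mul0r.
exact: (moving_frame_exists oJ iJ J0 (smooth_fmx oJ sOs) (smooth_fmx oJ sOt)
  dOt kOs kOt zOs zOt).
Qed.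

Lemma smooth1_Os4 {R : realType} (eps : R) (J : set R) f :
  profile eps J f -> allp (allp (smooth1 J)) (Os4 eps f).
Proof.
move=> pf; have [oJ sf _ _ _] := pf.
have sc (k : R) : smooth1 J (fun=> k) := smooth1_cst (c := k) oJ; have z := sc 0.
exact: (conj (conj z (conj (sc 1) (conj z (conj z I))))
  (conj (conj (sc (- eps)) (conj z (conj z (conj (smooth1N oJ sf) I))))
  (conj (conj z (conj z (conj z (conj z I))))
  (conj (conj z (conj sf (conj z (conj z I)))) I)))).
Qed.

Lemma Os4_shift {R : realType} (eps : R) (f : R -> R) s : fmx 4 (Os4 eps f) s *m shiftmx eps = 0.
Proof.
apply: mul_shift0 => -> i; rewrite mxE.
by case: i => [[|[|[|[|//]]]] hi]; rewrite /= ?oppr0.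
Qed.

Lemma Ot4_shift {R : realType} (eps : R) (f : R -> R) s : fmx 4 (Ot4 eps f) s *m shiftmx eps = 0.
Proof.
apply: mul_shift0 => -> i; rewrite mxE.
by case: i => [[|[|[|[|//]]]] hi]; rewrite /= ?oppr0 ?mul0r.
Qed.

Lemma space_frame {R : realType} (eps : R) (J : set R) (s0 : R) f :
  profile eps J f -> is_interval J -> J s0 ->
  exists e : 'rV[R]_2 -> 'M[R]_4,
  [/\ (forall p, strip J p ->
         is_derive p (delta_mx 0 0) e (fmx 4 (Os4 eps f) (p 0 0) *m e p) /\
         is_derive p (delta_mx 0 1) e (fmx 4 (Ot4 eps f) (p 0 0) *m e p)),
      (forall i, smooth_on (strip J) (fun p => row i (e p))) &
      (forall p, strip J p -> onframe eps (e p))].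
Proof.
move=> pf iJ J0; have [oJ sf f0 _ _] := pf.
have sc (k : R) : smooth1 J (fun=> k) := smooth1_cst (c := k) oJ.
have z := sc 0; have sh := smooth1_hf pf; have sd := smooth1_dhf pf.
have s3 := smooth1M oJ (sc 3) (smooth1M oJ sh sf); have sOs := smooth1_Os4 pf.
have sOt : allp (allp (smooth1 J)) (Ot4 eps f).
  exact: (conj (conj z (conj z (conj sh (conj z I))))
    (conj (conj z (conj z (conj sd (conj z I))))
    (conj (conj (smooth1M oJ (sc (- eps)) sh) (conj (smooth1N oJ sd) (conj z (conj s3 I))))
    (conj (conj z (conj z (conj (smooth1N oJ s3) (conj z I)))) I)))).
have dN (u : R -> R) (s d : R) :
    is_derive s 1 u d -> is_derive s 1 (fun y => - u y) (- d) by exact: is_deriveN.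
have dOt s : J s -> is_derive s 1 (fmx 4 (Ot4 eps f))
    (fmx 4 (Os4 eps f) s *m fmx 4 (Ot4 eps f) s
     - fmx 4 (Ot4 eps f) s *m fmx 4 (Os4 eps f) s).
  move=> Js.
  have fn : f s != 0 by rewrite gt_eqF// f0.
  have h0 := hf_derive pf Js; have h1 := dhf_derive pf Js.
  have h3 := is_derive_cmul 3 (is_derive_comb h0 (profile_df pf Js)).
  have E3 : 3 * (dhf f s * f s + hf f s * derive1 f s) = dhf f s * - f s.
    rewrite /dhf; move: (hf f s) (derive1 f s) (f s) fn => a b d d0.
    by field; rewrite d0.
  rewrite E3 in h3.
  have zz := is_derive_cst (0 : R) s (1 : R).
  have E : (3 * f s ^+ 2 - eps) * hf f s =
      - eps * hf f s - (- f s) * (3 * (hf f s * f s)) by ring.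
  have Z := @zero_curvature4 R eps (hf f s) (dhf f s) (- f s)
    (3 * (hf f s * f s)) _ E; rewrite opprK in Z.
  have D := derive_fmx 4 (conj (conj zz (conj zz (conj h0 (conj zz I))))
    (conj (conj zz (conj zz (conj h1 (conj zz I))))
    (conj (conj (is_derive_cmul (- eps) h0) (conj (dN _ _ _ h1) (conj zz (conj h3 I))))
    (conj (conj zz (conj zz (conj (dN _ _ _ h3) (conj zz I)))) I)))
    : all2p (all2p (fun (u : R -> R) (d : R) => is_derive s 1 u d)) (Ot4 eps f)
      [:: [:: _; _; _; _]; [:: _; _; _; _]; [:: _; _; _; _]; [:: _; _; _; _]]).
  by apply: (is_derive_eq D); rewrite !fmx_cmx; exact: Z.
have kOs s : J s -> (fmx 4 (Os4 eps f) s)^T *m Dmx eps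
    + Dmx eps *m fmx 4 (Os4 eps f) s = 0.
  move=> Js; rewrite fmx_cmx.
  have := @skew4 R eps 0 0 (- f s) 0 1.
  by rewrite mulr1 mulr0 oppr0 opprK; exact: id.
have kOt s : J s -> (fmx 4 (Ot4 eps f) s)^T *m Dmx eps
    + Dmx eps *m fmx 4 (Ot4 eps f) s = 0.
  move=> Js; rewrite fmx_cmx.
  have := @skew4 R eps (hf f s) (dhf f s) 0 (3 * (hf f s * f s)) 0.
  by rewrite mulr0 oppr0; exact: id.
have [e [_ h1 h2 h3]] := moving_frame_exists oJ iJ J0 (smooth_fmx oJ sOs)
  (smooth_fmx oJ sOt) dOt kOs kOt
  (fun s _ => Os4_shift eps f s) (fun s _ => Ot4_shift eps f s).
by exists e.
Qed.

(** * The family of surfaces in N^4 *)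

Lemma sum5 {V : nmodType} (F : 'I_5 -> V) : \sum_(k < 5) F k =
  F 0 + (F (@Ordinal 5 1 isT) + (F (@Ordinal 5 2 isT)
    + (F (@Ordinal 5 3 isT) + F (@Ordinal 5 4 isT)))).
Proof.
rewrite !big_ord_recl big_ord0 addr0.
by congr (F _ + (F _ + (F _ + (F _ + F _)))); apply: val_inj.
Qed.

Lemma sum4 {V : nmodType} (F : 'I_4 -> V) : \sum_(k < 4) F k =
  F 0 + (F (@Ordinal 4 1 isT) + (F (@Ordinal 4 2 isT) + F (@Ordinal 4 3 isT))).
Proof.
rewrite !big_ord_recl big_ord0 addr0.
by congr (F _ + (F _ + (F _ + F _))); apply: val_inj.
Qed.

Definition r5 {R : realType} (k : 'I_5) (e : 'rV[R]_2 -> 'M[R]_5) (p : 'rV[R]_2)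
  : 'rV[R]_5 := row k (e p).

Notation i1 := (@Ordinal 5 1 isT).
Notation i2 := (@Ordinal 5 2 isT).
Notation i3 := (@Ordinal 5 3 isT).
Notation i4 := (@Ordinal 5 4 isT).

Definition solves5 {R : realType} (eps c : R) (J : set R) f
    (e : 'rV[R]_2 -> 'M[R]_5) : Prop :=
  forall p, strip J p ->
    is_derive p (delta_mx 0 0) e (fmx 5 (Os5 eps c f) (p 0 0) *m e p) /\
    is_derive p (delta_mx 0 1) e (fmx 5 (Ot5 eps c f) (p 0 0) *m e p).

Lemma frame5_d0 {R : realType} (eps c : R) (J : set R) f e p :
  solves5 eps c J f e -> strip J p ->
  [/\ is_derive p (delta_mx 0 0) (r5 0 e) (r5 i1 e p),
      is_derive p (delta_mx 0 0) (r5 i1 e)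
        (lam c f (p 0 0) *: r5 i3 e p + mu c f (p 0 0) *: r5 i4 e p - eps *: r5 0 e p),
      is_derive p (delta_mx 0 0) (r5 i2 e) 0,
      is_derive p (delta_mx 0 0) (r5 i3 e)
        (- lam c f (p 0 0) *: r5 i1 e p + nw c f (p 0 0) *: r5 i4 e p) &
      is_derive p (delta_mx 0 0) (r5 i4 e)
        (- mu c f (p 0 0) *: r5 i1 e p - nw c f (p 0 0) *: r5 i3 e p)].
Proof.
move=> sol Jp; have [d _] := sol p Jp.
have D k : is_derive p (delta_mx 0 0) (r5 k e)
    (\sum_l fmx 5 (Os5 eps c f) (p 0 0) k l *: r5 l e p).
  by rewrite -row_mulmx_sum; exact: is_derive_row.
split; apply: (is_derive_eq (D _)); rewrite sum5 !mxE /= ?scale0r ?scale1r ?add0r ?addr0 //.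
  by rewrite scaleNr addrC.
by rewrite !scaleNr.
Qed.

Lemma frame5_d1 {R : realType} (eps c : R) (J : set R) f e p :
  solves5 eps c J f e -> strip J p ->
  [/\ is_derive p (delta_mx 0 1) (r5 0 e) (hf f (p 0 0) *: r5 i2 e p),
      is_derive p (delta_mx 0 1) (r5 i1 e) (dhf f (p 0 0) *: r5 i2 e p),
      is_derive p (delta_mx 0 1) (r5 i2 e)
        (- (dhf f (p 0 0) *: r5 i1 e p) + (u3 c f (p 0 0) *: r5 i3 e p
           - u4 c f (p 0 0) *: r5 i4 e p) - (eps * hf f (p 0 0)) *: r5 0 e p),
      is_derive p (delta_mx 0 1) (r5 i3 e) (- u3 c f (p 0 0) *: r5 i2 e p) &
      is_derive p (delta_mx 0 1) (r5 i4 e) (u4 c f (p 0 0) *: r5 i2 e p)].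
Proof.
move=> sol Jp; have [_ d] := sol p Jp.
have D k : is_derive p (delta_mx 0 1) (r5 k e)
    (\sum_l fmx 5 (Ot5 eps c f) (p 0 0) k l *: r5 l e p).
  by rewrite -row_mulmx_sum; exact: is_derive_row.
split; apply: (is_derive_eq (D _)); rewrite sum5 !mxE /= ?scale0r ?scale1r ?add0r ?addr0 //.
by rewrite mulNr !scaleNr addrC.
Qed.

(** The values [B(E_1, E_1)] and [B(E_2, E_2)]. *)
Definition b1f {R : realType} (c : R) f (e : 'rV[R]_2 -> 'M[R]_5) (p : 'rV[R]_2) :=
  lam c f (p 0 0) *: r5 i3 e p + mu c f (p 0 0) *: r5 i4 e p.

Definition b2f {R : realType} (c : R) f (e : 'rV[R]_2 -> 'M[R]_5) (p : 'rV[R]_2) :=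
  (3 * f (p 0 0) - 4 * f (p 0 0) * sa c f (p 0 0) ^+ 2) *: r5 i3 e p
  - mu c f (p 0 0) *: r5 i4 e p.

Lemma onframe_nrm {R : realType} {n : nat} (eps : R) (F : 'M[R]_n.+1) (i j k : 'I_n.+1) :
  onframe eps F -> i != 0 -> j != 0 -> k != 0 -> k != i -> k != j ->
  nrm eps (row 0 F) (row i F) (row j F) (row k F).
Proof.
move=> [on ox _ _] i0 j0 k0 ki kj; split.
- by rewrite on// (negbTE ki).
- by rewrite on// (negbTE kj).
- by move=> e0; rewrite ambientC (ox e0).2.
Qed.

Lemma nrm_comb {R : realType} {n : nat} (eps a b : R) (x E1 E2 v w : 'rV[R]_n.+1) :
  nrm eps x E1 E2 v -> nrm eps x E1 E2 w -> nrm eps x E1 E2 (a *: v + b *: w).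
Proof.
move=> [v1 v2 vx] [w1 w2 wx]; split.
- by rewrite !ambientE v1 w1 !mulr0 addr0.
- by rewrite !ambientE v2 w2 !mulr0 addr0.
- by move=> e0; rewrite !ambientE (vx e0) (wx e0) !mulr0 addr0.
Qed.

Lemma family_adapted {R : realType} (eps c : R) (J : set R) f e :
  solves5 eps c J f e -> (forall p, strip J p -> onframe eps (e p)) ->
  adapted eps J (hf f) (dhf f) (r5 0 e) (r5 i1 e) (r5 i2 e) (b1f c f e) (b2f c f e).
Proof.
move=> sol ofr p Jp; have fr := ofr p Jp; have [on ox _ _] := fr.
have [x0 e10 e20 _ _] := frame5_d0 sol Jp.
have [x1 e11 e21 _ _] := frame5_d1 sol Jp.
have n3 : nrm eps (r5 0 e p) (r5 i1 e p) (r5 i2 e p) (r5 i3 e p).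
  exact: onframe_nrm.
have n4 : nrm eps (r5 0 e p) (r5 i1 e p) (r5 i2 e p) (r5 i4 e p).
  exact: onframe_nrm.
split; [by split|by split| |by split; rewrite on|].
  split=> //; apply: (is_derive_eq e21); congr (_ + _ - _).
  by rewrite /b2f scalerBr !scalerA.
split.
- move=> e0; have [ox1 ox2] := ox e0; split=> //.
  by split; rewrite ambientC ox2.
- by rewrite /b1f; exact: nrm_comb.
- by rewrite /b2f -(scaleNr (mu c f (p 0 0)) (r5 i4 e p)); exact: nrm_comb.
Qed.

Lemma onframe_space_form {R : realType} {n : nat} (eps : R) (F : 'M[R]_n.+1) :
  onframe eps F -> space_form eps (row 0 F).
Proof.
move=> [_ ox oz op]; rewrite /space_form /=; case: (eqVneq eps 0) => [e0|e0].
  by rewrite mxE oz.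
by split; [case: (ox e0)|move=> en; rewrite mxE; exact: op].
Qed.

Lemma adapted_isometric {R : realType} {n : nat} (eps : R) (J : set R) g h dh
    (x E1 E2 b1 b2 : 'rV[R]_2 -> 'rV[R]_n.+1) :
  warped J g h dh -> adapted eps J h dh x E1 E2 b1 b2 ->
  smooth_on (strip J) x -> (forall p, strip J p -> space_form eps (x p)) ->
  isometric_immersion eps (strip J) g x.
Proof.
move=> w ad sx sf; split=> // p i j Jp.
have [px0 px1] := adapted_pd ad Jp; have [_ _ _ [e11 e22 e12] _] := ad p Jp.
have e21 : ambient_form eps (E2 p) (E1 p) = 0 by rewrite ambientC.
rewrite (warped_entry _ _ w Jp).
have [->|->] := ord2_cases i; have [->|->] := ord2_cases j;
  rewrite ?px0 ?px1 ?ambientE ?e11 ?e22 ?e12 ?e21 ?mulr0 //=.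
by rewrite mulr1 expr2.
Qed.

(** The relation between [K] and the mean curvature is itself a Weingarten relation,
    affine in [K]. *)
Lemma curvature_W_surface {R : realType} {n : nat} (eps : R) (M : set 'rV[R]_2) g
    (phi : 'rV[R]_2 -> 'rV[R]_n.+1) :
  (forall p, M p ->
     gauss_curvature g p = eps - 3 * mean_curvature eps g phi p ^+ 2) ->
  W_surface eps M g phi.
Proof.
move=> K; pose Wq (a b d k : R) (x : 'rV[R]_2) :=
  a * x 0 0 ^+ 2 + b * x 0 0 + d * x 0 1 + k.
have c0 (x : 'rV[R]_2) := is_derive_coord_same (u := id) (i := 0) (p := x) (is_derive_id _ _).
have c1 (x : 'rV[R]_2) := is_derive_coord_same (u := id) (i := 1) (p := x) (is_derive_id _ _).
have o0 (x : 'rV[R]_2) := @is_derive_coord_other R R id 1 0 x isT.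
have o1 (x : 'rV[R]_2) := @is_derive_coord_other R R id 0 1 x isT.
have dW a b d k x (v : 'rV[R]_2) (d0 d1 : R) :
    is_derive x v (fun q : 'rV[R]_2 => q 0 0) d0 ->
    is_derive x v (fun q : 'rV[R]_2 => q 0 1) d1 ->
    is_derive x v (Wq a b d k) (a * (2 * x 0 0 * d0) + b * d0 + d * d1).
  move=> h0 h1; apply: (is_derive_eq (is_deriveD (is_deriveD (is_deriveD
    (is_deriveZ a (is_deriveX 2 h0)) (is_deriveZ b h0)) (is_deriveZ d h1))
    (is_derive_cst k x v))).
  by rewrite addr0 -![_ *: _]/(_ * _) expr1.
exists (Wq 3 0 1 (- eps)); split.
- apply: (@smooth_on_coind _ _ _ (fun F => exists a b d k, F = Wq a b d k)).
  + exact: openT.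
  + move=> _ [a [b [d [k ->]]]] p _.
    have e0 : differentiable (fun q : 'rV[R]_2 => q 0 0) p by exact: differentiable_coord.
    have e1 : differentiable (fun q : 'rV[R]_2 => q 0 1) p by exact: differentiable_coord.
    have -> : Wq a b d k = (a *: (fun q : 'rV[R]_2 => q 0 0) ^+ 2
      + b *: (fun q : 'rV[R]_2 => q 0 0) + d *: (fun q : 'rV[R]_2 => q 0 1)) + cst k.
      by [].
    by do ![apply: differentiableD | apply: differentiableZ | apply: differentiableX
      | exact: differentiable_cst].
  + move=> _ i [a [b [d [k ->]]]].
    have [->|->] := ord2_cases i.
      exists (Wq 0 (2 * a) 0 b); first by do 4 eexists.
      move=> p _; rewrite (pd_is_derive (dW _ _ _ _ _ _ _ _ (c0 p) (o0 p))) /Wq.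
      by ring.
    exists (Wq 0 0 0 d); first by do 4 eexists.
    move=> p _; rewrite (pd_is_derive (dW _ _ _ _ _ _ _ _ (o1 p) (c1 p))) /Wq.
    by ring.
  + by do 4 eexists.
- move=> x; exists 1; rewrite (pd_is_derive (dW _ _ _ _ _ _ _ _ (o1 x) (c1 x))).
  by rewrite !mulr0 !add0r mulr1; apply/eqP; exact: oner_neq0.
- by move=> p Mp; rewrite /Wq pt0E pt1E K//; ring.
Qed.

Lemma family_mean {R : realType} (eps c : R) (J : set R) f e p :
  profile eps J f -> solves5 eps c J f e ->
  (forall p, strip J p -> onframe eps (e p)) -> strip J p ->
  mean_vector eps (warped_metric f) (r5 0 e) p = f (p 0 0) *: r5 i3 e p.
Proof.
move=> pf sol fr Jp; rewrite (adapted_mean (profile_warped pf) (family_adapted sol fr) Jp).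
rewrite /b1f /b2f addrACA subrr addr0 -scalerDl scalerA; congr (_ *: _).
by rewrite /lam; field.
Qed.

Lemma family_mean_curvature {R : realType} (eps c : R) (J : set R) f e p :
  profile eps J f -> solves5 eps c J f e ->
  (forall p, strip J p -> onframe eps (e p)) -> strip J p ->
  mean_curvature eps (warped_metric f) (r5 0 e) p = f (p 0 0).
Proof.
move=> pf sol fr Jp; rewrite /mean_curvature (family_mean pf sol fr Jp).
have [on _ _ _] := fr p Jp; have [_ _ f0 _ _] := pf.
rewrite !ambientE on// mulr1 -expr2 sqrtr_sqr ger0_norm//.
exact: ltW (f0 _ Jp).
Qed.

Lemma family_E3 {R : realType} (eps c : R) (J : set R) f e p :
  profile eps J f -> solves5 eps c J f e ->
  (forall p, strip J p -> onframe eps (e p)) -> strip J p ->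
  E3 eps (warped_metric f) (r5 0 e) p = r5 i3 e p.
Proof.
move=> pf sol fr Jp; have [_ _ f0 _ _] := pf.
rewrite /E3 (family_mean_curvature pf sol fr Jp) (family_mean pf sol fr Jp).
by rewrite scalerA mulVf ?scale1r// gt_eqF// f0.
Qed.

(** The tangential equation reduces to [lam f' + mu f nw = - f f'], which holds by the
    choice of [nw]. *)
Lemma family_biconservative {R : realType} (eps c : R) (J : set R) f e :
  profile eps J f -> solves5 eps c J f e -> admissible J c f ->
  (forall p, strip J p -> onframe eps (e p)) ->
  biconservative eps (strip J) (warped_metric f) (r5 0 e).
Proof.
move=> pf sol ac fr p Jp; have w := profile_warped pf.
have [oJ _ f0 _ _] := pf; have ad := family_adapted sol fr.
have [_ _ _ d03 _] := frame5_d0 sol Jp; have [_ _ _ d13 _] := frame5_d1 sol Jp.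
have df := profile_df pf Jp; set s := p 0 0 in df *.
have H q : strip J q -> f (q 0 0) *: r5 i3 e q
    = mean_vector eps (warped_metric f) (r5 0 e) q.
  by move=> Jq; rewrite (family_mean pf sol fr Jq).
have n3 : nrm eps (r5 0 e p) (r5 i1 e p) (r5 i2 e p) (r5 i3 e p).
  by apply: onframe_nrm; [exact: fr| | | | |].
have n4 : nrm eps (r5 0 e p) (r5 i1 e p) (r5 i2 e p) (r5 i4 e p).
  by apply: onframe_nrm; [exact: fr| | | | |].
have N0 : normal_conn_coord eps (warped_metric f) (r5 0 e) 0
    (mean_vector eps (warped_metric f) (r5 0 e)) p
    = derive1 f s *: r5 i3 e p + (f s * nw c f s) *: r5 i4 e p.
  have d : is_derive p (delta_mx 0 0) (mean_vector eps (warped_metric f) (r5 0 e))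
      ((- (f s * lam c f s)) *: r5 i1 e p + 0 *: r5 i2 e p
       + (derive1 f s *: r5 i3 e p + (f s * nw c f s) *: r5 i4 e p)).
    apply: (near_strip_is_derive oJ Jp H).
    apply: (is_derive_eq (is_derive_scale (is_derive_coord_same df) d03)).
    rewrite scale0r addr0 scalerDr !scalerA mulrN.
    by rewrite [LHS]addrCA.
  exact: (adapted_normal_conn w ad Jp d (nrm_comb _ _ n3 n4)).
have N1 : normal_conn_coord eps (warped_metric f) (r5 0 e) 1
    (mean_vector eps (warped_metric f) (r5 0 e)) p = 0.
  have d : is_derive p (delta_mx 0 1) (mean_vector eps (warped_metric f) (r5 0 e))
      (0 *: r5 i1 e p + (- (f s * u3 c f s)) *: r5 i2 e p + (0 *: r5 i3 e p + 0 *: r5 i4 e p)).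
    apply: (near_strip_is_derive oJ Jp H).
    have o := @is_derive_coord_other _ _ f 0 1 p isT.
    apply: (is_derive_eq (is_derive_scale o d13)).
    by rewrite !scale0r !addr0 !add0r scalerA mulrN.
  by rewrite (adapted_normal_conn w ad Jp d (nrm_comb 0 0 n3 n4)) !scale0r addr0.
have Q0 : is_derive p (delta_mx 0 0)
    (fun q => mean_curvature eps (warped_metric f) (r5 0 e) q ^+ 2) (2 * f s * derive1 f s).
  apply: (@near_strip_is_derive _ _ J (fun q : 'rV[R]_2 => f (q 0 0) ^+ 2)) => //.
    by move=> q Jq; rewrite (family_mean_curvature pf sol fr Jq).
  exact: (is_derive_coord_same (u := fun s => f s ^+ 2) (is_derive_sq df)).
have Q1 : is_derive p (delta_mx 0 1)
    (fun q => mean_curvature eps (warped_metric f) (r5 0 e) q ^+ 2) 0.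
  apply: (@near_strip_is_derive _ _ J (fun q : 'rV[R]_2 => f (q 0 0) ^+ 2)) => //.
    by move=> q Jq; rewrite (family_mean_curvature pf sol fr Jq).
  exact: (@is_derive_coord_other _ _ (fun s => f s ^+ 2) 0 1 p isT).
rewrite (@warped_biconservative R 4 eps J _ _ _ (r5 0 e) p
  (fun i => normal_conn_coord eps (warped_metric f) (r5 0 e) i
     (mean_vector eps (warped_metric f) (r5 0 e)) p) _ w Jp); cbv zeta.
rewrite (pd_is_derive Q0) (pd_is_derive Q1) N0 N1.
have [B00 B01 B10 _] := adapted_second_ff w ad Jp.
rewrite B00 B01 !ambient0l !ambient0r !mulr0 !addr0 mulr0 mul0r.
have [on _ _ _] := fr p Jp.
have -> : ambient_form eps (b1f c f e p)
    (derive1 f s *: r5 i3 e p + (f s * nw c f s) *: r5 i4 e p)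
    = lam c f s * derive1 f s + mu c f s * (f s * nw c f s).
  rewrite /b1f -/s !ambientE !on//= !mulr0 !mulr1 !addr0 !add0r.
  by ring.
have fn : f s != 0 by rewrite gt_eqF// f0.
have cn : ca c f s != 0 by rewrite gt_eqF// (ca_gt0 ac Jp).
have -> : 2 * (lam c f s * derive1 f s + mu c f s * (f s * nw c f s))
   + 2 * f s * derive1 f s = 0.
  rewrite /lam /mu /nw; move: (f s) (derive1 f s) (sa c f s) (ca c f s) fn cn.
  by move=> a b S T a0 T0; field; rewrite a0 T0.
by apply/rowP => j; rewrite !mxE; case: (j == 0).
Qed.

(** [2 theta] stays below a quarter turn, at which [A_3] would be umbilic. *)
Definition small_angle {R : realType} (J : set R) (c : R) (f : R -> R) : Prop :=
  forall s, J s -> sa c f s ^+ 2 < 2^-1.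

Lemma small_admissible {R : realType} (J : set R) (c : R) (f : R -> R) :
  small_angle J c f -> admissible J c f.
Proof. by move=> h s Js; have := h s Js; lra. Qed.

Lemma family_flat_W_surface {R : realType} (eps c : R) (J : set R) f e :
  profile eps J f -> solves5 eps c J f e -> 0 < c -> small_angle J c f ->
  (forall i, smooth_on (strip J) (r5 i e)) ->
  (forall p, strip J p -> onframe eps (e p)) ->
  flat_W_surface eps (strip J) (warped_metric f) (r5 0 e).
Proof.
move=> pf sol c0 sm se fr; have ac := small_admissible sm.
have w := profile_warped pf; have ad := family_adapted sol fr.
have [oJ sf f0 f'0 _] := pf; have oS := strip_open oJ.
have mc p : strip J p -> mean_curvature eps (warped_metric f) (r5 0 e) p = f (p 0 0).
  exact: family_mean_curvature pf sol fr.
have mv p : strip J p ->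
    mean_vector eps (warped_metric f) (r5 0 e) p = f (p 0 0) *: r5 i3 e p.
  exact: family_mean pf sol fr.
have e3 p : strip J p -> E3 eps (warped_metric f) (r5 0 e) p = r5 i3 e p.
  exact: family_E3 pf sol fr.
have sa0 s : J s -> 0 < sa c f s by move=> Js; rewrite mulr_gt0// powR_gt0 ?f0.
have KE p : strip J p -> gauss_curvature (warped_metric f) p =
    eps - 3 * mean_curvature eps (warped_metric f) (r5 0 e) p ^+ 2.
  by move=> Jp; rewrite (mc p Jp); exact: profile_curvature pf Jp.
have grad0 p : strip J p ->
    grad (warped_metric f) (mean_curvature eps (warped_metric f) (r5 0 e)) p 0 0
    = derive1 f (p 0 0).
  move=> Jp; rewrite (warped_grad _ w Jp) pt0E (pd_eq_on 0 oS Jp mc).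
  by apply: pd_is_derive; exact: (is_derive_coord_same (profile_df pf Jp)).
have nc p : strip J p ->
    normal_conn_coord eps (warped_metric f) (r5 0 e) 0
      (E3 eps (warped_metric f) (r5 0 e)) p = nw c f (p 0 0) *: r5 i4 e p /\
    normal_conn_coord eps (warped_metric f) (r5 0 e) 1
      (E3 eps (warped_metric f) (r5 0 e)) p = 0.
  move=> Jp.
  have [_ _ _ d03 _] := frame5_d0 sol Jp; have [_ _ _ d13 _] := frame5_d1 sol Jp.
  have n4 : nrm eps (r5 0 e p) (r5 i1 e p) (r5 i2 e p) (r5 i4 e p).
    by apply: onframe_nrm; [exact: fr| | | | |].
  have H q : strip J q -> r5 i3 e q = E3 eps (warped_metric f) (r5 0 e) q.
    by move=> Jq; rewrite (e3 q Jq).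
  split.
    have d : is_derive p (delta_mx 0 0) (E3 eps (warped_metric f) (r5 0 e))
        (- lam c f (p 0 0) *: r5 i1 e p + 0 *: r5 i2 e p
         + (nw c f (p 0 0) *: r5 i4 e p + 0 *: r5 i4 e p)).
      by rewrite !scale0r !addr0; exact: (near_strip_is_derive oJ Jp H d03).
    rewrite (adapted_normal_conn w ad Jp d (nrm_comb _ _ n4 n4)).
    by rewrite scale0r addr0.
  have d : is_derive p (delta_mx 0 1) (E3 eps (warped_metric f) (r5 0 e))
      (0 *: r5 i1 e p + - u3 c f (p 0 0) *: r5 i2 e p
       + (0 *: r5 i4 e p + 0 *: r5 i4 e p)).
    by rewrite !scale0r !addr0 add0r; exact: (near_strip_is_derive oJ Jp H d13).
  rewrite (adapted_normal_conn w ad Jp d (nrm_comb _ _ n4 n4)).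
  by rewrite scale0r addr0.
have nw0 s : J s -> nw c f s < 0.
  move=> Js; have h1 : 0 < derive1 f s / f s by rewrite divr_gt0 ?f0 ?f'0.
  rewrite /nw !mulNr oppr_lt0.
  exact: (divr_gt0 (mulr_gt0 h1 (sa0 s Js)) (ca_gt0 ac Js)).
have on p : strip J p -> _ := fun Jp => let: And4 h _ _ _ := fr p Jp in h.
split.
- apply: (adapted_isometric w ad) => // p Jp.
  exact: onframe_space_form (fr p Jp).
- split; first exact: family_biconservative pf sol ac fr.
  move=> p Jp; split.
  + rewrite mv// => E.
    have : ambient_form eps (f (p 0 0) *: r5 i3 e p) (r5 i3 e p) = 0.
      by rewrite E ambient0l.
    by rewrite ambientZl (on p Jp)// mulr1; apply/eqP; rewrite gt_eqF// f0.
  + move=> /(congr1 (fun M : 'rV_2 => M 0 0)); rewrite grad0// mxE.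
    by apply/eqP; rewrite gt_eqF// f'0.
  + move=> /(congr1 (fun M : 'M[R]_2 => M 0 0)).
    rewrite (warped_shape _ _ _ _ _ w Jp) e3// mc//.
    have [-> _ _ _] := adapted_second_ff w ad Jp.
    rewrite /b1f !ambientE !(on p Jp)//= !mxE mulr0 addr0 !mulr1 mulr1n /lam.
    have := sm _ Jp; have := f0 _ Jp; move: (f _) (sa _ _ _) => a S a0 S2 E.
    have : a * (S ^+ 2 - 2^-1) = 0 by lra.
    by move/eqP; rewrite mulf_eq0 gt_eqF//= subr_eq0 lt_eqF.
- exact: curvature_W_surface KE.
- exact: adapted_flat w ad.
pose X1 (p : 'rV[R]_2) : 'rV[R]_2 := pt 1 0.
pose X2 (p : 'rV[R]_2) : 'rV[R]_2 := pt 0 ((hf f (p 0 0))^-1).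
have h0 s : J s -> 0 < hf f s by exact: hf_gt0 pf.
exists X1, X2, (r5 i4 e); split.
  split.
  - apply: (smooth_on_row (u := fun=> pt 1 0) oJ) => k.
    exact: (smooth1_cst (c := pt 1 0 0 k) oJ).
  - apply: (smooth_on_row (u := fun s => pt 0 ((hf f s)^-1)) oJ) => k.
    have [->|->] := ord2_cases k.
      have -> : (fun s => pt 0 ((hf f s)^-1) 0 0) = (fun=> 0 : R).
        by apply/funext => s; rewrite pt0E.
      exact: (smooth1_cst (c := 0) oJ).
    have hh := smooth1_powR (a := -1) oJ h0 (smooth1_hf pf).
    apply: (smooth1_ext oJ _ hh) => s Js.
    by rewrite pt1E; exact: powR_inv1 (ltW (h0 s Js)).
  - split; first exact: se.
    move=> p Jp; have [on1 ox oz _] := fr p Jp.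
    have [px0 px1] := adapted_pd ad Jp; split.
      rewrite /tangent_to_space_form; case: (eqVneq eps 0) => [e0|e0].
        by rewrite mxE oz.
      by rewrite ambientC (ox e0).2.
    move=> i; have [->|->] := ord2_cases i; rewrite ?px0 ?px1 ?ambientZr.
      by rewrite /r5 on1.
    by rewrite /r5 on1// mulr0.
  - move=> p Jp; have hp : hf f (p 0 0) != 0 by rewrite gt_eqF// h0.
    have [_ _ _ gE] := w.
    have prod (a b a' b' : R) : (pt a b *m warped_metric f p *m (pt a' b')^T) 0 0
        = a * a' + b * b' * hf f (p 0 0) ^+ 2.
      rewrite gE// mul_mx_diag mxE sum2 !mxE /=; ring.
    rewrite /X1 /X2 !prod; split.
    + by ring.
    + by rewrite mulr0 add0r; field.
    + by ring.
    + by rewrite /r5 (on p Jp).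
    + by rewrite e3// /r5 (on p Jp).
  - move=> p Jp A3.
    have [B00 B01 B10 B11] := adapted_second_ff w ad Jp.
    have A01 : A3 0 1 = 0.
      by rewrite /A3 (warped_shape _ _ _ _ _ w Jp) B01 ambient0l mul0r.
    have A10 : A3 1 0 = 0.
      by rewrite /A3 (warped_shape _ _ _ _ _ w Jp) B10 ambient0l mul0r.
    move: (A3) A01 A10 => A A01 A10; split.
      exists (A 0 0); apply/rowP => j; rewrite mxE sum2 !mxE /=.
      by have [->|->] := ord2_cases j; rewrite /= ?A01; ring.
    exists (A 1 1); apply/rowP => j; rewrite mxE sum2 !mxE /=.
    by have [->|->] := ord2_cases j; rewrite /= ?A10; ring.
move=> p Jp; have [n0 n1] := nc p Jp; have hp : hf f (p 0 0) != 0.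
  by rewrite gt_eqF// h0.
have ncX a b : normal_conn eps (warped_metric f) (r5 0 e) (fun=> pt a b)
      (E3 eps (warped_metric f) (r5 0 e)) p = (a * nw c f (p 0 0)) *: r5 i4 e p.
  rewrite /normal_conn.
  rewrite (sum2 (fun i => pt a b 0 i *: normal_conn_coord eps (warped_metric f) (r5 0 e) i
    (E3 eps (warped_metric f) (r5 0 e)) p)).
  by rewrite n0 n1 scaler0 addr0 pt0E scalerA.
have w1 : ambient_form eps (normal_conn eps (warped_metric f) (r5 0 e) X1
      (E3 eps (warped_metric f) (r5 0 e)) p) (r5 i4 e p) = nw c f (p 0 0).
  by rewrite (ncX 1 0) ambientZl (on p Jp)// mul1r mulr1.
have w2 : ambient_form eps (normal_conn eps (warped_metric f) (r5 0 e) X2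
      (E3 eps (warped_metric f) (r5 0 e)) p) (r5 i4 e p) = 0.
  have -> : normal_conn eps (warped_metric f) (r5 0 e) X2
      (E3 eps (warped_metric f) (r5 0 e)) p = 0.
    have := ncX 0 ((hf f (p 0 0))^-1); rewrite mul0r scale0r => <-.
    by [].
  by rewrite ambient0l.
split.
- rewrite w1 w2 mulr0; split=> //; split=> //.
  by apply/eqP; rewrite lt_eqF// nw0.
- exact: KE.
- exists 0; rewrite n0 => E.
  have : ambient_form eps (nw c f (p 0 0) *: r5 i4 e p) (r5 i4 e p) = 0.
    by rewrite E ambient0l.
  by rewrite ambientZl (on p Jp)// mulr1; apply/eqP; rewrite lt_eqF// nw0.
- move=> /(congr1 (fun M : 'M[R]_2 => M 0 0)).
  rewrite (warped_shape _ _ _ _ _ w Jp).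
  have [-> _ _ _] := adapted_second_ff w ad Jp.
  rewrite /b1f !ambientE !(on p Jp)//= mulr0 add0r !mulr1 mxE.
  apply/eqP; rewrite gt_eqF// /mu.
  have h4 : 0 < 4 :> R by [].
  exact: (mulr_gt0 (mulr_gt0 (mulr_gt0 h4 (f0 _ Jp)) (sa0 _ Jp)) (ca_gt0 ac Jp)).
move=> /(congr1 (fun M : 'rV_2 => M 0 0)).
rewrite /levi_civita (sum2 (fun i => X2 p 0 i *: levi_civita_coord (warped_metric f) i X2 p)).
rewrite /X2 pt0E pt1E scale0r add0r (warped_lc _ _ w Jp) !mxE /=.
have -> : pd 1 (fun q : 'rV[R]_2 => pt 0 (hf f (q 0 0))^-1 0 0) p = 0.
  have -> : (fun q : 'rV[R]_2 => pt 0 (hf f (q 0 0))^-1 0 0) = (fun=> 0).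
    by apply/funext => q; rewrite pt0E.
  by apply: pd_is_derive; exact: is_derive_cst.
rewrite sub0r; apply/eqP; rewrite mulf_neq0 ?invr_eq0// oppr_eq0.
rewrite mulf_neq0 ?invr_eq0// mulf_neq0//.
have h1 : 0 < derive1 f (p 0 0) / f (p 0 0) by rewrite divr_gt0 ?f0 ?f'0.
have h34 : 0 < 3 / 4 :> R by rewrite divr_gt0.
rewrite lt_eqF// /dhf !mulNr oppr_lt0.
exact: (mulr_gt0 (mulr_gt0 h34 h1) (h0 _ Jp)).
Qed.

(** * Distinct parameters give non-congruent surfaces *)

Lemma is_derive_line0 {R : realType} {W : normedModType R} (F : 'rV[R]_2 -> W)
    (s t : R) d :
  is_derive (pt s t) (delta_mx 0 0) F d -> is_derive s 1 (fun s => F (pt s t)) d.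
Proof.
have E : (fun h : R => h^-1 *: (F (pt (h *: 1 + s) t) - F (pt s t))) =
    (fun h : R => h^-1 *: (F (h *: delta_mx 0 0 + pt s t) - F (pt s t))).
  apply/funext => h; congr (_ *: (F _ - _)); apply/rowP => i; rewrite !mxE.
  by have [->|->] := ord2_cases i; rewrite /= ?mulr0 ?add0r.
by move=> [h1 h2]; apply: DeriveDef; [rewrite /derivable E|rewrite /derive E].
Qed.

Lemma is_derive_line1 {R : realType} {W : normedModType R} (F : 'rV[R]_2 -> W)
    (s t : R) d :
  is_derive (pt s t) (delta_mx 0 1) F d -> is_derive t 1 (fun t => F (pt s t)) d.
Proof.
have E : (fun h : R => h^-1 *: (F (pt s (h *: 1 + t)) - F (pt s t))) =
    (fun h : R => h^-1 *: (F (h *: delta_mx 0 1 + pt s t) - F (pt s t))).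
  apply/funext => h; congr (_ *: (F _ - _)); apply/rowP => i; rewrite !mxE.
  by have [->|->] := ord2_cases i; rewrite /= ?mulr0 ?add0r.
by move=> [h1 h2]; apply: DeriveDef; [rewrite /derivable E|rewrite /derive E].
Qed.

Lemma is_derive_eq_on {R : realType} (J : set R) (u w : R -> R) (s d e : R) :
  open J -> J s -> (forall x, J x -> u x = w x) ->
  is_derive s 1 u d -> is_derive s 1 w e -> d = e.
Proof.
move=> oJ Js uw hu [_ <-].
have : is_derive s 1 w d.
  by apply: near_eq_is_derive hu; apply: filterS (near_open oJ Js) => x; exact: uw.
by case.
Qed.

(** Chordal distances along a curve determine the length of its acceleration:
    differentiate the squared distance twice in each of its two arguments. *)
Lemma chord_acceleration {R : realType} {n : nat} (eps : R) (J : set R)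
    (X X1 X2 Y Y1 Y2 : R -> 'rV[R]_n.+1) : open J ->
  (forall s, J s -> is_derive s 1 X (X1 s)) ->
  (forall s, J s -> is_derive s 1 X1 (X2 s)) ->
  (forall s, J s -> is_derive s 1 Y (Y1 s)) ->
  (forall s, J s -> is_derive s 1 Y1 (Y2 s)) ->
  (forall s, J s -> ambient_form eps (X1 s) (X1 s) = ambient_form eps (Y1 s) (Y1 s)) ->
  (forall s u, J s -> J u -> ambient_form eps (X s - X u) (X s - X u)
     = ambient_form eps (Y s - Y u) (Y s - Y u)) ->
  forall s, J s -> ambient_form eps (X2 s) (X2 s) = ambient_form eps (Y2 s) (Y2 s).
Proof.
move=> oJ dX dX1 dY dY1 speed chord.
have dsub (Z Z1 : R -> 'rV[R]_n.+1) (u s : R) : is_derive s 1 Z (Z1 s) ->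
    is_derive s 1 (fun s => Z s - Z u) (Z1 s).
  move=> h; apply: (is_derive_eq (is_deriveB h (is_derive_cst (Z u) s (1 : R)))).
  by rewrite subr0.
have cst_l (Z Z1 : R -> 'rV[R]_n.+1) (v : 'rV[R]_n.+1) (s : R) : is_derive s 1 Z (Z1 s) ->
    is_derive s 1 (fun s => ambient_form eps v (Z s)) (ambient_form eps v (Z1 s)).
  move=> h; apply: (is_derive_eq (is_derive_ambient eps (is_derive_cst v s (1 : R)) h)).
  by rewrite ambient0l add0r.
have st1 s u : J s -> J u -> ambient_form eps (X1 s) (X s - X u)
    = ambient_form eps (Y1 s) (Y s - Y u).
  move=> Js Ju.
  have a := dsub _ _ u _ (dX s Js); have b := dsub _ _ u _ (dY s Js).
  have := is_derive_eq_on oJ Js (fun x Jx => chord x u Jx Ju)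
    (is_derive_ambient eps a a) (is_derive_ambient eps b b).
  rewrite [ambient_form _ (X s - _) _]ambientC [ambient_form _ (Y s - _) _]ambientC.
  by move: (ambient_form _ _ _) (ambient_form _ _ _) => v w; lra.
have st2 s u : J s -> J u -> ambient_form eps (X2 s) (X s - X u)
    = ambient_form eps (Y2 s) (Y s - Y u).
  move=> Js Ju.
  have a := dsub _ _ u _ (dX s Js); have b := dsub _ _ u _ (dY s Js).
  have := is_derive_eq_on oJ Js (fun x Jx => st1 x u Jx Ju)
    (is_derive_ambient eps (dX1 s Js) a) (is_derive_ambient eps (dY1 s Js) b).
  rewrite speed//; move: (ambient_form _ _ _) (ambient_form _ _ _) (ambient_form _ _ _).
  by move=> v w z; lra.
have st2' s u : J s -> J u -> ambient_form eps (X2 s) (X u) - ambient_form eps (Y2 s) (Y u)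
    = ambient_form eps (X2 s) (X s) - ambient_form eps (Y2 s) (Y s).
  move=> Js Ju; have := st2 s u Js Ju; rewrite !ambientDr !ambientNr.
  move: (ambient_form _ _ _) (ambient_form _ _ _) (ambient_form _ _ _) (ambient_form _ _ _).
  by move=> v w y z; lra.
have st3 s u : J s -> J u -> ambient_form eps (X2 s) (X1 u)
    = ambient_form eps (Y2 s) (Y1 u).
  move=> Js Ju; apply/eqP; rewrite -subr_eq0; apply/eqP.
  exact: (is_derive_eq_on oJ Ju (fun x Jx => st2' s x Js Jx)
    (is_derive_sub (cst_l _ _ (X2 s) _ (dX u Ju)) (cst_l _ _ (Y2 s) _ (dY u Ju)))
    (is_derive_cst _ _ _)).
move=> s Js.
exact: (is_derive_eq_on oJ Js (fun x Jx => st3 s x Js Jx)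
    (cst_l _ _ (X2 s) _ (dX1 s Js)) (cst_l _ _ (Y2 s) _ (dY1 s Js))).
Qed.

(** The curve [t = 0] has an acceleration of squared length [lam^2 + mu^2 + eps], and
    [lam^2 + mu^2 = f^2 + 8 f^2 sa^2] determines the parameter. *)
Lemma family_not_congruent {R : realType} (eps c c' : R) (J : set R) f s0 e e' :
  profile eps J f -> J s0 -> solves5 eps c J f e -> solves5 eps c' J f e' ->
  0 < c -> 0 < c' -> admissible J c f -> admissible J c' f ->
  (forall p, strip J p -> onframe eps (e p)) ->
  (forall p, strip J p -> onframe eps (e' p)) ->
  congruent_on eps (strip J) (r5 0 e) (r5 0 e') -> c = c'.
Proof.
move=> pf J0 sol sol' c0 c0' ac ac' fr fr' [F [_ iso] FE].
have [oJ _ f0 _ _] := pf.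
have Jpt s : J s -> strip J (pt s 0) by rewrite strip_pt.
pose acc c e s := lam c f s *: r5 i3 e (pt s 0) + mu c f s *: r5 i4 e (pt s 0)
  - eps *: r5 0 e (pt s 0).
have D0 c1 e1 s : solves5 eps c1 J f e1 -> J s ->
    is_derive s 1 (fun s => r5 0 e1 (pt s 0)) (r5 i1 e1 (pt s 0)).
  by move=> so Js; apply: is_derive_line0; have [] := frame5_d0 so (Jpt s Js).
have D1 c1 e1 s : solves5 eps c1 J f e1 -> J s ->
    is_derive s 1 (fun s => r5 i1 e1 (pt s 0)) (acc c1 e1 s).
  move=> so Js; apply: is_derive_line0; have [_ h _ _ _] := frame5_d0 so (Jpt s Js).
  by rewrite pt0E in h.
have accE c1 e1 s : (forall p, strip J p -> onframe eps (e1 p)) -> admissible J c1 f ->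
    J s -> ambient_form eps (acc c1 e1 s) (acc c1 e1 s) =
    f s ^+ 2 + 8 * f s ^+ 2 * (c1 * f s `^ (- (1 / 4))) ^+ 2
      + (if eps == 0 then 0 else eps).
  move=> fr1 ac1 Js; have [on ox _ _] := fr1 _ (Jpt s Js).
  have g1 : lam c1 f s ^+ 2 + mu c1 f s ^+ 2
      = f s ^+ 2 + 8 * f s ^+ 2 * (c1 * f s `^ (- (1 / 4))) ^+ 2.
    rewrite /lam /mu -/(sa c1 f s).
    move: (f s) (sa c1 f s) (ca c1 f s) (ca_sqr ac1 Js) => a S T T2.
    have -> : (4 * a * S * T) ^+ 2 = 16 * a ^+ 2 * S ^+ 2 * T ^+ 2 by ring.
    by rewrite T2; ring.
  rewrite -g1 /acc; have [e0|e0] := eqVneq eps 0.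
    rewrite {2 3}e0 scale0r subr0 !ambientE !on//= !mulr0 !mulr1 !addr0 add0r.
    by rewrite !expr2.
  have [oxx ox'] := ox e0.
  have h3 := ox' i3 isT; have h4 := ox' i4 isT.
  have n33 := on i3 i3 isT isT; have n34 := on i3 i4 isT isT.
  have n44 := on i4 i4 isT isT; have n43 := on i4 i3 isT isT.
  move: n33 n34 n43 n44 h3 h4 oxx; rewrite /r5; move: (row _ _) (row _ _) (row _ _).
  move: (lam _ _ _) (mu _ _ _) => a b x v u; clear -e0 => n33 n34 n43 n44 h3 h4 oxx.
  rewrite !ambientE n33 n34 n43 n44 oxx ![ambient_form _ _ x]ambientC ?oxx h3 h4 /=.
  by field.
have key := chord_acceleration (eps := eps) oJ (fun s Js => D0 c e s sol Js)
  (fun s Js => D1 c e s sol Js) (fun s Js => D0 c' e' s sol' Js)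
  (fun s Js => D1 c' e' s sol' Js).
have speed s : J s -> ambient_form eps (r5 i1 e (pt s 0)) (r5 i1 e (pt s 0)) =
    ambient_form eps (r5 i1 e' (pt s 0)) (r5 i1 e' (pt s 0)).
  move=> Js; have [on _ _ _] := fr _ (Jpt s Js); have [on' _ _ _] := fr' _ (Jpt s Js).
  by rewrite !on// !on'.
have chord s u : J s -> J u ->
    ambient_form eps (r5 0 e (pt s 0) - r5 0 e (pt u 0))
      (r5 0 e (pt s 0) - r5 0 e (pt u 0)) =
    ambient_form eps (r5 0 e' (pt s 0) - r5 0 e' (pt u 0))
      (r5 0 e' (pt s 0) - r5 0 e' (pt u 0)).
  move=> Js Ju; rewrite !FE; [|exact: Jpt|exact: Jpt].
  by rewrite iso//; apply: onframe_space_form; [exact: fr (Jpt s Js)|exact: fr (Jpt u Ju)].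
have := key speed chord s0 J0; rewrite !accE// => /addIr/addrI.
have a0 := f0 _ J0; have b0 : 0 < f s0 `^ (- (1 / 4)) by rewrite powR_gt0.
have k0 : 8 * f s0 ^+ 2 != 0 by rewrite mulf_neq0// sqrf_eq0 gt_eqF.
move/(mulfI k0)/eqP; rewrite eqrXn2 ?mulr_ge0 ?ltW// => /eqP.
by apply: mulIf; rewrite gt_eqF.
Qed.

(** * Continuous dependence on the parameter *)

(** Joint continuity is uniform along a compact segment. *)
Lemma near_bounded_distance {R : realType} (n m : nat) (a b c0 : R)
    (A : R -> R -> 'M[R]_(n, m)) (d : R) :
  (forall u i j, a <= u <= b -> {for (c0, u), continuous (fun q => A q.1 q.2 i j)}) ->
  0 < d ->
  \forall c \near c0, forall u i j, a <= u <= b -> `|(A c u - A c0 u) i j| <= d.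
Proof.
move=> cA d0.
have /compact_near_coveringP : compact `[a, b]%classic := @segment_compact R a b.
move=> /(_ R (nbhs c0) (fun c u => forall i j, `|(A c u - A c0 u) i j| <= d) _) cov.
have : \forall c \near c0, `[a, b]%classic `<=`
    (fun u => forall i j, `|(A c u - A c0 u) i j| <= d).
  apply: cov => u /=; rewrite in_itv /= => uab.
  have H (ij : 'I_n * 'I_m) :
      \forall u' \near u & c \near c0, `|(A c u' - A c0 u') ij.1 ij.2| <= d.
    have d2 : 0 < d / 2 by rewrite divr_gt0.
    have /cvgrPdist_lt/(_ _ d2)[[U V] [/= Uc Vu] UV] := cA u ij.1 ij.2 uab.
    exists (V, U) => //= -[u' c] /= [Vu' Uc']; rewrite !mxE.
    have h1 := UV (c, u') (conj Uc' Vu'); have h2 := UV (c0, u') (conj (nbhs_singleton Uc) Vu').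
    rewrite /= in h1 h2.
    have -> : A c u' ij.1 ij.2 - A c0 u' ij.1 ij.2 =
      (A c0 u ij.1 ij.2 - A c0 u' ij.1 ij.2) - (A c0 u ij.1 ij.2 - A c u' ij.1 ij.2).
      by ring.
    apply: le_trans (ler_normB _ _) _; rewrite [leRHS]splitr.
    exact: ltW (ltrD h2 h1).
  have h := @filter_forall _ _ (fun ij (q : R * R) => `|(A q.2 q.1 - A c0 q.1) ij.1 ij.2| <= d)
    (filter_prod (nbhs u) (nbhs c0)) (filter_prod_filter _ _) H.
  have [Q HQ sub] := h.
  by exists Q => // -[u' c] Qq i j; exact: (sub (u', c) Qq (i, j)).
by apply: filterS => c h u i j uab; apply: h; rewrite /= in_itv.
Qed.

(** On a compact segment the coefficients are uniformly close to those of the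
    limiting parameter, so the stability estimate applies. *)
Lemma linear_ode_continuous_param {R : realType} (m q : nat) (J : set R)
    (A : R -> R -> 'M[R]_m) (Y : R -> R -> 'M[R]_(m, q)) (c0 s0 s : R) :
  is_interval J -> J s0 -> J s ->
  (forall u i j, J u -> {for (c0, u), continuous (fun q => A q.1 q.2 i j)}) ->
  (\forall c \near c0, forall u, J u -> is_derive u 1 (Y c) (A c u *m Y c u)) ->
  (forall i j, {for c0, continuous (fun c => Y c s0 i j)}) ->
  forall i j, {for c0, continuous (fun c => Y c s i j)}.
Proof.
move=> iJ J0 Js cA dY cY i j.
pose a0 := Num.min s0 s; pose b0 := Num.max s0 s.
have ab : a0 <= b0 by rewrite /a0 /b0 ge_min !le_max lexx.
have Jab u : a0 <= u <= b0 -> J u.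
  rewrite /a0 /b0; case: (leP s0 s) => [h|/ltW h].
    by exact: iJ.
  by exact: iJ.
have btwE u : btw s0 s u -> a0 <= u <= b0.
  rewrite /btw /a0 /b0 => /orP[]/andP[h1 h2].
    by rewrite (min_idPl (le_trans h1 h2)) (max_idPr (le_trans h1 h2)) h1.
  by rewrite (min_idPr (le_trans h1 h2)) (max_idPl (le_trans h1 h2)) h1.
have dY0 := nbhs_singleton dY.
have [a a_gt0 Ha] : exists2 K, 0 < K & forall u i j, a0 <= u <= b0 -> `|A c0 u i j| <= K.
  apply: (continuous_bounded_mx ab Jab) => u i' j' Ju.
  apply: (@continuous_comp _ _ _ (fun u => (c0, u)) (fun q => A q.1 q.2 i' j')).
    exact: (cvg_pair (f := fun=> c0) (g := id) (cvg_cst c0) (@cvg_id _ (nbhs u))).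
  exact: cA.
have [z z_gt0 Hz] : exists2 K, 0 < K & forall u i j, a0 <= u <= b0 -> `|Y c0 u i j| <= K.
  apply: (continuous_bounded_mx ab Jab) => u i' j' Ju.
  exact: is_derive_continuous (is_derive_entry i' j' (dY0 u Ju)).
pose k := 2 * ((m * q)%:R * m%:R * (a + 1)) + 1.
have k0 : 0 < k by rewrite /k ltr_wpDl// !mulr_ge0// addr_ge0// ltW.
pose E := expR (k * `|s - s0|); have E0 : 0 < E by exact: expR_gt0.
pose X := (m * q)%:R * (m%:R * z) ^+ 2 / k * E.
have X0 : 0 <= X by rewrite /X !mulr_ge0 ?sqr_ge0 ?invr_ge0// ltW.
apply/cvgrPdist_lt => e e0.
(* [X * d ^ 2] bounds the effect of the coefficients; [d] keeps it under half of
   [e ^ 2], the other half being left to the initial values *)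
pose d := e / (2 * (X + 1)).
have d0 : 0 < d by rewrite divr_gt0// mulr_gt0// ltr_wpDl.
have Xd : X * d ^+ 2 < e ^+ 2 / 2.
  have -> : X * d ^+ 2 = e ^+ 2 / 2 * (X / (2 * (X + 1) ^+ 2)).
    by rewrite /d; field; rewrite gt_eqF// ltr_wpDl.
  rewrite -[ltRHS]mulr1 ltr_pM2l ?divr_gt0 ?exprn_gt0//.
  rewrite ltr_pdivrMr ?mul1r; last by rewrite mulr_gt0// exprn_gt0// ltr_wpDl.
  by clear -X0; nra.
have near1 := near_bounded_distance (fun u i j h => cA u i j (Jab u h)) ltr01.
have near2 := near_bounded_distance (fun u i j h => cA u i j (Jab u h)) d0.
have near3 : \forall c \near c0,
    \sum_ij (Y c s0 ij.1 ij.2 - Y c0 s0 ij.1 ij.2) ^+ 2 < e ^+ 2 / (2 * E).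
  pose r := e ^+ 2 / (2 * E) / ((m * q)%:R + 1).
  have mq : 0 < (m * q)%:R + 1 :> R by rewrite ltr_wpDl.
  have r0 : 0 < r by rewrite !divr_gt0 ?exprn_gt0// mulr_gt0.
  have H (ij : 'I_m * 'I_q) : \forall c \near c0,
      (Y c s0 ij.1 ij.2 - Y c0 s0 ij.1 ij.2) ^+ 2 <= r.
    have sr : 0 < Num.sqrt r by rewrite sqrtr_gt0.
    have /cvgrPdist_lt/(_ _ sr) := cY ij.1 ij.2; apply: filterS => c h.
    rewrite -sqrrN opprB -real_normK ?num_real// -(sqr_sqrtr (ltW r0)).
    by rewrite lerXn2r ?nnegrE ?sqrtr_ge0// ltW.
  have := @filter_forall _ _ (fun ij c => (Y c s0 ij.1 ij.2 - Y c0 s0 ij.1 ij.2) ^+ 2 <= r)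
    (nbhs c0) (nbhs_filter c0) H.
  apply: filterS => c h; apply: le_lt_trans (ler_sum _ (fun ij _ => h ij)) _.
  rewrite sumr_const card_prod !card_ord.
  rewrite [ltRHS](_ : _ = ((m * q)%:R + 1) * r); last first.
    by rewrite /r [RHS]mulrCA divff ?mulr1 ?(gt_eqF mq).
  by rewrite -[ltLHS]mulr_natl mulrDl mul1r ltrDl.
near=> c.
have dYc : forall u, J u -> is_derive u 1 (Y c) (A c u *m Y c u) by near: c.
have n1 : forall u i j, a0 <= u <= b0 -> `|(A c u - A c0 u) i j| <= 1 by near: c.
have n2 : forall u i j, a0 <= u <= b0 -> `|(A c u - A c0 u) i j| <= d by near: c.
have n3 : \sum_ij (Y c s0 ij.1 ij.2 - Y c0 s0 ij.1 ij.2) ^+ 2 < e ^+ 2 / (2 * E).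
  by near: c.
have Ac u i' j' : btw s0 s u -> `|A c u i' j'| <= a + 1.
  move=> /btwE h; have := n1 u i' j' h; have := Ha u i' j' h; rewrite !mxE => h1 h2.
  have -> : A c u i' j' = A c0 u i' j' + (A c u i' j' - A c0 u i' j') by ring.
  exact: le_trans (ler_normD _ _) (lerD h1 h2).
have := linear_ode_stability (erefl k) (fun u h => dYc u (Jab u (btwE u h)))
  (fun u h => dY0 u (Jab u (btwE u h))) Ac (fun u i j h => n2 u i j (btwE u h))
  (fun u i j h => Hz u i j (btwE u h)) (addr_ge0 (ltW a_gt0) ler01) (ltW d0) (ltW z_gt0)
  i j.
rewrite -/E mulrDl => h.
have : (Y c s i j - Y c0 s i j) ^+ 2 < e ^+ 2.
  apply: le_lt_trans h _; rewrite [ltRHS]splitr; apply: ltrD.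
    have -> : e ^+ 2 / 2 = e ^+ 2 / (2 * E) * E by field; rewrite gt_eqF.
    by rewrite ltr_pM2r.
  apply: le_lt_trans Xd; rewrite le_eqVlt; apply/orP; left; apply/eqP.
  by rewrite /X; ring.
rewrite distrC -[X in X < _ -> _]real_normK ?num_real//.
by rewrite ltr_pXn2r ?nnegrE ?(ltW e0).
Unshelve. all: by end_near.
Qed.

Lemma continuous_mx {T : topologicalType} {R : realType} (m n : nat)
    (F : T -> 'M[R]_(m, n)) (x : T) :
  (forall i j, {for x, continuous (fun y => F y i j)}) -> {for x, continuous F}.
Proof.
move=> h; apply/cvgrPdist_lt => e e0.
have e2 : 0 < e / 2 by rewrite divr_gt0.
have H (ij : 'I_m * 'I_n) : \forall y \near x, `|F x ij.1 ij.2 - F y ij.1 ij.2| < e / 2.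
  by have /cvgrPdist_lt/(_ _ e2) := h ij.1 ij.2.
have := @filter_forall _ _ (fun ij y => `|F x ij.1 ij.2 - F y ij.1 ij.2| < e / 2)
    (nbhs x) (nbhs_filter x) H.
apply: filterS => y hy; apply: (@le_lt_trans _ _ (e / 2)).
  rewrite /Num.Def.normr/= mx_normrE; apply: bigmax_le; first exact: ltW.
  by move=> ij _; rewrite !mxE; exact: ltW (hy ij).
by rewrite ltr_pdivrMr// ltr_pMr// ltr1n.
Qed.

Lemma continuous_in_second {R : realType} (u : R -> R) (c s : R) :
  {for s, continuous u} -> {for (c, s), continuous (fun q : R * R => u q.2)}.
Proof.
move=> h; apply: (@continuous_comp _ _ _ (fun q : R * R => q.2) u).
  exact: cvg_snd.
exact: h.
Qed.

(** Joint continuity in the parameter [c] and the arclength [s]. *)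
Section JointContinuity.
Context {R : realType} (eps : R) (J : set R) (f : R -> R) (c s : R).
Context (pf : profile eps J f) (Js : J s) (ac : admissible J c f).
Local Notation jc F := {for (c, s), continuous F}.

Lemma jcM (F G : R * R -> R) : jc F -> jc G -> jc (fun q => F q * G q).
Proof. by move=> h1 h2; exact: cvgM h1 h2. Qed.

Lemma jcD (F G : R * R -> R) : jc F -> jc G -> jc (fun q => F q + G q).
Proof. by move=> h1 h2; exact: cvgD h1 h2. Qed.

Lemma jcN (F : R * R -> R) : jc F -> jc (fun q => - F q).
Proof. by move=> h1; exact: cvgN h1. Qed.

Lemma jc_cst (k : R) : jc (fun=> k).
Proof. exact: cvg_cst. Qed.

Lemma jc_smooth (u : R -> R) : smooth1 J u -> jc (fun q => u q.2).
Proof. by move=> h; exact: continuous_in_second (smooth1_continuous h Js). Qed.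

Lemma jc_powR (F : R * R -> R) (a : R) : 0 < F (c, s) -> jc F -> jc (fun q => F q `^ a).
Proof.
move=> F0 h; apply: (@continuous_comp _ _ _ F (fun x => x `^ a)); first exact: h.
exact: is_derive_continuous (is_derive1_powR a F0).
Qed.

Lemma jc_sa : jc (fun q => sa q.1 f q.2).
Proof.
apply: jcM; first exact: cvg_fst.
have [oJ sf f0 _ _] := pf.
exact: (jc_smooth (smooth1_powR (a := - (1 / 4)) oJ f0 sf)).
Qed.

Lemma jc_sa2 : jc (fun q => sa q.1 f q.2 ^+ 2).
Proof. exact: jcM jc_sa jc_sa. Qed.

Lemma jc_ca : jc (fun q => ca q.1 f q.2).
Proof.
apply: jc_powR; first exact: ac.
exact: jcD (@jc_cst 1) (jcN jc_sa2).
Qed.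

Lemma jc_f : jc (fun q => f q.2).
Proof. by have [_ sf _ _ _] := pf; exact: jc_smooth. Qed.

Lemma jc_4f : jc (fun q => 4 * f q.2).
Proof. exact: jcM (@jc_cst 4) jc_f. Qed.

Lemma jc_lam : jc (fun q => lam q.1 f q.2).
Proof. exact: jcD (jcN jc_f) (jcM jc_4f jc_sa2). Qed.

Lemma jc_mu : jc (fun q => mu q.1 f q.2).
Proof. exact: jcM (jcM jc_4f jc_sa) jc_ca. Qed.

Lemma jc_nw : jc (fun q => nw q.1 f q.2).
Proof.
apply: jcM; first exact: jcM (jcN (jc_smooth (smooth1_ratio pf))) jc_sa.
by apply: cvgV; [rewrite gt_eqF// (ca_gt0 ac Js)|exact: jc_ca].
Qed.

Lemma jc_u3 : jc (fun q => u3 q.1 f q.2).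
Proof.
apply: jcM (jc_smooth (smooth1_hf pf)) _.
exact: jcD (jcM (@jc_cst 3) jc_f) (jcN (jcM jc_4f jc_sa2)).
Qed.

Lemma jc_u4 : jc (fun q => u4 q.1 f q.2).
Proof. exact: jcM (jc_smooth (smooth1_hf pf)) jc_mu. Qed.

Lemma jc_Os5 (i j : 'I_5) : jc (fun q => fmx 5 (Os5 eps q.1 f) q.2 i j).
Proof.
have := jc_lam; have := jc_mu; have := jc_nw.
have z (k : R) := @jc_cst k => nwc muc lac.
have -> : (fun q : R * R => fmx 5 (Os5 eps q.1 f) q.2 i j) =
    (fun q : R * R => nth (fun=> 0) (nth [::] (Os5 eps q.1 f) i) j q.2).
  by apply/funext => q; rewrite mxE.
case: i => [[|[|[|[|[|//]]]]] hi]; case: j => [[|[|[|[|[|//]]]]] hj] /=.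
- exact: (z 0).
- exact: (z 1).
- exact: (z 0).
- exact: (z 0).
- exact: (z 0).
- exact: (z (- eps)).
- exact: (z 0).
- exact: (z 0).
- exact: (lac).
- exact: (muc).
- exact: (z 0).
- exact: (z 0).
- exact: (z 0).
- exact: (z 0).
- exact: (z 0).
- exact: (z 0).
- exact: (jcN lac).
- exact: (z 0).
- exact: (z 0).
- exact: (nwc).
- exact: (z 0).
- exact: (jcN muc).
- exact: (z 0).
- exact: (jcN nwc).
- exact: (z 0).
Qed.

Lemma jc_Ot5 (i j : 'I_5) : jc (fun q => fmx 5 (Ot5 eps q.1 f) q.2 i j).
Proof.
have := jc_u3; have := jc_u4; have := jc_smooth (smooth1_hf pf).
have := jc_smooth (smooth1_dhf pf).
have z (k : R) := @jc_cst k => dhc hc u4c u3c.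
have -> : (fun q : R * R => fmx 5 (Ot5 eps q.1 f) q.2 i j) =
    (fun q : R * R => nth (fun=> 0) (nth [::] (Ot5 eps q.1 f) i) j q.2).
  by apply/funext => q; rewrite mxE.
case: i => [[|[|[|[|[|//]]]]] hi]; case: j => [[|[|[|[|[|//]]]]] hj] /=.
- exact: (z 0).
- exact: (z 0).
- exact: (hc).
- exact: (z 0).
- exact: (z 0).
- exact: (z 0).
- exact: (z 0).
- exact: (dhc).
- exact: (z 0).
- exact: (z 0).
- exact: (jcM (z _) hc).
- exact: (jcN dhc).
- exact: (z 0).
- exact: (u3c).
- exact: (jcN u4c).
- exact: (z 0).
- exact: (z 0).
- exact: (jcN u3c).
- exact: (z 0).
- exact: (z 0).
- exact: (z 0).
- exact: (z 0).
- exact: (u4c).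
- exact: (z 0).
- exact: (z 0).
Qed.

End JointContinuity.

(** A positive lower bound of [f] bounds [f ^ (-1/4)] from above, so one interval of
    parameters serves all of [J]. *)
Lemma small_angle_range {R : realType} (J : set R) (f : R -> R) (m c : R) :
  0 < m -> (forall s, J s -> m <= f s) -> 0 < c < m `^ (1 / 4) / 2 -> small_angle J c f.
Proof.
move=> m0 mf /andP[c0 cb] s Js; have ms := mf s Js.
have f0 : 0 < f s := lt_le_trans m0 ms.
have p0 : 0 < f s `^ (1 / 4) by rewrite powR_gt0.
have le4 : m `^ (1 / 4) <= f s `^ (1 / 4).
  by rewrite ge0_ler_powR ?nnegrE ?divr_ge0// ltW.
have S0 : 0 < sa c f s by rewrite mulr_gt0// powR_gt0.
have S1 : sa c f s < 2^-1.
  rewrite /sa powRN ltr_pdivrMr//; apply: lt_le_trans cb _.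
  by rewrite mulrC ler_pM2l ?invr_gt0.
by clear -S0 S1; nra.
Qed.

(** The surfaces start from one and the same frame over [s0], and the
    coefficients of their structure equations are continuous in [c]. *)
Lemma family_continuous {R : realType} (eps : R) (J : set R) f (s0 c0 : R)
    (F0 : 'M[R]_5) (e : R -> 'rV[R]_2 -> 'M[R]_5) :
  profile eps J f -> is_interval J -> J s0 -> admissible J c0 f ->
  (\forall c \near c0, e c (pt s0 0) = F0 /\ solves5 eps c J f (e c)) ->
  forall p i j, strip J p -> {for c0, continuous (fun c => e c p i j)}.
Proof.
move=> pf iJ J0 ac E p i j Jp.
have along_s k l s : J s -> {for c0, continuous (fun c => e c (pt s 0) k l)}.
  move=> Js.
  apply: (linear_ode_continuous_param (A := fun c u => fmx 5 (Os5 eps c f) u)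
    (Y := fun c u => e c (pt u 0)) (c0 := c0) iJ J0 Js).
  - by move=> u i' j' Ju; exact: (jc_Os5 pf Ju ac).
  - apply: filterS E => c [_ sol] u Ju.
    have Jpu : strip J (pt u 0) by rewrite strip_pt.
    have [h _] := sol _ Jpu; rewrite pt0E in h.
    exact: is_derive_line0.
  - move=> i' j'.
    have : (fun=> F0 i' j') @ c0 --> F0 i' j' by exact: cvg_cst.
    have E0 := (nbhs_singleton E).1; rewrite /prop_for /continuous_at /= E0.
    apply: cvg_trans; apply: near_eq_cvg.
    by apply: filterS E => c [-> _].
rewrite (ptE p); move: (p 0 0) (p 0 1) (Jp : J (p 0 0)) => s t Js.
have iT : is_interval [set: R] by [].
apply: (linear_ode_continuous_param (A := fun c _ => fmx 5 (Ot5 eps c f) s)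
  (Y := fun c u => e c (pt s u)) (c0 := c0) (s0 := 0) iT I I).
- move=> u i' j' _.
  apply: (@continuous_comp _ _ _ (fun q : R * R => (q.1, s))
    (fun q => fmx 5 (Ot5 eps q.1 f) q.2 i' j')); last exact: (jc_Ot5 pf Js ac).
  exact: (cvg_pair (f := fst) (g := fun=> s) cvg_fst (cvg_cst s)).
- apply: filterS E => c [_ sol] u _.
  have Jpu : strip J (pt s u) by rewrite strip_pt.
  have [_ h] := sol _ Jpu; rewrite pt0E in h.
  exact: is_derive_line1.
- by move=> i' j'; exact: along_s.
Qed.

Lemma family_exists {R : realType} (eps : R) (J : set R) f (m : R) :
  profile eps J f -> is_interval J -> J !=set0 -> 0 < m ->
  (forall s, J s -> m <= f s) ->
  exists (a b : R) (phi : R -> 'rV[R]_2 -> 'rV[R]_5),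
  [/\ a < b,
      (forall c : R, a < c < b ->
         flat_W_surface eps (strip J) (warped_metric f) (phi c) /\
         forall p, strip J p -> mean_curvature eps (warped_metric f) (phi c) p ^+ 2
           = 1 / 3 * (eps - gauss_curvature (warped_metric f) p)),
      (forall c c' : R, a < c < b -> a < c' < b -> c <> c' ->
         ~ congruent_on eps (strip J) (phi c) (phi c')) &
      (forall (p : 'rV[R]_2) (c : R), strip J p -> a < c < b ->
         {for c, continuous (fun c' : R => phi c' p)})].
Proof.
move=> pf iJ [s0 J0] m0 mf; pose b := m `^ (1 / 4) / 2.
have sm c : 0 < c < b -> small_angle J c f by exact: small_angle_range.
have ac c : 0 < c < b -> admissible J c f by move=> /sm/small_admissible.
pose P c e := [/\ e (pt s0 0) = Phi0 eps - shiftmx eps, solves5 eps c J f e,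
  forall i, smooth_on (strip J) (r5 i e) & forall p, strip J p -> onframe eps (e p)].
have ex c : exists e, 0 < c < b -> P c e.
  have [h|_] := boolP (0 < c < b); last by exists (fun=> 0).
  by have [e [h1 h2 h3 h4]] := family_frame pf iJ J0 (ac c h); exists e.
have [e he] := choice ex.
exists 0, b, (fun c => r5 0 (e c)); split.
- by rewrite divr_gt0// powR_gt0.
- move=> c cb; have [_ sol se fr] := he c cb; have /andP[c0 _] := cb.
  split; first exact: family_flat_W_surface pf sol c0 (sm c cb) se fr.
  move=> p Jp; rewrite (family_mean_curvature pf sol fr Jp) (profile_curvature pf Jp).
  by field.
- move=> c c' cb cb' cc' H; have [_ sol se fr] := he c cb; have [_ sol' _ fr'] := he c' cb'.
  have /andP[c0 _] := cb; have /andP[c0' _] := cb'.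
  exact: cc' (family_not_congruent pf J0 sol sol' c0 c0' (ac _ cb) (ac _ cb') fr fr' H).
move=> p c Jp cb; apply: continuous_mx => k j.
have -> : (fun y => r5 0 (e y) p k j) = (fun y => e y p 0 j).
  by apply/funext => y; rewrite mxE.
apply: (family_continuous pf iJ J0 (ac c cb) _ Jp (F0 := Phi0 eps - shiftmx eps)).
have : \forall c' \near c, 0 < c' < b.
  have /andP[h1 h2] := cb.
  near=> c'; apply/andP; split; near: c'; [exact: lt_nbhsr|exact: lt_nbhsl].
apply: filterS => c' cb'; have [h1 h2 _ _] := he c' cb'; by split.
Unshelve. all: by end_near.
Qed.

(** * The surface in N^3 *)

Definition r4 {R : realType} (k : 'I_4) (e : 'rV[R]_2 -> 'M[R]_4) (p : 'rV[R]_2)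
  : 'rV[R]_4 := row k (e p).

Notation j1 := (@Ordinal 4 1 isT).
Notation j2 := (@Ordinal 4 2 isT).
Notation j3 := (@Ordinal 4 3 isT).

Definition solves4 {R : realType} (eps : R) (J : set R) f
    (e : 'rV[R]_2 -> 'M[R]_4) : Prop :=
  forall p, strip J p ->
    is_derive p (delta_mx 0 0) e (fmx 4 (Os4 eps f) (p 0 0) *m e p) /\
    is_derive p (delta_mx 0 1) e (fmx 4 (Ot4 eps f) (p 0 0) *m e p).

Lemma frame4_d0 {R : realType} (eps : R) (J : set R) f e p :
  solves4 eps J f e -> strip J p ->
  [/\ is_derive p (delta_mx 0 0) (r4 0 e) (r4 j1 e p),
      is_derive p (delta_mx 0 0) (r4 j1 e) (- f (p 0 0) *: r4 j3 e p - eps *: r4 0 e p),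
      is_derive p (delta_mx 0 0) (r4 j2 e) 0 &
      is_derive p (delta_mx 0 0) (r4 j3 e) (f (p 0 0) *: r4 j1 e p)].
Proof.
move=> sol Jp; have [d _] := sol p Jp.
have D k : is_derive p (delta_mx 0 0) (r4 k e)
    (\sum_l fmx 4 (Os4 eps f) (p 0 0) k l *: r4 l e p).
  by rewrite -row_mulmx_sum; exact: is_derive_row.
split; apply: (is_derive_eq (D _)); rewrite sum4 !mxE /= ?scale0r ?scale1r ?add0r ?addr0 //.
by rewrite [- eps *: _]scaleNr addrC.
Qed.

Lemma frame4_d1 {R : realType} (eps : R) (J : set R) f e p :
  solves4 eps J f e -> strip J p ->
  [/\ is_derive p (delta_mx 0 1) (r4 0 e) (hf f (p 0 0) *: r4 j2 e p),
      is_derive p (delta_mx 0 1) (r4 j1 e) (dhf f (p 0 0) *: r4 j2 e p),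
      is_derive p (delta_mx 0 1) (r4 j2 e)
        (- (dhf f (p 0 0) *: r4 j1 e p) + hf f (p 0 0) *: ((3 * f (p 0 0)) *: r4 j3 e p)
           - (eps * hf f (p 0 0)) *: r4 0 e p) &
      is_derive p (delta_mx 0 1) (r4 j3 e)
        (- (3 * (hf f (p 0 0) * f (p 0 0))) *: r4 j2 e p)].
Proof.
move=> sol Jp; have [_ d] := sol p Jp.
have D k : is_derive p (delta_mx 0 1) (r4 k e)
    (\sum_l fmx 4 (Ot4 eps f) (p 0 0) k l *: r4 l e p).
  by rewrite -row_mulmx_sum; exact: is_derive_row.
split; apply: (is_derive_eq (D _)); rewrite sum4 !mxE /= ?scale0r ?scale1r ?add0r ?addr0 //.
by rewrite mulNr !scaleNr scalerA addrC [hf _ _ * (3 * _)]mulrCA.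
Qed.

Lemma space_adapted {R : realType} (eps : R) (J : set R) f e :
  solves4 eps J f e -> (forall p, strip J p -> onframe eps (e p)) ->
  adapted eps J (hf f) (dhf f) (r4 0 e) (r4 j1 e) (r4 j2 e)
    (fun p => - f (p 0 0) *: r4 j3 e p) (fun p => (3 * f (p 0 0)) *: r4 j3 e p).
Proof.
move=> sol ofr p Jp; have fr := ofr p Jp; have [on ox _ _] := fr.
have [x0 e10 e20 _] := frame4_d0 sol Jp.
have [x1 e11 e21 _] := frame4_d1 sol Jp.
have n3 : nrm eps (r4 0 e p) (r4 j1 e p) (r4 j2 e p) (r4 j3 e p).
  exact: onframe_nrm.
have nk k : nrm eps (r4 0 e p) (r4 j1 e p) (r4 j2 e p) (k *: r4 j3 e p).
  by have := nrm_comb k 0 n3 n3; rewrite scale0r addr0.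
split; [by split|by split|by split|by split; rewrite on|].
split; [|exact: nk|exact: nk].
by move=> e0; have [ox1 ox2] := ox e0; split=> //; split; rewrite ambientC ox2.
Qed.

Lemma space_mean {R : realType} (eps : R) (J : set R) f e p :
  profile eps J f -> solves4 eps J f e ->
  (forall p, strip J p -> onframe eps (e p)) -> strip J p ->
  mean_vector eps (warped_metric f) (r4 0 e) p = f (p 0 0) *: r4 j3 e p.
Proof.
move=> pf sol fr Jp; rewrite (adapted_mean (profile_warped pf) (space_adapted sol fr) Jp).
by rewrite -scalerDl scalerA; congr (_ *: _); field.
Qed.

Lemma space_mean_curvature {R : realType} (eps : R) (J : set R) f e p :
  profile eps J f -> solves4 eps J f e ->
  (forall p, strip J p -> onframe eps (e p)) -> strip J p ->
  mean_curvature eps (warped_metric f) (r4 0 e) p = f (p 0 0).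
Proof.
move=> pf sol fr Jp; rewrite /mean_curvature (space_mean pf sol fr Jp).
have [on _ _ _] := fr p Jp; have [_ _ f0 _ _] := pf.
rewrite !ambientE on// mulr1 -expr2 sqrtr_sqr ger0_norm//.
exact: ltW (f0 _ Jp).
Qed.

Lemma space_non_CMC_biconservative {R : realType} (eps : R) (J : set R) f e :
  profile eps J f -> solves4 eps J f e ->
  (forall p, strip J p -> onframe eps (e p)) ->
  non_CMC_biconservative3 eps (strip J) (warped_metric f) (r4 0 e).
Proof.
move=> pf sol fr; have w := profile_warped pf; have ad := space_adapted sol fr.
have [oJ _ f0 f'0 _] := pf; have oS := strip_open oJ.
have mc p : strip J p -> mean_curvature eps (warped_metric f) (r4 0 e) p = f (p 0 0).
  exact: space_mean_curvature pf sol fr.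
have mv p : strip J p ->
    mean_vector eps (warped_metric f) (r4 0 e) p = f (p 0 0) *: r4 j3 e p.
  exact: space_mean pf sol fr.
split; last first.
  move=> p Jp; have [on _ _ _] := fr p Jp; split.
    rewrite mv// => E.
    have : ambient_form eps (f (p 0 0) *: r4 j3 e p) (r4 j3 e p) = 0.
      by rewrite E ambient0l.
    by rewrite ambientZl on// mulr1; apply/eqP; rewrite gt_eqF// f0.
  move=> /(congr1 (fun M : 'rV_2 => M 0 0)); rewrite (warped_grad _ w Jp) pt0E mxE.
  rewrite (pd_eq_on 0 oS Jp mc).
  rewrite (pd_is_derive (is_derive_coord_same (profile_df pf Jp))).
  by apply/eqP; rewrite gt_eqF// f'0.
move=> p Jp; have [on _ _ _] := fr p Jp.
have [_ _ _ d03] := frame4_d0 sol Jp; have [_ _ _ d13] := frame4_d1 sol Jp.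
have df := profile_df pf Jp; set s := p 0 0 in df *.
have H q : strip J q -> f (q 0 0) *: r4 j3 e q
    = mean_vector eps (warped_metric f) (r4 0 e) q.
  by move=> Jq; rewrite (mv q Jq).
have n3 : nrm eps (r4 0 e p) (r4 j1 e p) (r4 j2 e p) (r4 j3 e p).
  by apply: onframe_nrm; [exact: fr| | | | |].
have N0 : normal_conn_coord eps (warped_metric f) (r4 0 e) 0
    (mean_vector eps (warped_metric f) (r4 0 e)) p = derive1 f s *: r4 j3 e p.
  have d : is_derive p (delta_mx 0 0) (mean_vector eps (warped_metric f) (r4 0 e))
      ((f s * f s) *: r4 j1 e p + 0 *: r4 j2 e p
       + (derive1 f s *: r4 j3 e p + 0 *: r4 j3 e p)).
    apply: (near_strip_is_derive oJ Jp H).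
    apply: (is_derive_eq (is_derive_scale (is_derive_coord_same df) d03)).
    by rewrite !scale0r !addr0 scalerA addrC.
  by rewrite (adapted_normal_conn w ad Jp d (nrm_comb _ _ n3 n3)) scale0r addr0.
have N1 : normal_conn_coord eps (warped_metric f) (r4 0 e) 1
    (mean_vector eps (warped_metric f) (r4 0 e)) p = 0.
  have d : is_derive p (delta_mx 0 1) (mean_vector eps (warped_metric f) (r4 0 e))
      (0 *: r4 j1 e p + (- (f s * (3 * (hf f s * f s)))) *: r4 j2 e p
        + (0 *: r4 j3 e p + 0 *: r4 j3 e p)).
    apply: (near_strip_is_derive oJ Jp H).
    have o := @is_derive_coord_other _ _ f 0 1 p isT.
    apply: (is_derive_eq (is_derive_scale o d13)).
    by rewrite !scale0r !addr0 !add0r scalerA mulrN.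
  by rewrite (adapted_normal_conn w ad Jp d (nrm_comb 0 0 n3 n3)) !scale0r addr0.
have Q0 : is_derive p (delta_mx 0 0)
    (fun q => mean_curvature eps (warped_metric f) (r4 0 e) q ^+ 2) (2 * f s * derive1 f s).
  apply: (@near_strip_is_derive _ _ J (fun q : 'rV[R]_2 => f (q 0 0) ^+ 2)) => //.
    by move=> q Jq; rewrite mc.
  exact: (is_derive_coord_same (u := fun s => f s ^+ 2) (is_derive_sq df)).
have Q1 : is_derive p (delta_mx 0 1)
    (fun q => mean_curvature eps (warped_metric f) (r4 0 e) q ^+ 2) 0.
  apply: (@near_strip_is_derive _ _ J (fun q : 'rV[R]_2 => f (q 0 0) ^+ 2)) => //.
    by move=> q Jq; rewrite mc.
  exact: (@is_derive_coord_other _ _ (fun s => f s ^+ 2) 0 1 p isT).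
rewrite (@warped_biconservative R 3 eps J _ _ _ (r4 0 e) p
  (fun i => normal_conn_coord eps (warped_metric f) (r4 0 e) i
     (mean_vector eps (warped_metric f) (r4 0 e)) p) _ w Jp); cbv zeta.
rewrite (pd_is_derive Q0) (pd_is_derive Q1) N0 N1.
have [B00 B01 B10 _] := adapted_second_ff w ad Jp.
rewrite B00 B01 !ambient0l !ambient0r !mulr0 !addr0 mulr0 mul0r.
have -> : ambient_form eps (- f (p 0 0) *: r4 j3 e p) (derive1 f s *: r4 j3 e p)
    = - (f s * derive1 f s).
  by rewrite -/s !ambientE on//= mulr1 mulNr.
have -> : 2 * - (f s * derive1 f s) + 2 * f s * derive1 f s = 0 by ring.
by apply/rowP => j; rewrite !mxE; case: (j == 0).
Qed.

(** * Gauss formulas of an arbitrary immersion *)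

(** The normal of the space form at [x], up to a factor: the position vector,
    or the normal [e_0] of the hyperplane for [eps = 0]. *)
Definition pole {R : realType} {n : nat} (eps : R) (x : 'rV[R]_n.+1) : 'rV[R]_n.+1 :=
  if eps == 0 then delta_mx 0 0 else x.

Lemma eps_pole {R : realType} {n : nat} (eps a : R) (x : 'rV[R]_n.+1) :
  (eps * a) *: pole eps x = (eps * a) *: x.
Proof. by rewrite /pole; case: eqP => // ->; rewrite mul0r !scale0r. Qed.

Lemma eps_ambient_pole {R : realType} {n : nat} (eps : R) (v x : 'rV[R]_n.+1) :
  (eps * ambient_form eps v (pole eps x)) *: pole eps x = (eps * ambient_form eps v x) *: x.
Proof. by rewrite /pole; case: eqP => // ->; rewrite !mul0r !scale0r. Qed.

Lemma ambient_e0 {R : realType} {n : nat} (v : 'rV[R]_n.+1) :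
  ambient_form 0 v (delta_mx 0 0) = v 0 0.
Proof.
rewrite ambient_formE (bigD1 0)//= big1 ?addr0; last first.
  by move=> i i0; rewrite mxE (negbTE i0) andbF !mulr0.
by rewrite mxE /sig ltxx andbF mul1r mulr1.
Qed.

Lemma pole_square {R : realType} {n : nat} (eps : R) (x : 'rV[R]_n.+1) :
  space_form eps x -> ambient_form eps (pole eps x) (pole eps x)
    = if eps == 0 then 1 else eps^-1.
Proof.
rewrite /space_form /pole /=; case: eqP => [->|_ []//] _.
by rewrite ambient_e0 mxE.
Qed.

Lemma pole_derive {R : realType} {n : nat} (eps : R) (psi : 'rV[R]_2 -> 'rV[R]_n.+1) p v d :
  is_derive p v psi d ->
  is_derive p v (fun q => pole eps (psi q)) ((eps != 0)%:R *: d).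
Proof.
rewrite /pole; case: eqP => [_|_] h /=; last by rewrite scale1r.
by rewrite scale0r; exact: is_derive_cst.
Qed.

Lemma strip_is_derive_eq {R : realType} {W : normedModType R} (J : set R)
    (F G : 'rV[R]_2 -> W) p v d e :
  open J -> strip J p -> (forall q, strip J q -> F q = G q) ->
  is_derive p v F d -> is_derive p v G e -> d = e.
Proof.
move=> oJ Jp FG hF [_ <-]; have [_ <-] := near_strip_is_derive oJ Jp FG hF.
by [].
Qed.

Lemma self_add_eq0 {R : realType} (u : R) : u + u = 0 -> u = 0.
Proof. by lra. Qed.

Lemma immersion_tangent {R : realType} {n : nat} (eps : R) (J : set R) g
    (psi : 'rV[R]_2 -> 'rV[R]_n.+1) p i :
  open J -> isometric_immersion eps (strip J) g psi -> strip J p ->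
  ambient_form eps (pd i psi p) (pole eps (psi p)) = 0.
Proof.
move=> oJ [sm sf _] Jp; have d := is_derive_pd i (smooth_on_differentiable sm Jp).
have := sf p Jp; rewrite /space_form /pole /=; case: (eqVneq eps 0) => [e0|e0] sfp.
  rewrite e0 ambient_e0.
  apply: (strip_is_derive_eq oJ Jp _ (is_derive_entry 0 0 d) (is_derive_cst (0 : R) p _)).
  by move=> q Jq; have := sf q Jq; rewrite /space_form /= e0 eqxx.
have E : forall q, strip J q -> ambient_form eps (psi q) (psi q) = eps^-1.
  by move=> q Jq; have := sf q Jq; rewrite /space_form /= (negbTE e0) => -[].
have e := strip_is_derive_eq oJ Jp E (is_derive_ambient eps d d) (is_derive_cst (eps^-1) p _).
rewrite (ambientC eps (psi p) (pd i psi p)) in e; exact: self_add_eq0 e.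
Qed.

(** Differentiating the entries of the metric determines the scalar products
    of the second derivatives with the tangent frame, and differentiating these
    once more gives the Gauss equation; [T] is the common value of the third
    derivatives [d_0 d_1 d_1] and [d_1 d_0 d_1]. *)
Lemma second_derivative_products {R : realType} {n : nat} (eps tau : R) (J : set R)
    (h dh : R -> R) (ddh : R) (X0 X1 V00 V01 V11 y : 'rV[R]_2 -> 'rV[R]_n.+1)
    (T : 'rV[R]_n.+1) (p : 'rV[R]_2) :
  open J -> strip J p ->
  (forall s, J s -> is_derive s 1 h (dh s)) -> is_derive (p 0 0) 1 dh ddh ->
  (forall q, strip J q ->
     [/\ is_derive q (delta_mx 0 0) X0 (V00 q), is_derive q (delta_mx 0 1) X0 (V01 q),
         is_derive q (delta_mx 0 0) X1 (V01 q) & is_derive q (delta_mx 0 1) X1 (V11 q)]) ->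
  is_derive p (delta_mx 0 0) y (tau *: X0 p) -> is_derive p (delta_mx 0 1) y (tau *: X1 p) ->
  is_derive p (delta_mx 0 0) V11 T -> is_derive p (delta_mx 0 1) V01 T ->
  (forall q, strip J q ->
     [/\ ambient_form eps (X0 q) (X0 q) = 1, ambient_form eps (X0 q) (X1 q) = 0,
         h (q 0 0) ^+ 2 = ambient_form eps (X1 q) (X1 q) :> R,
         ambient_form eps (X0 q) (y q) = 0 & ambient_form eps (X1 q) (y q) = 0]) ->
  let a := h (p 0 0) in let b := dh (p 0 0) in
  [/\ [/\ ambient_form eps (V00 p) (X0 p) = 0, ambient_form eps (V00 p) (X1 p) = 0 &
         ambient_form eps (V00 p) (y p) = - tau],
      [/\ ambient_form eps (V01 p) (X0 p) = 0, ambient_form eps (V01 p) (X1 p) = a * b &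
         ambient_form eps (V01 p) (y p) = 0],
      [/\ ambient_form eps (V11 p) (X0 p) = - (a * b), ambient_form eps (V11 p) (X1 p) = 0 &
         ambient_form eps (V11 p) (y p) = - (tau * a ^+ 2)] &
      ambient_form eps (V00 p) (V11 p) - ambient_form eps (V01 p) (V01 p)
        = - (b * b + a * ddh)].
Proof.
move=> oJ Jp hdh hddh dX dy0 dy1 dT1 dT0 pr a b.
have g00 q : strip J q -> ambient_form eps (X0 q) (X0 q) = 1 by case/pr.
have g01 q : strip J q -> ambient_form eps (X0 q) (X1 q) = 0 by case/pr.
have g11 q : strip J q -> h (q 0 0) ^+ 2 = ambient_form eps (X1 q) (X1 q) by case/pr.
have y0 q : strip J q -> ambient_form eps (X0 q) (y q) = 0 by case/pr.
have y1 q : strip J q -> ambient_form eps (X1 q) (y q) = 0 by case/pr.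
have [d00 d10 d01 d11] := dX p Jp.
have half (u c d : R) : 2 * c * d = u + u -> u = c * d by lra.
have cst (c : R) i := is_derive_cst c p (delta_mx 0 i : 'rV[R]_2).
have k000 : ambient_form eps (V00 p) (X0 p) = 0.
  have e := strip_is_derive_eq oJ Jp g00 (is_derive_ambient eps d00 d00) (cst 1 0).
  rewrite (ambientC eps (X0 p) (V00 p)) in e; exact: self_add_eq0 e.
have k010 q : strip J q -> ambient_form eps (V01 q) (X0 q) = 0.
  move=> Jq; have [_ d _ _] := dX q Jq.
  have e := strip_is_derive_eq oJ Jq g00 (is_derive_ambient eps d d) (is_derive_cst (1 : R) q _).
  rewrite (ambientC eps (X0 q) (V01 q)) in e; exact: self_add_eq0 e.
have k011 q : strip J q -> ambient_form eps (V01 q) (X1 q) = h (q 0 0) * dh (q 0 0).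
  move=> Jq; have [_ _ d _] := dX q Jq; have e := strip_is_derive_eq oJ Jq g11
    (is_derive_coord_same (u := fun s => h s ^+ 2) (is_derive_sq (hdh _ Jq)))
    (is_derive_ambient eps d d).
  rewrite (ambientC eps (X1 q) (V01 q)) in e; exact: half e.
have k111 : ambient_form eps (V11 p) (X1 p) = 0.
  have e := strip_is_derive_eq oJ Jp g11
    (@is_derive_coord_other _ _ (fun s => h s ^+ 2) 0 1 p isT) (is_derive_ambient eps d11 d11).
  rewrite (ambientC eps (X1 p) (V11 p)) in e; exact: self_add_eq0 (esym e).
have k001 : ambient_form eps (V00 p) (X1 p) = 0.
  have e := strip_is_derive_eq oJ Jp g01 (is_derive_ambient eps d00 d01) (cst 0 0).
  by rewrite (ambientC eps (X0 p) (V01 p)) (k010 p Jp) addr0 in e.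
have k110 q : strip J q -> - (h (q 0 0) * dh (q 0 0)) = ambient_form eps (V11 q) (X0 q).
  move=> Jq; have [_ d d' d''] := dX q Jq.
  have e := strip_is_derive_eq oJ Jq g01 (is_derive_ambient eps d d'')
    (is_derive_cst (0 : R) q _).
  rewrite (k011 q Jq) (ambientC eps (X0 q) (V11 q)) in e.
  by rewrite (addr0_eq e).
have eq_opp (u v : R) : u + v = 0 -> u = - v by lra.
have V00y : ambient_form eps (V00 p) (y p) = - tau.
  have e := strip_is_derive_eq oJ Jp y0 (is_derive_ambient eps d00 dy0) (cst 0 0).
  by rewrite ambientZr (g00 p Jp) mulr1 in e; exact: eq_opp e.
have V01y : ambient_form eps (V01 p) (y p) = 0.
  have e := strip_is_derive_eq oJ Jp y0 (is_derive_ambient eps d10 dy1) (cst 0 1).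
  by rewrite ambientZr (g01 p Jp) mulr0 addr0 in e.
have V11y : ambient_form eps (V11 p) (y p) = - (tau * a ^+ 2).
  have e := strip_is_derive_eq oJ Jp y1 (is_derive_ambient eps d11 dy1) (cst 0 1).
  by rewrite ambientZr -(g11 p Jp) in e; exact: eq_opp e.
split; [by split|by split; [exact: k010|exact: k011|]|by split; [rewrite -(k110 p Jp)| |]|].
have e1 := strip_is_derive_eq oJ Jp k110
  (is_derive_coord_same (u := fun s => - (h s * dh s))
    (is_deriveN (is_derive_comb (hdh _ Jp) hddh))) (is_derive_ambient eps dT1 d00).
have e2 := strip_is_derive_eq oJ Jp k010 (is_derive_ambient eps dT0 d10) (cst 0 1).
rewrite (ambientC eps (V11 p) (V00 p)) in e1.
have lin (u v z c : R) : - c = z + u -> z + v = 0 -> u - v = - c by lra.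
exact: lin e1 e2.
Qed.

Lemma gauss_algebra {R : realType} {n : nat} (eps tau a b dd : R)
    (V00 V01 V11 X0 X1 z b00 b01 b11 : 'rV[R]_n.+1) :
  a != 0 -> eps * tau = eps -> eps * ambient_form eps z z = tau ->
  ambient_form eps V00 X0 = 0 -> ambient_form eps V00 X1 = 0 ->
  ambient_form eps V00 z = - tau ->
  ambient_form eps V01 X0 = 0 -> ambient_form eps V01 X1 = a * b ->
  ambient_form eps V01 z = 0 ->
  ambient_form eps V11 X0 = - (a * b) -> ambient_form eps V11 X1 = 0 ->
  ambient_form eps V11 z = - (tau * a ^+ 2) ->
  ambient_form eps X0 X0 = 1 -> ambient_form eps X0 X1 = 0 ->
  ambient_form eps X1 X1 = a ^+ 2 ->
  ambient_form eps X0 z = 0 -> ambient_form eps X1 z = 0 ->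
  ambient_form eps V00 V11 - ambient_form eps V01 V01 = - (b * b + a * dd) ->
  b00 = V00 + eps *: z -> b01 = V01 - (b / a) *: X1 ->
  b11 = V11 + (eps * a ^+ 2) *: z + (a * b) *: X0 ->
  let nrm v := [/\ ambient_form eps v X0 = 0, ambient_form eps v X1 = 0 &
    ambient_form eps v z = 0] in
  [/\ nrm b00, nrm b01, nrm b11 &
    ambient_form eps b00 b11 - ambient_form eps b01 b01 = - (a * dd) - eps * a ^+ 2].
Proof.
move=> an te yy v00x v00x' v00y v01x v01x' v01y v11x v11x' v11y g00 g01 g11 x0y x1y.
move=> gauss B00 B01 B11 nrm.
have yx0 : ambient_form eps z X0 = 0 by rewrite ambientC.
have yx1 : ambient_form eps z X1 = 0 by rewrite ambientC.
have g10 : ambient_form eps X1 X0 = 0 by rewrite ambientC.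
have n00 : nrm b00.
  rewrite /nrm B00 !ambientE yx0 yx1 v00x v00x' v00y yy !mulr0 !addr0.
  by rewrite addNr.
have n01 : nrm b01.
  rewrite /nrm B01 !ambientE g10 g11 v01x v01x' v01y x1y !mulr0 !subr0; split=> //.
  by field.
have n11 : nrm b11.
  rewrite /nrm B11 !ambientE yx0 yx1 g00 g01 v11x v11x' v11y x0y !mulr0 !addr0.
  split=> //; first by rewrite mulr1 addNr.
  by rewrite [eps * _]mulrC -mulrA yy mulrC addNr.
split=> //; have [n00x n00x' n00z] := n00; have [n01x n01x' n01z] := n01.
have -> : ambient_form eps b00 b11 = ambient_form eps V00 V11 - eps * a ^+ 2.
  rewrite B11 !ambientDr !ambientZr n00x n00z !mulr0 !addr0 B00 ambientDl ambientZl.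
  by rewrite (ambientC eps z V11) v11y mulrN mulrA te.
have -> : ambient_form eps b01 b01 = ambient_form eps V01 V01 - b ^+ 2.
  rewrite {2}B01 ambientDr ambientNr ambientZr n01x' mulr0 subr0 B01 ambientDl ambientNl.
  rewrite ambientZl (ambientC eps X1 V01) v01x'.
  by congr (_ - _); field.
have lin (u v : R) : u - v = - (b * b + a * dd) ->
    u - eps * a ^+ 2 - (v - b ^+ 2) = - (a * dd) - eps * a ^+ 2 by lra.
exact: lin gauss.
Qed.

(** The tangential parts of the second derivatives are those of the Levi-Civita
    connection, the part along the pole is dictated by the space form, and the normal
    parts satisfy the Gauss equation. *)
Lemma gauss_formulas {R : realType} {n : nat} (eps : R) (J : set R) g (h dh : R -> R) (ddh : R)
    (psi : 'rV[R]_2 -> 'rV[R]_n.+1) (p : 'rV[R]_2) :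
  warped J g h dh -> is_derive (p 0 0) 1 dh ddh ->
  isometric_immersion eps (strip J) g psi -> strip J p ->
  let a := h (p 0 0) in let b := dh (p 0 0) in let y := pole eps (psi p) in
  let B i j := second_ff eps g psi i j p in
  [/\ forall i j, [/\ ambient_form eps (B i j) (pd 0 psi p) = 0,
        ambient_form eps (B i j) (pd 1 psi p) = 0 & ambient_form eps (B i j) y = 0],
      pd 0 (pd 0 psi) p = B 0 0 - eps *: y,
      pd 0 (pd 1 psi) p = B 0 1 + (b / a) *: pd 1 psi p /\
      pd 1 (pd 0 psi) p = B 0 1 + (b / a) *: pd 1 psi p,
      B 1 0 = B 0 1 /\
      pd 1 (pd 1 psi) p = B 1 1 - (a * b) *: pd 0 psi p - (eps * a ^+ 2) *: y &
      ambient_form eps (B 0 0) (B 1 1) - ambient_form eps (B 0 1) (B 0 1)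
        = - (a * ddh) - eps * a ^+ 2].
Proof.
move=> w hddh im Jp a b y B; have [oJ h0 hdh _] := w; have [sm sf gE] := im.
have an : a != 0 by rewrite gt_eqF// h0.
have oS := strip_open oJ.
have dX i j q : strip J q -> is_derive q (delta_mx 0 i) (pd j psi) (pd i (pd j psi) q).
  by move=> Jq; exact: is_derive_pd (smooth_on_differentiable (smooth_on_pd j sm) Jq).
have dV i j k : is_derive p (delta_mx 0 k) (pd i (pd j psi)) (pd k (pd i (pd j psi)) p).
  exact: is_derive_pd (smooth_on_differentiable (smooth_on_pd i (smooth_on_pd j sm)) Jp).
have dy i : is_derive p (delta_mx 0 i) (fun q => pole eps (psi q))
    ((eps != 0)%:R *: pd i psi p).
  exact: pole_derive (is_derive_pd i (smooth_on_differentiable sm Jp)).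
have V10 q : strip J q -> pd 0 (pd 1 psi) q = pd 1 (pd 0 psi) q.
  by move=> Jq; exact: schwarz_row oS sm Jq.
have pr q : strip J q ->
   [/\ ambient_form eps (pd 0 psi q) (pd 0 psi q) = 1,
       ambient_form eps (pd 0 psi q) (pd 1 psi q) = 0,
       h (q 0 0) ^+ 2 = ambient_form eps (pd 1 psi q) (pd 1 psi q) :> R,
       ambient_form eps (pd 0 psi q) (pole eps (psi q)) = 0 &
       ambient_form eps (pd 1 psi q) (pole eps (psi q)) = 0].
  move=> Jq; have ty i := immersion_tangent i oJ im Jq.
  by split; [| | |exact: ty|exact: ty]; rewrite gE// (warped_entry _ _ w Jq).
have dX' q : strip J q ->
     [/\ is_derive q (delta_mx 0 0) (pd 0 psi) (pd 0 (pd 0 psi) q),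
         is_derive q (delta_mx 0 1) (pd 0 psi) (pd 0 (pd 1 psi) q),
         is_derive q (delta_mx 0 0) (pd 1 psi) (pd 0 (pd 1 psi) q) &
         is_derive q (delta_mx 0 1) (pd 1 psi) (pd 1 (pd 1 psi) q)].
  by move=> Jq; split; [exact: dX|rewrite (V10 q Jq); exact: dX|exact: dX|exact: dX].
have dT : is_derive p (delta_mx 0 1) (pd 0 (pd 1 psi)) (pd 0 (pd 1 (pd 1 psi)) p).
  by rewrite (schwarz_row oS (smooth_on_pd 1 sm) Jp); exact: dV.
have [[v00x v00x' v00y] [v01x v01x' v01y] [v11x v11x' v11y] gauss] :=
  second_derivative_products oJ Jp hdh hddh dX' (dy 0) (dy 1) (dV 1 1 0) dT pr.
have [g00 g01 g11 x0y x1y] := pr p Jp.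
rewrite -/a -/b -/y in v00y v01x' v01y v11x v11y gauss g11 x0y x1y.
have yy : eps * ambient_form eps y y = (eps != 0)%:R.
  rewrite /y pole_square; last exact: sf.
  by case: (eqVneq eps 0) => [->|e0]; rewrite ?mul0r// mulfV.
have te : eps * (eps != 0)%:R = eps.
  by case: (eqVneq eps 0) => [->|_]; rewrite ?mul0r// mulr1.
have conn i j c : ambient_form eps (pd i (pd j psi) p) y = - ((eps != 0)%:R * c) ->
    space_form_conn eps psi i (pd j psi) p = pd i (pd j psi) p + (eps * c) *: y.
  rewrite /space_form_conn -eps_ambient_pole -/y => ->.
  by rewrite mulrN scaleNr opprK mulrA te.
have B00 : B 0 0 = pd 0 (pd 0 psi) p + eps *: y.
  rewrite /B (warped_second_ff _ _ _ _ w Jp) (conn 0 0 1) ?mulr1//.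
  by rewrite subr0.
have B01 : B 0 1 = pd 0 (pd 1 psi) p - (b / a) *: pd 1 psi p.
  rewrite /B (warped_second_ff _ _ _ _ w Jp) (conn 0 1 0) ?mulr0 ?oppr0//.
  by rewrite scale0r addr0.
have B10 : B 1 0 = pd 0 (pd 1 psi) p - (b / a) *: pd 1 psi p.
  rewrite /B (warped_second_ff _ _ _ _ w Jp) (conn 1 0 0) -?(V10 p Jp) ?mulr0 ?oppr0//.
  by rewrite scale0r addr0.
have B11 : B 1 1 = pd 1 (pd 1 psi) p + (eps * a ^+ 2) *: y + (a * b) *: pd 0 psi p.
  have E : B 1 1 = space_form_conn eps psi 1 (pd 1 psi) p - (- (a * b)) *: pd 0 psi p.
    exact: (warped_second_ff eps psi 1 1 w Jp).
  by rewrite E (conn 1 1 (a ^+ 2) v11y) scaleNr opprK.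
have ea (v u c : 'rV[R]_n.+1) : v = u + c -> u = v - c by move=> ->; rewrite addrK.
have eb (v u c : 'rV[R]_n.+1) : v = u - c -> u = v + c by move=> ->; rewrite subrK.
have ec (v u c d : 'rV[R]_n.+1) : v = u + c + d -> u = v - d - c.
  by move=> ->; rewrite !addrK.
have B10E : B 1 0 = B 0 1 := etrans B10 (esym B01).
have [n00 n01 n11 eqB] := gauss_algebra an te yy v00x v00x' v00y v01x v01x' v01y
  v11x v11x' v11y g00 g01 (esym g11) x0y x1y gauss B00 B01 B11.
split.
- move=> i j.
  have [->|->] := ord2_cases i; have [->|->] := ord2_cases j; [exact: n00|exact: n01| |exact: n11].
  by rewrite B10E; exact: n01.
- exact: ea B00.
- by split; [exact: eb B01|rewrite -(V10 p Jp); exact: eb B01].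
- split; [exact: B10E|exact: ec B11].
- exact: eqB.
Qed.

(** * Positivity and orthogonal bases *)

Lemma sum_sqr_comb {R : realType} {n : nat} (a b : R) (v x : 'I_n -> R) :
  \sum_i (a * v i - b * x i) ^+ 2 = a ^+ 2 * \sum_i v i * v i
    - 2 * a * b * \sum_i v i * x i + b ^+ 2 * \sum_i x i * x i.
Proof.
rewrite !mulr_sumr -sumrN -!big_split /=; apply: eq_bigr => i _; ring.
Qed.

Lemma ambient_lorentz {R : realType} {n : nat} (eps : R) (x y : 'rV[R]_n.+1) : eps < 0 ->
  ambient_form eps x y
    = - (x 0 0 * y 0 0) + \sum_(i < n) x 0 (lift ord0 i) * y 0 (lift ord0 i).
Proof.
move=> e; rewrite ambient_formE big_ord_recl /sig eqxx e /= mulN1r; congr (_ + _).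
by apply: eq_bigr => i _; rewrite mul1r.
Qed.

Lemma hyperboloid_time {R : realType} {n : nat} (eps : R) (x : 'rV[R]_n.+1) :
  eps < 0 -> ambient_form eps x x = eps^-1 -> x 0 0 != 0.
Proof.
move=> e xx; apply/eqP => x0; have : eps^-1 < 0 by rewrite invr_lt0.
rewrite -xx ambient_lorentz// x0 mulr0 oppr0 add0r ltNge sumr_ge0// => i _.
by rewrite -expr2 sqr_ge0.
Qed.

(** For [eps < 0], if [v] is orthogonal to [x] then [x_0^2 <v, v>] equals the sum of
    the squares of [x_0 v_i - v_0 x_i], increased by [- v_0^2 / eps]. *)
Lemma tangent_positive {R : realType} {n : nat} (eps : R) (x v : 'rV[R]_n.+1) :
  space_form eps x -> ambient_form eps v (pole eps x) = 0 -> v <> 0 ->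
  0 < ambient_form eps v v.
Proof.
move=> sx vx vn; have [e|e] := ltP eps 0; last first.
  have E : ambient_form eps v v = \sum_i v 0 i ^+ 2.
    rewrite ambient_formE; apply: eq_bigr => i _.
    by rewrite /sig ltNge e andbF mul1r expr2.
  rewrite E lt0r sumr_ge0 ?andbT => [|i _]; last exact: sqr_ge0.
  apply/negP; rewrite psumr_eq0 => [/allP h|i _]; last exact: sqr_ge0.
  apply: vn; apply/rowP => i; rewrite mxE; apply/eqP.
  by have := h i (mem_index_enum i); rewrite sqrf_eq0.
have en : eps == 0 = false by rewrite lt_eqF.
move: sx; rewrite /space_form /= en => -[xx _].
move: vx; rewrite /pole en => vx.
have x0 := hyperboloid_time e xx.
(* the vector [x_0 v - v_0 x] is spacelike *)
have key : x 0 0 ^+ 2 * ambient_form eps v v =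
    \sum_(i < n) (x 0 0 * v 0 (lift ord0 i) - v 0 0 * x 0 (lift ord0 i)) ^+ 2
    - v 0 0 ^+ 2 * eps^-1.
  rewrite sum_sqr_comb -xx; move: vx; rewrite !ambient_lorentz//.
  move: (\sum_(i < n) _) => S; move: (\sum_(i < n) _) => S2.
  move: (\sum_(i < n) _) (x 0 0) (v 0 0) => S3 c d E.
  have -> : S = d * c by lra.
  by ring.
have x2 : 0 < x 0 0 ^+ 2 by rewrite lt0r sqr_ge0 sqrf_eq0 x0.
rewrite -(pmulr_rgt0 _ x2) key.
have s0 : 0 <= \sum_(i < n)
    (x 0 0 * v 0 (lift ord0 i) - v 0 0 * x 0 (lift ord0 i)) ^+ 2.
  by rewrite sumr_ge0// => i _; exact: sqr_ge0.
have ei : eps^-1 < 0 by rewrite invr_lt0.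
have [v0|v0] := eqVneq (v 0 0) 0; last first.
  have v2 : 0 < v 0 0 ^+ 2 by rewrite lt0r sqr_ge0 sqrf_eq0 v0.
  by apply: ltr_wpDl => //; rewrite -mulrN mulr_gt0// oppr_gt0.
rewrite v0 in s0 *; rewrite expr0n/= mul0r subr0 lt0r s0 andbT.
apply/negP; rewrite psumr_eq0 => [/allP h|i _]; last exact: sqr_ge0.
apply: vn; apply/rowP => i; rewrite mxE.
have [j ->|->] := unliftP ord0 i; last exact: v0.
apply/eqP; have := h j (mem_index_enum j).
by rewrite mul0r subr0 sqrf_eq0 mulf_eq0 (negbTE x0).
Qed.

(** Expand the sum of the squares of [x_0 y_i - y_0 x_i]: for points of the hyperboloid
    it shows that [x_0 y_0] and [<x, y>] have opposite signs. *)
Lemma same_sheet {R : realType} {n : nat} (eps : R) (x y : 'rV[R]_n.+1) :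
  eps < 0 -> ambient_form eps x x = eps^-1 -> ambient_form eps y y = eps^-1 ->
  (0 < x 0 0 * y 0 0) = (ambient_form eps x y < 0).
Proof.
move=> e xx yy; have x0 := hyperboloid_time e xx; have y0 := hyperboloid_time e yy.
have key : 2 * (x 0 0 * y 0 0) * ambient_form eps x y =
    - \sum_(i < n) (x 0 0 * y 0 (lift ord0 i) - y 0 0 * x 0 (lift ord0 i)) ^+ 2
    + (x 0 0 ^+ 2 + y 0 0 ^+ 2) * eps^-1.
  have E : (x 0 0 ^+ 2 + y 0 0 ^+ 2) * eps^-1
      = x 0 0 ^+ 2 * ambient_form eps y y + y 0 0 ^+ 2 * ambient_form eps x x.
    by rewrite xx yy; ring.
  rewrite E sum_sqr_comb (ambientC eps x y) !ambient_lorentz//.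
  move: (\sum_(i < n) _) => S; move: (\sum_(i < n) _) => S2.
  by move: (\sum_(i < n) _) (x 0 0) (y 0 0) => S3 c d; ring.
have s0 : 0 <= \sum_(i < n)
    (x 0 0 * y 0 (lift ord0 i) - y 0 0 * x 0 (lift ord0 i)) ^+ 2.
  by rewrite sumr_ge0// => i _; exact: sqr_ge0.
have ei : eps^-1 < 0 by rewrite invr_lt0.
have x2 : 0 < x 0 0 ^+ 2 by rewrite lt0r sqr_ge0 sqrf_eq0 x0.
have y2 : 0 < y 0 0 ^+ 2 by rewrite lt0r sqr_ge0 sqrf_eq0 y0.
have neg : x 0 0 * y 0 0 * ambient_form eps x y < 0.
  have : (x 0 0 ^+ 2 + y 0 0 ^+ 2) * eps^-1 < 0 by rewrite nmulr_llt0 ?addr_gt0.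
  move: key s0; move: (ambient_form _ _ _) (\sum_(i < n) _) (_ * eps^-1).
  by move=> u S w; clear => E S0 w0; lra.
move: neg; move: (x 0 0 * y 0 0) (ambient_form eps x y) => c d; clear => cd.
by apply/idP/idP => h; [rewrite (pmulr_rlt0 _ h) in cd|rewrite (nmulr_llt0 _ h) in cd].
Qed.

Lemma orthogonal_gram {R : realType} {n : nat} (eps : R) (F : 'M[R]_n.+1) (k : 'I_n.+1 -> R) :
  (forall i j, ambient_form eps (row i F) (row j F) = if i == j then k i else 0) ->
  F *m Gmx eps *m F^T = diag_mx (\row_i k i).
Proof.
move=> h; apply/matrixP => i j; rewrite -ambient_rows h !mxE.
by case: (eqVneq i j) => [->|]; rewrite ?mulr1n ?mulr0n.
Qed.

Lemma orthogonal_unitmx {R : realType} {n : nat} (eps : R) (F : 'M[R]_n.+1) (k : 'I_n.+1 -> R) :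
  (forall i j, ambient_form eps (row i F) (row j F) = if i == j then k i else 0) ->
  (forall i, k i != 0) -> F \in unitmx.
Proof.
move=> /orthogonal_gram H k0.
have : F *m (Gmx eps *m F^T *m diag_mx (\row_i (k i)^-1)) = 1%:M.
  rewrite !mulmxA H mulmx_diag; apply/matrixP => i j; rewrite !mxE.
  by rewrite mulfV.
by move/mulmx1_unit => [].
Qed.

(** An orthogonal family of non-isotropic vectors as large as the dimension is
    a basis, so only the zero vector is orthogonal to it. *)
Lemma orthogonal_basis {R : realType} {n : nat} (eps : R) (F : 'M[R]_n.+1)
    (k : 'I_n.+1 -> R) (w : 'rV[R]_n.+1) :
  (forall i j, ambient_form eps (row i F) (row j F) = if i == j then k i else 0) ->
  (forall i, k i != 0) -> (forall i, ambient_form eps w (row i F) = 0) -> w = 0.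
Proof.
move=> H k0 w0; have uF := orthogonal_unitmx H k0.
have E : w *m Gmx eps *m F^T = 0.
  apply/rowP => j; rewrite [RHS]mxE -(w0 j) ambient_formE.
  by rewrite mxE; apply: eq_bigr => i _; rewrite mul_mx_diag !mxE; ring.
have uT : F^T \in unitmx by rewrite unitmx_tr.
have E1 : w *m Gmx eps = 0 by rewrite -(mulmxK uT (w *m Gmx eps)) E mul0mx.
by rewrite -(mulmx1 w) -(Gmx_sqr eps) mulmxA E1 mul0mx.
Qed.

Definition rows4 {R : realType} (y e1 e2 v : 'rV[R]_4) : 'M[R]_4 :=
  \matrix_(i, j) (nth 0 [:: y; e1; e2; v] i : 'rV[R]_4) 0 j.

Lemma row_rows4 {R : realType} (y e1 e2 v : 'rV[R]_4) i :
  row i (rows4 y e1 e2 v) = nth 0 [:: y; e1; e2; v] i.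
Proof. by apply/rowP => j; rewrite !mxE. Qed.

Lemma rows4_products {R : realType} (eps a b c d : R) (y e1 e2 v : 'rV[R]_4) :
  ambient_form eps y y = a -> ambient_form eps e1 e1 = b ->
  ambient_form eps e2 e2 = c -> ambient_form eps v v = d ->
  ambient_form eps e1 y = 0 -> ambient_form eps e2 y = 0 -> ambient_form eps e1 e2 = 0 ->
  ambient_form eps v e1 = 0 -> ambient_form eps v e2 = 0 -> ambient_form eps v y = 0 ->
  forall i j, ambient_form eps (row i (rows4 y e1 e2 v)) (row j (rows4 y e1 e2 v))
    = if i == j then nth 0 [:: a; b; c; d] i else 0.
Proof.
move=> yy h11 h22 vv h1y h2y h12 v1 v2 vy i j; rewrite !row_rows4.
case: i => [[|[|[|[|//]]]] hi]; case: j => [[|[|[|[|//]]]] hj] //=; by rewrite ambientC.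
Qed.

Lemma rows4_eq0 {R : realType} (eps a b c d : R) (y e1 e2 v w : 'rV[R]_4) :
  ambient_form eps y y = a -> ambient_form eps e1 e1 = b ->
  ambient_form eps e2 e2 = c -> ambient_form eps v v = d ->
  ambient_form eps e1 y = 0 -> ambient_form eps e2 y = 0 -> ambient_form eps e1 e2 = 0 ->
  ambient_form eps v e1 = 0 -> ambient_form eps v e2 = 0 -> ambient_form eps v y = 0 ->
  [/\ a != 0, b != 0, c != 0 & d != 0] ->
  ambient_form eps w y = 0 -> ambient_form eps w e1 = 0 -> ambient_form eps w e2 = 0 ->
  ambient_form eps w v = 0 -> w = 0.
Proof.
move=> yy h11 h22 vv h1y h2y h12 v1 v2 vy [a0 b0 c0 d0] wy w1 w2 wv.
apply: (orthogonal_basis (rows4_products yy h11 h22 vv h1y h2y h12 v1 v2 vy)).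
  by case=> [[|[|[|[|//]]]] hi].
by move=> i; rewrite row_rows4; case: i => [[|[|[|[|//]]]] hi].
Qed.

(** The gradient of [|H|^2] being an eigenvector of the shape operator for the
    eigenvalue [- r], with [r = |H|] half the trace, the other eigenvalue is
    [3 r] and the Gauss equation gives the value of [r]. *)
Lemma eigenvalue_ratio {R : realType} (a b c k q0 q1 r F : R) :
  0 < r -> 0 < F -> a + k * c = 2 * r -> k * (a * c - b ^+ 2) = - (3 * F ^+ 2) ->
  a * q0 + k * b * q1 = - r * q0 -> b * q0 + k * c * q1 = - r * q1 ->
  ~ (q0 = 0 /\ q1 = 0) -> r = F.
Proof.
move=> r0 F0 tr det e0 e1 q.
have D : (a + r) * (k * c + r) - k * b ^+ 2 = 0.
  have [q00|q00] := eqVneq q0 0.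
    have q10 : q1 != 0 by apply/eqP => q10; apply: q.
    apply: (mulIf q10); rewrite mul0r.
    have -> : ((a + r) * (k * c + r) - k * b ^+ 2) * q1 =
      (a + r) * (b * q0 + k * c * q1 - (- r * q1))
        - b * (a * q0 + k * b * q1 - (- r * q0)) by ring.
    by rewrite e0 e1 !subrr !mulr0 subrr.
  apply: (mulIf q00); rewrite mul0r.
  have -> : ((a + r) * (k * c + r) - k * b ^+ 2) * q0 =
    (k * c + r) * (a * q0 + k * b * q1 - (- r * q0))
      - k * b * (b * q0 + k * c * q1 - (- r * q1)) by ring.
  by rewrite e0 e1 !subrr !mulr0 subrr.
have r2 : r ^+ 2 = F ^+ 2.
  have kc : k * c = 2 * r - a by lra.
  have -> : r ^+ 2 = - (k * (a * c - b ^+ 2)) / 3.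
    have -> : k * (a * c - b ^+ 2) = a * (k * c) - k * b ^+ 2 by ring.
    by rewrite kc in D *; clear -D; lra.
  by rewrite det; field.
by apply/eqP; rewrite -(eqrXn2 (n := 2)) ?ltW// r2.
Qed.

(** * Second fundamental form of a biconservative surface in N^3 *)

Lemma is_derive_lineP {R : realType} {V W : normedModType R} (F : V -> W) (p v : V) (d : W) :
  is_derive p v F d <-> is_derive (0 : R) 1 (fun h : R => F (h *: v + p)) d.
Proof.
have E : (fun h : R => h^-1 *: (F ((h *: (1 : R) + 0) *: v + p) - F ((0 : R) *: v + p))) =
    (fun h : R => h^-1 *: (F (h *: v + p) - F p)).
  by apply/funext => h; rewrite scale0r add0r addr0 -[h *: 1]/(h * 1) mulr1.
by split=> -[h1 h2]; apply: DeriveDef;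
  [rewrite /derivable E|rewrite /derive E|rewrite /derivable -E|rewrite /derive -E].
Qed.

Lemma is_derive_powR_along {R : realType} {V : normedModType R} (u : V -> R) (a : R)
    (p v : V) (d : R) : 0 < u p ->
  is_derive p v u d -> is_derive p v (fun q => u q `^ a) (a * u p `^ (a - 1) * d).
Proof.
move=> u0 /is_derive_lineP h; apply/is_derive_lineP.
have u0' : 0 < u (0 *: v + p) by rewrite scale0r add0r.
apply: (is_derive_eq (is_derive_powR_comp a u0' h)).
by rewrite scale0r add0r.
Qed.

Definition has_pd {R : realType} {W : normedModType R} (p : 'rV[R]_2)
    (F : 'rV[R]_2 -> W) : Prop := forall i, exists d, is_derive p (delta_mx 0 i) F d.

Lemma has_pdD {R : realType} {W : normedModType R} (p : 'rV[R]_2) (F G : 'rV[R]_2 -> W) :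
  has_pd p F -> has_pd p G -> has_pd p (fun q => F q + G q).
Proof.
by move=> hF hG i; have [d hd] := hF i; have [e he] := hG i; exists (d + e); exact: is_deriveD.
Qed.

Lemma has_pd_scale {R : realType} {n : nat} (p : 'rV[R]_2) (u : R -> R) (du : R)
    (F : 'rV[R]_2 -> 'rV[R]_n) :
  is_derive (p 0 0) 1 u du -> has_pd p F -> has_pd p (fun q => u (q 0 0) *: F q).
Proof.
move=> hu hF i; have [d hd] := hF i.
have [e he] : exists e, is_derive p (delta_mx 0 i) (fun q : 'rV[R]_2 => u (q 0 0)) e.
  have [->|->] := ord2_cases i; first by exists du; exact: is_derive_coord_same.
  by exists 0; exact: (@is_derive_coord_other _ _ u 0 1 p isT).
by exists (e *: F p + u (p 0 0) *: d); exact: (is_derive_scale he hd).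
Qed.

(** The normal connection of a normal field only sees the normal component of
    its derivative. *)
Lemma normal_conn_products {R : realType} {n : nat} (eps : R) (J : set R) g (h dh : R -> R)
    (psi V : 'rV[R]_2 -> 'rV[R]_n.+1) (p : 'rV[R]_2) i (d : 'rV[R]_n.+1) :
  warped J g h dh -> isometric_immersion eps (strip J) g psi -> strip J p ->
  is_derive p (delta_mx 0 i) V d -> ambient_form eps d (pole eps (psi p)) = 0 ->
  let w := normal_conn_coord eps g psi i V p in
  [/\ ambient_form eps w (pd 0 psi p) = 0, ambient_form eps w (pd 1 psi p) = 0,
      ambient_form eps w (pole eps (psi p)) = 0 &
      forall N, ambient_form eps N (pd 0 psi p) = 0 -> ambient_form eps N (pd 1 psi p) = 0 ->
        ambient_form eps w N = ambient_form eps d N].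
Proof.
move=> w im Jp dV dy W; have [oJ h0 _ _] := w; have [_ _ gE] := im.
have hn : h (p 0 0) != 0 by rewrite gt_eqF// h0.
have WE : W = d - (ambient_form eps d (pd 0 psi p) *: pd 0 psi p
    + ((h (p 0 0) ^+ 2)^-1 * ambient_form eps d (pd 1 psi p)) *: pd 1 psi p).
  rewrite /W /normal_conn_coord (warped_normal_part _ _ _ w Jp) /space_form_conn.
  by rewrite (pd_is_derive dV) -eps_ambient_pole dy mulr0 scale0r subr0.
have g00 : ambient_form eps (pd 0 psi p) (pd 0 psi p) = 1.
  by rewrite gE// (warped_entry _ _ w Jp).
have g01 : ambient_form eps (pd 0 psi p) (pd 1 psi p) = 0.
  by rewrite gE// (warped_entry _ _ w Jp).
have g11 : ambient_form eps (pd 1 psi p) (pd 1 psi p) = h (p 0 0) ^+ 2.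
  by rewrite gE// (warped_entry _ _ w Jp).
have t0 := immersion_tangent 0 oJ im Jp; have t1 := immersion_tangent 1 oJ im Jp.
move: (W) (pd 0 psi p) (pd 1 psi p) (pole eps (psi p)) (h (p 0 0)) hn WE g00 g01 g11 t0 t1 dy.
move=> {}W X0 X1 y a an -> g00 g01 g11 t0 t1 dy.
have g10 : ambient_form eps X1 X0 = 0 by rewrite ambientC.
split.
- by rewrite !ambientE g00 g10 mulr0 addr0 mulr1 subrr.
- by rewrite !ambientE g01 g11 mulr0 add0r; field.
- by rewrite !ambientE t0 t1 dy !mulr0 addr0 subr0.
move=> N N0 N1; rewrite !ambientE (ambientC eps X0 N) (ambientC eps X1 N) N0 N1.
by rewrite !mulr0 addr0 subr0.
Qed.

Lemma mean_vector_normal {R : realType} {n : nat} (eps : R) (J : set R) g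
    (h dh ddh : R -> R) (psi : 'rV[R]_2 -> 'rV[R]_n.+1) (p : 'rV[R]_2) :
  warped J g h dh -> (forall s, J s -> is_derive s 1 dh (ddh s)) ->
  isometric_immersion eps (strip J) g psi -> strip J p ->
  let H := mean_vector eps g psi in
  [/\ ambient_form eps (H p) (pd 0 psi p) = 0, ambient_form eps (H p) (pd 1 psi p) = 0,
      ambient_form eps (H p) (pole eps (psi p)) = 0 & has_pd p H].
Proof.
move=> w hddh im Jp H; have [oJ h0 hdh _] := w; have [sm sf gE] := im.
have HE q : strip J q -> H q = 2^-1 *: (second_ff eps g psi 0 0 q
    + (h (q 0 0) ^+ 2)^-1 *: second_ff eps g psi 1 1 q).
  by move=> Jq; exact: warped_mean w Jq.
have [nB _ _ _ _] := gauss_formulas w (hddh _ Jp) im Jp.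
have [[a0 a1 ay] [b0 b1 b_y]] := (nB 0 0, nB 1 1).
have nH (c : R) (B C v : 'rV[R]_n.+1) : ambient_form eps B v = 0 ->
    ambient_form eps C v = 0 -> ambient_form eps (2^-1 *: (B + c *: C)) v = 0.
  by move=> u0 u1; rewrite ambientZl ambientDl ambientZl u0 u1 mulr0 addr0 mulr0.
split; [rewrite (HE p Jp); exact: nH a0 b0|rewrite (HE p Jp); exact: nH a1 b1
       |rewrite (HE p Jp); exact: nH ay b_y|].
(* on the strip, the mean curvature vector in terms of derivatives of [psi] *)
pose k s := (h s ^+ 2) `^ (-1).
have kE s : J s -> (h s ^+ 2)^-1 = k s.
  by move=> _; rewrite /k powR_inv1// sqr_ge0.
pose G q := 2^-1 *: ((pd 0 (pd 0 psi) q + eps *: pole eps (psi q))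
  + k (q 0 0) *: (pd 1 (pd 1 psi) q + (h (q 0 0) * dh (q 0 0)) *: pd 0 psi q
     + (eps * h (q 0 0) ^+ 2) *: pole eps (psi q))).
have GH q : strip J q -> G q = H q.
  move=> Jq; rewrite HE// kE// /G.
  have [_ E0 _ [_ E1] _] := gauss_formulas w (hddh _ Jq) im Jq.
  rewrite E0 E1; move: (second_ff _ _ _ 0 0 _) (second_ff _ _ _ 1 1 _) (pole _ _) (pd 0 _ _).
  by move=> u v y x; rewrite subrK addrAC subrK subrK.
have pdV i j : has_pd p (pd i (pd j psi)).
  move=> l; exists (pd l (pd i (pd j psi)) p); apply: is_derive_pd.
  exact: smooth_on_differentiable (smooth_on_pd i (smooth_on_pd j sm)) Jp.
have pdX j : has_pd p (pd j psi).
  move=> l; exists (pd l (pd j psi) p); apply: is_derive_pd.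
  exact: smooth_on_differentiable (smooth_on_pd j sm) Jp.
have pdy : has_pd p (fun q => pole eps (psi q)).
  move=> l; exists ((eps != 0)%:R *: pd l psi p); apply: pole_derive.
  exact: is_derive_pd (smooth_on_differentiable sm Jp).
have cst (c : R) := is_derive_cst c (p 0 0) (1 : R).
have h2 : 0 < h (p 0 0) ^+ 2 by rewrite exprn_gt0// h0.
have dk := is_derive_powR_comp (u := fun s => h s ^+ 2) (-1) h2 (is_derive_sq (hdh _ Jp)).
have hG : has_pd p G.
  apply: (has_pd_scale (u := fun=> 2^-1) (cst _)).
  apply: has_pdD; first exact: has_pdD (pdV 0 0) (has_pd_scale (u := fun=> eps) (cst _) pdy).
  apply: (has_pd_scale dk).
  apply: has_pdD.
    apply: has_pdD (pdV 1 1) _.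
    exact: (has_pd_scale (is_derive_comb (hdh _ Jp) (hddh _ Jp)) (pdX 0)).
  exact: (has_pd_scale (is_derive_cmul eps (is_derive_sq (hdh _ Jp))) pdy).
move=> i; have [d hd] := hG i; exists d.
exact: (near_strip_is_derive oJ Jp GH hd).
Qed.

Opaque mean_vector second_ff normal_conn_coord.

(** Normal spaces are lines spanned by the mean curvature vector [v]; this turns the
    vector equations into equations between the scalar products with [v]. *)
Lemma codimension1_algebra {R : realType} (eps a kap g2 q : R)
    (y X0 X1 v b00 b01 b11 : 'rV[R]_4) :
  kap != 0 -> a != 0 -> q != 0 ->
  ambient_form eps y y = kap -> ambient_form eps X0 X0 = 1 ->
  ambient_form eps X1 X1 = a ^+ 2 -> ambient_form eps v v = q ->
  ambient_form eps X0 y = 0 -> ambient_form eps X1 y = 0 -> ambient_form eps X0 X1 = 0 ->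
  let nrm w := [/\ ambient_form eps w X0 = 0, ambient_form eps w X1 = 0 &
    ambient_form eps w y = 0] in
  nrm v -> nrm b00 -> nrm b01 -> nrm b11 ->
  v = 2^-1 *: (b00 + (a ^+ 2)^-1 *: b11) ->
  ambient_form eps b00 b11 - ambient_form eps b01 b01 = g2 ->
  let c w := ambient_form eps w v in
  [/\ forall w, nrm w -> w = (c w / q) *: v,
      c b00 + (a ^+ 2)^-1 * c b11 = 2 * q &
      c b00 * c b11 - c b01 ^+ 2 = q * g2].
Proof.
move=> kap0 a0 q0 yy x00 x11 vv x0y x1y x01 nrm nv n00 n01 n11 vE gauss c.
have [v0 v1 vy] := nv.
have line w : nrm w -> w = (c w / q) *: v.
  move=> [w0 w1 wy]; apply/eqP; rewrite -subr_eq0; apply/eqP.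
  have a2 : a ^+ 2 != 0 by rewrite expf_neq0.
  apply: (rows4_eq0 yy x00 x11 vv x0y x1y x01 v0 v1 vy (And4 kap0 (oner_neq0 R) a2 q0)).
  - by rewrite ambientDl ambientNl ambientZl wy vy mulr0 subrr.
  - by rewrite ambientDl ambientNl ambientZl w0 v0 mulr0 subrr.
  - by rewrite ambientDl ambientNl ambientZl w1 v1 mulr0 subrr.
  - by rewrite ambientDl ambientNl ambientZl vv /c divfK// subrr.
split=> //.
  have : ambient_form eps (2^-1 *: (b00 + (a ^+ 2)^-1 *: b11)) v = q by rewrite -vE.
  rewrite ambientZl ambientDl ambientZl => h.
  by rewrite /c -h; field.
have := gauss; rewrite (line b11 n11) {2}(line b01 n01) !ambientZr => <-.
rewrite -/(c b00) -/(c b01).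
have -> : c ((c b11 / q) *: v) = c b11 by rewrite /c ambientZl vv divfK.
by field.
Qed.

Lemma pole_square_neq0 {R : realType} (eps : R) : (if eps == 0 then 1 else eps^-1) != 0.
Proof. by case: (eqVneq eps 0) => [_|e0]; rewrite ?oner_neq0// invr_eq0. Qed.

Lemma biconservative_algebra {R : realType} (eps k q q0 q1 P0 P1 : R)
    (b00 b10 b01 b11 w0 w1 v : 'rV[R]_4) :
  k != 0 -> q != 0 -> w0 = (q0 / 2 / q) *: v -> w1 = (q1 / 2 / q) *: v -> b10 = b01 ->
  P0 = q0 -> P1 = q1 ->
  pt (2 * (ambient_form eps b00 w0 + k * ambient_form eps b10 w1) + P0)
     ((2 * (ambient_form eps b01 w0 + k * ambient_form eps b11 w1) + P1) * k) = 0 ->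
  ambient_form eps b00 v * q0 + k * ambient_form eps b01 v * q1 = - (q * q0) /\
  ambient_form eps b01 v * q0 + k * ambient_form eps b11 v * q1 = - (q * q1).
Proof.
move=> kn qn -> -> -> -> -> bic.
have bic0 := congr1 (fun M : 'rV_2 => M 0 0) bic.
have bic1 := congr1 (fun M : 'rV_2 => M 0 1) bic.
rewrite pt0E mxE in bic0; rewrite pt1E mxE in bic1.
move: bic0 bic1; rewrite !ambientZr.
move: (ambient_form _ _ _) (ambient_form _ _ _) (ambient_form _ _ _) => c b a.
clear -kn qn => bic0 bic1; split.
  have : (2 * (q0 / 2 / q * a + k * (q1 / 2 / q * b)) + q0) * q = 0 by rewrite bic0 mul0r.
  have -> : (2 * (q0 / 2 / q * a + k * (q1 / 2 / q * b)) + q0) * q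
    = a * q0 + k * b * q1 + q * q0 by field.
  by move/eqP; rewrite addr_eq0 => /eqP.
have : (2 * (q0 / 2 / q * b + k * (q1 / 2 / q * c)) + q1) * q = 0.
  move/eqP: bic1; rewrite mulf_eq0 (negbTE kn) orbF => /eqP ->.
  by rewrite mul0r.
have -> : (2 * (q0 / 2 / q * b + k * (q1 / 2 / q * c)) + q1) * q
    = b * q0 + k * c * q1 + q * q1 by field.
by move/eqP; rewrite addr_eq0 => /eqP.
Qed.

Section CodimensionOne.
Context {R : realType} (eps : R) (J : set R) (f : R -> R) (psi : 'rV[R]_2 -> 'rV[R]_4).
Context (pf : profile eps J f)
  (im : isometric_immersion eps (strip J) (warped_metric f) psi)
  (bc : non_CMC_biconservative3 eps (strip J) (warped_metric f) psi).
Local Notation g := (warped_metric f).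
Local Notation H := (mean_vector eps g psi).
Local Notation B i j := (second_ff eps g psi i j).
Local Notation Q q := (ambient_form eps (H q) (H q)).

Let dd s : J s -> is_derive s 1 (dhf f) ((3 * f s ^+ 2 - eps) * hf f s).
Proof. exact: dhf_derive pf. Qed.

Lemma mean_square_gt0 p : strip J p -> 0 < Q p.
Proof.
move=> Jp; have [_ sf _] := im.
have [_ _ Hy _] := mean_vector_normal (profile_warped pf) dd im Jp.
by apply: (tangent_positive (sf p Jp) Hy); exact: (bc.2 p Jp).1.
Qed.

Lemma mean_curvature_square p : strip J p -> mean_curvature eps g psi p ^+ 2 = Q p.
Proof. by move=> Jp; rewrite sqr_sqrtr// ltW// mean_square_gt0. Qed.

(** The biconservative equation says that [grad |H|^2] is an eigenvector of the shape
    operator of [H] for the eigenvalue [- |H|^2]. *)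
Lemma biconservative_system p : strip J p ->
  exists q0 q1 a b c, [/\ is_derive p (delta_mx 0 0) (fun q => Q q) q0,
    is_derive p (delta_mx 0 1) (fun q => Q q) q1, ~ (q0 = 0 /\ q1 = 0) &
    let k := (hf f (p 0 0) ^+ 2)^-1 in
    [/\ B 0 0 p = (a / Q p) *: H p, B 0 1 p = (b / Q p) *: H p &
        B 1 1 p = (c / Q p) *: H p] /\
    [/\ a + k * c = 2 * Q p,
        k * (a * c - b ^+ 2) = - (3 * f (p 0 0) ^+ 2) * Q p,
        a * q0 + k * b * q1 = - (Q p * q0) &
        b * q0 + k * c * q1 = - (Q p * q1)]].
Proof.
move=> Jp; have w := profile_warped pf; have [sm sf gE] := im; have [oJ h0 _ _] := w.
have an : hf f (p 0 0) != 0 by rewrite gt_eqF// h0.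
have [H0 H1 Hy pdH] := mean_vector_normal w dd im Jp.
have [d0 dH0] := pdH 0; have [d1 dH1] := pdH 1.
have Qn : Q p != 0 by rewrite gt_eqF// mean_square_gt0.
have dy i : is_derive p (delta_mx 0 i) (fun q => pole eps (psi q))
    ((eps != 0)%:R *: pd i psi p).
  exact: pole_derive (is_derive_pd i (smooth_on_differentiable sm Jp)).
have Hy' q : strip J q -> ambient_form eps (H q) (pole eps (psi q)) = 0.
  by move=> Jq; have [_ _ h _] := mean_vector_normal w dd im Jq.
have HX i : ambient_form eps (H p) (pd i psi p) = 0.
  by have [->|->] := ord2_cases i.
have dHy i d : is_derive p (delta_mx 0 i) H d -> ambient_form eps d (pole eps (psi p)) = 0.
  move=> hd; have e := strip_is_derive_eq oJ Jp Hy' (is_derive_ambient eps hd (dy i))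
    (is_derive_cst (0 : R) p _).
  by rewrite ambientZr HX mulr0 addr0 in e.
have [w00 w01 w0y w0N] := normal_conn_products w im Jp dH0 (dHy 0 d0 dH0).
have [w10 w11 w1y w1N] := normal_conn_products w im Jp dH1 (dHy 1 d1 dH1).
pose q0 := ambient_form eps d0 (H p) + ambient_form eps (H p) d0.
pose q1 := ambient_form eps d1 (H p) + ambient_form eps (H p) d1.
have dQ0 : is_derive p (delta_mx 0 0) (fun q => Q q) q0 by exact: is_derive_ambient.
have dQ1 : is_derive p (delta_mx 0 1) (fun q => Q q) q1 by exact: is_derive_ambient.
pose c i j := ambient_form eps (B i j p) (H p).
exists q0, q1, (c 0 0), (c 0 1), (c 1 1); split; [exact: dQ0|exact: dQ1| |].
  (* otherwise the gradient of [|H|] would vanish *)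
  move=> [q00 q10]; apply: (bc.2 p Jp).2.
  have mc q : strip J q -> mean_curvature eps g psi q = Q q `^ 2^-1.
    by move=> Jq; rewrite powR12_sqrt// ltW// mean_square_gt0.
  rewrite (warped_grad _ w Jp) !(pd_eq_on _ (strip_open oJ) Jp mc).
  rewrite (pd_is_derive (is_derive_powR_along (u := fun q => Q q) 2^-1 (mean_square_gt0 Jp) dQ0)).
  rewrite (pd_is_derive (is_derive_powR_along (u := fun q => Q q) 2^-1 (mean_square_gt0 Jp) dQ1)).
  rewrite q00 q10 !mulr0 mul0r; apply/rowP => i; rewrite !mxE; by case: (i == 0).
move=> k.
have [nB _ _ [B10 _] gauss] := gauss_formulas w (dd Jp) im Jp.
have g00 : ambient_form eps (pd 0 psi p) (pd 0 psi p) = 1.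
  by rewrite (gE _ _ _ Jp) (warped_entry _ _ w Jp).
have g01 : ambient_form eps (pd 0 psi p) (pd 1 psi p) = 0.
  by rewrite (gE _ _ _ Jp) (warped_entry _ _ w Jp).
have g11 : ambient_form eps (pd 1 psi p) (pd 1 psi p) = hf f (p 0 0) ^+ 2.
  by rewrite (gE _ _ _ Jp) (warped_entry _ _ w Jp).
have t0 := immersion_tangent 0 oJ im Jp; have t1 := immersion_tangent 1 oJ im Jp.
have [line tr det] := codimension1_algebra (pole_square_neq0 eps) an Qn (pole_square (sf p Jp)) g00 g11
  erefl t0 t1 g01 (And3 H0 H1 Hy) (nB 0 0) (nB 0 1) (nB 1 1) (warped_mean eps psi w Jp) gauss.
have wl0 := line _ (And3 w00 w01 w0y); have wl1 := line _ (And3 w10 w11 w1y).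
rewrite (w0N _ H0 H1) in wl0; rewrite (w1N _ H0 H1) in wl1.
have mc2 q : strip J q -> mean_curvature eps g psi q ^+ 2 = Q q.
  exact: mean_curvature_square.
have P i := pd_eq_on i (strip_open oJ) Jp mc2.
have d0H : ambient_form eps d0 (H p) = q0 / 2.
  by rewrite /q0 (ambientC eps (H p) d0); field.
have d1H : ambient_form eps d1 (H p) = q1 / 2.
  by rewrite /q1 (ambientC eps (H p) d1); field.
rewrite d0H in wl0; rewrite d1H in wl1.
have kn : k != 0 by rewrite invr_eq0 expf_neq0.
have bic := @warped_biconservative R 3 eps J _ _ _ psi p (fun i => normal_conn_coord eps g psi i H p)
  (fun q => mean_curvature eps g psi q ^+ 2) w Jp.
have [e0 e1] := biconservative_algebra kn Qn wl0 wl1 B10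
  (etrans (P 0) (pd_is_derive dQ0)) (etrans (P 1) (pd_is_derive dQ1))
  (etrans (esym bic) (bc.1 p Jp)).
split; first by split; exact: line (nB _ _).
split; [exact: tr| |exact: e0|exact: e1].
rewrite /c det /k; move: (Q p) (hf f (p 0 0)) (f (p 0 0)) an => q a F an'.
by field.
Qed.

Lemma mean_square_eq p : strip J p -> Q p = f (p 0 0) ^+ 2.
Proof.
move=> Jp; have [q0 [q1 [a [b [c [_ _ q00 [_ [tr det e0 e1]]]]]]]] := biconservative_system Jp.
have Q0 := mean_square_gt0 Jp; have [_ _ f0 _ _] := pf.
have fp := f0 _ Jp; set r := Num.sqrt (Q p).
have r0 : 0 < r by rewrite sqrtr_gt0.
have r2 : r ^+ 2 = Q p by rewrite sqr_sqrtr// ltW.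
have rn : r != 0 by rewrite gt_eqF.
rewrite -r2; congr (_ ^+ 2).
rewrite -r2 in tr det e0 e1.
apply: (@eigenvalue_ratio _ (a / r) (b / r) (c / r) ((hf f (p 0 0) ^+ 2)^-1) q0 q1) => //.
- have -> : a / r + (hf f (p 0 0) ^+ 2)^-1 * (c / r)
    = (a + (hf f (p 0 0) ^+ 2)^-1 * c) / r by ring.
  by rewrite tr; field.
- have -> : (hf f (p 0 0) ^+ 2)^-1 * (a / r * (c / r) - (b / r) ^+ 2)
    = (hf f (p 0 0) ^+ 2)^-1 * (a * c - b ^+ 2) / r ^+ 2.
    by move: (_^-1) => k; field.
  by rewrite det; field.
- have -> : a / r * q0 + (hf f (p 0 0) ^+ 2)^-1 * (b / r) * q1
    = (a * q0 + (hf f (p 0 0) ^+ 2)^-1 * b * q1) / r by ring.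
  by rewrite e0; field.
have -> : b / r * q0 + (hf f (p 0 0) ^+ 2)^-1 * (c / r) * q1
    = (b * q0 + (hf f (p 0 0) ^+ 2)^-1 * c * q1) / r by ring.
by rewrite e1; field.
Qed.

(** Now [|H| = f] depends on [s] only, so the eigenvector [grad |H|^2] is a coordinate
    direction and the shape operator is diagonal. *)
Lemma biconservative_second_ff p : strip J p ->
  [/\ B 0 0 p = - H p, B 0 1 p = 0 & B 1 1 p = (3 * hf f (p 0 0) ^+ 2) *: H p].
Proof.
move=> Jp; have [q0 [q1 [a [b [c [d0 d1 _ [[E0 E1 E2] [tr _ e0 e1]]]]]]]] := biconservative_system Jp.
have [oJ _ f0 f'0 _] := pf; have Qn : Q p != 0 by rewrite gt_eqF// mean_square_gt0.
have hn : hf f (p 0 0) != 0 by rewrite gt_eqF// (hf_gt0 pf).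
have q0E : q0 = 2 * f (p 0 0) * derive1 f (p 0 0).
  apply: (strip_is_derive_eq oJ Jp mean_square_eq d0).
  exact: (is_derive_coord_same (u := fun s => f s ^+ 2) (is_derive_sq (profile_df pf Jp))).
have q1E : q1 = 0.
  apply: (strip_is_derive_eq oJ Jp mean_square_eq d1).
  exact: (@is_derive_coord_other _ _ (fun s => f s ^+ 2) 0 1 p isT).
have q0n : q0 != 0.
  have f1 := f0 _ Jp; have f2 := f'0 _ Jp.
  by rewrite q0E !mulf_neq0// gt_eqF.
rewrite q1E !mulr0 !addr0 in e0 e1.
have c0 : a = - Q p by apply: (mulIf q0n); rewrite e0 mulNr.
have c1 : b = 0 by apply: (mulIf q0n); rewrite e1 mul0r oppr0.
have c2 : c = 3 * hf f (p 0 0) ^+ 2 * Q p.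
  have -> : c = hf f (p 0 0) ^+ 2 * (- a + (a + (hf f (p 0 0) ^+ 2)^-1 * c)) by field.
  by rewrite tr c0; ring.
rewrite c0 mulNr divff// in E0; rewrite c1 mul0r scale0r in E1; rewrite c2 mulfK// in E2.
by split=> //; rewrite E0 scaleN1r.
Qed.

End CodimensionOne.

(** * The frame of a biconservative surface in N^3 *)

Lemma is_derive_rows4 {R : realType} (p v : 'rV[R]_2) (y e1 e2 n : 'rV[R]_2 -> 'rV[R]_4)
    (dy de1 de2 dn : 'rV[R]_4) :
  is_derive p v y dy -> is_derive p v e1 de1 -> is_derive p v e2 de2 -> is_derive p v n dn ->
  is_derive p v (fun q => rows4 (y q) (e1 q) (e2 q) (n q)) (rows4 dy de1 de2 dn).
Proof.
move=> h0 h1 h2 h3; apply/is_derive_mxP => i j; rewrite mxE.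
have E : (fun q => rows4 (y q) (e1 q) (e2 q) (n q) i j)
    = (fun q => (nth 0 [:: y q; e1 q; e2 q; n q] i : 'rV[R]_4) 0 j).
  by apply/funext => q; rewrite mxE.
rewrite E; case: i {E} => [[|[|[|[|//]]]] hi] /=; exact: is_derive_entry.
Qed.

(** Unit length and orthogonality to the tangent plane determine the derivatives
    of the unit normal [N] from those of the tangent frame. *)
Lemma normal_derivative {R : realType} (eps tau kap a : R) (J : set R) (p : 'rV[R]_2) i
    (y X0 X1 N : 'rV[R]_2 -> 'rV[R]_4) (V0 V1 Xi d : 'rV[R]_4) (l m : R) :
  open J -> strip J p -> kap != 0 -> a != 0 ->
  is_derive p (delta_mx 0 i) X0 V0 -> is_derive p (delta_mx 0 i) X1 V1 ->
  is_derive p (delta_mx 0 i) y (tau *: Xi) -> is_derive p (delta_mx 0 i) N d ->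
  (forall q, strip J q -> [/\ ambient_form eps (N q) (N q) = 1,
     ambient_form eps (N q) (X0 q) = 0, ambient_form eps (N q) (X1 q) = 0 &
     ambient_form eps (N q) (y q) = 0]) ->
  ambient_form eps (y p) (y p) = kap -> ambient_form eps (X0 p) (X0 p) = 1 ->
  ambient_form eps (X1 p) (X1 p) = a ^+ 2 ->
  ambient_form eps (X0 p) (y p) = 0 -> ambient_form eps (X1 p) (y p) = 0 ->
  ambient_form eps (X0 p) (X1 p) = 0 -> ambient_form eps (N p) Xi = 0 ->
  ambient_form eps (N p) V0 = - l -> ambient_form eps (N p) V1 = - (m * a ^+ 2) ->
  d = l *: X0 p + m *: X1 p.
Proof.
move=> oJ Jp kap0 a0 dX0 dX1 dy dN pr yy x00 x11 x0y x1y x01 NXi NV0 NV1.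
have nn q : strip J q -> ambient_form eps (N q) (N q) = 1 by case/pr.
have n0 q : strip J q -> ambient_form eps (N q) (X0 q) = 0 by case/pr.
have n1 q : strip J q -> ambient_form eps (N q) (X1 q) = 0 by case/pr.
have ny q : strip J q -> ambient_form eps (N q) (y q) = 0 by case/pr.
have cst (c : R) := is_derive_cst c p (delta_mx 0 i : 'rV[R]_2).
have eN := strip_is_derive_eq oJ Jp nn (is_derive_ambient eps dN dN) (cst 1).
rewrite (ambientC eps (N p) d) in eN; have {}eN := self_add_eq0 eN.
have e0 := strip_is_derive_eq oJ Jp n0 (is_derive_ambient eps dN dX0) (cst 0).
rewrite NV0 in e0; have {}e0 := subr0_eq e0.
have e1 := strip_is_derive_eq oJ Jp n1 (is_derive_ambient eps dN dX1) (cst 0).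
rewrite NV1 in e1; have {}e1 := subr0_eq e1.
have ey := strip_is_derive_eq oJ Jp ny (is_derive_ambient eps dN dy) (cst 0).
rewrite ambientZr NXi mulr0 addr0 in ey.
have x10 : ambient_form eps (X1 p) (X0 p) = 0 by rewrite ambientC.
have x0N : ambient_form eps (X0 p) (N p) = 0 by rewrite ambientC n0.
have x1N : ambient_form eps (X1 p) (N p) = 0 by rewrite ambientC n1.
have [a2 l1] : a ^+ 2 != 0 /\ (1 : R) != 0 by rewrite expf_neq0// oner_neq0.
apply/eqP; rewrite -subr_eq0; apply/eqP.
apply: (rows4_eq0 yy x00 x11 (nn p Jp) x0y x1y x01 (n0 p Jp) (n1 p Jp) (ny p Jp)
  (And4 kap0 l1 a2 l1)).
- by rewrite ambientDl ambientNl ambientDl !ambientZl ey x0y x1y !mulr0 addr0 subrr.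
- by rewrite ambientDl ambientNl ambientDl !ambientZl e0 x00 x10 mulr0 addr0 mulr1 subrr.
- by rewrite ambientDl ambientNl ambientDl !ambientZl e1 x01 x11 mulr0 add0r subrr.
- by rewrite ambientDl ambientNl ambientDl !ambientZl eN x0N x1N !mulr0 addr0 subrr.
Qed.

Lemma Os4_rows {R : realType} (eps : R) (f : R -> R) (s : R) (y x u n : 'rV[R]_4) :
  fmx 4 (Os4 eps f) s *m rows4 y x u n
  = rows4 x (- f s *: n - eps *: y) 0 (f s *: x).
Proof.
apply/row_matrixP => i; rewrite row_rows4 row_mulmx_sum sum4 !row_rows4 !mxE.
case: i => [[|[|[|[|//]]]] hi] /=; rewrite ?scale0r ?scale1r ?add0r ?addr0 //.
by rewrite addrC !scaleNr.
Qed.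

Lemma Ot4_rows {R : realType} (eps : R) (f : R -> R) (s : R) (y x u n : 'rV[R]_4) :
  fmx 4 (Ot4 eps f) s *m rows4 y x u n
  = rows4 (hf f s *: u) (dhf f s *: u)
      (- dhf f s *: x + (3 * (hf f s * f s)) *: n - (eps * hf f s) *: y)
      (- (3 * (hf f s * f s)) *: u).
Proof.
apply/row_matrixP => i; rewrite row_rows4 row_mulmx_sum sum4 !row_rows4 !mxE.
case: i => [[|[|[|[|//]]]] hi] /=; rewrite ?scale0r ?scale1r ?add0r ?addr0 //.
by rewrite mulNr scaleNr addrC.
Qed.

(** Rows: position, unit tangent vectors along the coordinate lines, and [H / f].
    By [biconservative_second_ff] its structure equations involve no choice. *)
Lemma biconservative_frame {R : realType} (eps : R) (J : set R) (f : R -> R)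
    (psi : 'rV[R]_2 -> 'rV[R]_4) :
  profile eps J f -> isometric_immersion eps (strip J) (warped_metric f) psi ->
  non_CMC_biconservative3 eps (strip J) (warped_metric f) psi ->
  exists e, [/\ forall p, r4 0 e p = psi p, solves4 eps J f e &
    forall p, strip J p -> onframe eps (e p)].
Proof.
move=> pf im bc; have w := profile_warped pf; have [oJ _ f0 _ _] := pf.
have [_ h0 hdh _] := w; have [sm sf gE] := im.
have dd s : J s -> is_derive s 1 (dhf f) ((3 * f s ^+ 2 - eps) * hf f s).
  exact: dhf_derive pf.
pose H := mean_vector eps (warped_metric f) psi.
pose N (q : 'rV[R]_2) : 'rV[R]_4 := (f (q 0 0))^-1 *: H q.
pose E2 (q : 'rV[R]_2) : 'rV[R]_4 := (hf f (q 0 0))^-1 *: pd 1 psi q.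
pose e q := rows4 (psi q) (pd 0 psi q) (E2 q) (N q).
have lin3 (a b c : R) (n u v z : 'rV[R]_4) :
    ambient_form eps n (a *: u - b *: v - c *: z) =
    a * ambient_form eps n u - b * ambient_form eps n v - c * ambient_form eps n z.
  by rewrite !(ambientDr, ambientNr, ambientZr).
have divh (h k b : R) (u x z : 'rV[R]_4) : h != 0 ->
    h^-1 *: ((3 * h ^+ 2) *: (k *: u) - (h * b) *: x - (eps * h ^+ 2) *: z)
    = - b *: x + (3 * (h * k)) *: u - (eps * h) *: z.
  by move=> hn; apply/rowP => i; rewrite !mxE; field.
have HN q : strip J q -> H q = f (q 0 0) *: N q.
  by move=> Jq; rewrite scalerA divff ?scale1r// gt_eqF// f0.
have X1E q : strip J q -> pd 1 psi q = hf f (q 0 0) *: E2 q.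
  by move=> Jq; rewrite scalerA divff ?scale1r// gt_eqF// h0.
have nN q : strip J q -> [/\ ambient_form eps (N q) (N q) = 1,
     ambient_form eps (N q) (pd 0 psi q) = 0, ambient_form eps (N q) (pd 1 psi q) = 0 &
     ambient_form eps (N q) (pole eps (psi q)) = 0].
  move=> Jq; have [n0 n1 ny _] := mean_vector_normal w dd im Jq.
  have HH := mean_square_eq pf im bc Jq; have fn : f (q 0 0) != 0 by rewrite gt_eqF// f0.
  move: n0 n1 ny HH; rewrite /N /H; move: (mean_vector _ _ _ _) => v n0 n1 ny HH.
  split; [by rewrite ambientZl ambientZr HH; field|by rewrite ambientZl n0 mulr0
    |by rewrite ambientZl n1 mulr0|by rewrite ambientZl ny mulr0].
have prods q : strip J q -> [/\ ambient_form eps (pd 0 psi q) (pd 0 psi q) = 1,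
    ambient_form eps (pd 0 psi q) (pd 1 psi q) = 0 &
    ambient_form eps (pd 1 psi q) (pd 1 psi q) = hf f (q 0 0) ^+ 2].
  by move=> Jq; split; rewrite (gE _ _ _ Jq) (warped_entry _ _ w Jq).
have sol : solves4 eps J f e.
  move=> p Jp; have hn : hf f (p 0 0) != 0 by rewrite gt_eqF// h0.
  have fn : f (p 0 0) != 0 by rewrite gt_eqF// f0.
  have dpsi i : is_derive p (delta_mx 0 i) psi (pd i psi p).
    exact: is_derive_pd (smooth_on_differentiable sm Jp).
  have dX i j : is_derive p (delta_mx 0 i) (pd j psi) (pd i (pd j psi) p).
    exact: is_derive_pd (smooth_on_differentiable (smooth_on_pd j sm) Jp).
  have [_ V00 [V01 V10] [_ V11] _] := gauss_formulas w (dd _ Jp) im Jp.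
  have [B00 B01 B11] := biconservative_second_ff pf im bc Jp.
  have yE := eps_pole eps 1 (psi p); rewrite mulr1 in yE.
  rewrite B00 yE -/H (HN p Jp) in V00; rewrite B01 add0r in V01 V10.
  rewrite B11 -/H (HN p Jp) eps_pole in V11.
  have [g00 g01 g11] := prods p Jp; have [nn n0 n1 ny] := nN p Jp.
  have t0 := immersion_tangent 0 oJ im Jp; have t1 := immersion_tangent 1 oJ im Jp.
  have nx : eps * ambient_form eps (N p) (psi p) = 0.
    by rewrite -ambientZr -yE ambientZr ny mulr0.
  have nV00 : ambient_form eps (N p) (pd 0 (pd 0 psi) p) = - f (p 0 0).
    rewrite V00 ambientDr !ambientNr [ambient_form _ _ (f _ *: N p)]ambientZr nn mulr1.
    by rewrite [ambient_form _ _ (eps *: _)]ambientZr nx subr0.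
  have nV01 : ambient_form eps (N p) (pd 0 (pd 1 psi) p) = 0.
    by rewrite V01 ambientZr n1 mulr0.
  have nV11 : ambient_form eps (N p) (pd 1 (pd 1 psi) p)
      = - (- (3 * f (p 0 0)) * hf f (p 0 0) ^+ 2).
    rewrite V11 lin3 [ambient_form _ _ (f _ *: N p)]ambientZr nn n0 mulr0 subr0 mulr1.
    have -> : eps * hf f (p 0 0) ^+ 2 * ambient_form eps (N p) (psi p)
      = hf f (p 0 0) ^+ 2 * (eps * ambient_form eps (N p) (psi p)) by ring.
    by rewrite nx; ring.
  have dy i := pole_derive eps (dpsi i).
  have pdN : has_pd p N.
    have [_ _ _ pdH] := mean_vector_normal w dd im Jp.
    have df := is_derive_powR_comp (-1) (f0 _ Jp) (profile_df pf Jp).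
    have hN := has_pd_scale df pdH.
    move=> i; have [d hd] := hN i; exists d; apply: (near_strip_is_derive oJ Jp _ hd).
    by move=> q Jq; rewrite /N; congr (_ *: _); exact: powR_inv1 (ltW (f0 _ Jq)).
  have [d0 dN0] := pdN 0; have [d1 dN1] := pdN 1.
  have ps := pole_square (sf p Jp); have pn := pole_square_neq0 eps.
  have nV01' : ambient_form eps (N p) (pd 0 (pd 1 psi) p) = - (0 * hf f (p 0 0) ^+ 2).
    by rewrite nV01 mul0r oppr0.
  have nV10' : ambient_form eps (N p) (pd 1 (pd 0 psi) p) = - 0.
    by rewrite V10 -V01 nV01 oppr0.
  have N0 := normal_derivative oJ Jp pn hn (dX 0 0) (dX 0 1) (dy 0) dN0 nN ps g00 g11
    t0 t1 g01 n0 nV00 nV01'.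
  have N1 := normal_derivative oJ Jp pn hn (dX 1 0) (dX 1 1) (dy 1) dN1 nN ps g00 g11
    t0 t1 g01 n1 nV10' nV11.
  rewrite scale0r addr0 in N0; rewrite scale0r add0r in N1.
  rewrite N0 in dN0; rewrite N1 in dN1.
  have h2 := is_derive_powR_comp (-1) (h0 _ Jp) (hdh _ Jp).
  have hE q : strip J q -> (hf f (q 0 0)) `^ (-1) *: pd 1 psi q = E2 q.
    by move=> Jq; rewrite /E2; congr (_ *: _); exact: powR_inv1 (ltW (h0 _ Jq)).
  have hm : hf f (p 0 0) `^ (-1 - 1) = (hf f (p 0 0) ^+ 2)^-1.
    rewrite powRB ?(negbTE hn) ?implybT// powR_inv1 ?ltW ?h0// powRr1 ?ltW ?h0//.
    by rewrite expr2 invfM.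
  have dE0 : is_derive p (delta_mx 0 0) E2 0.
    apply: (near_strip_is_derive oJ Jp hE).
    apply: (is_derive_eq (is_derive_scale (is_derive_coord_same h2) (dX 0 1))).
    rewrite V01 hm powR_inv1 ?ltW ?h0// scalerA -scalerDl.
    by rewrite (_ : _ + _ = 0) ?scale0r//; field.
  have dE1 : is_derive p (delta_mx 0 1) E2
      (- (dhf f (p 0 0)) *: pd 0 psi p + (3 * (hf f (p 0 0) * f (p 0 0))) *: N p
        - (eps * hf f (p 0 0)) *: psi p).
    apply: (near_strip_is_derive oJ Jp hE).
    have ho := @is_derive_coord_other _ _ (fun s => hf f s `^ (-1)) 0 1 p isT.
    apply: (is_derive_eq (is_derive_scale ho (dX 1 1))).
    rewrite V11 (powR_inv1 (ltW (h0 _ Jp))) scale0r add0r; exact: divh.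
  have V10E : pd 1 (pd 0 psi) p = dhf f (p 0 0) *: E2 p by rewrite V10; exact: esym (scalerA _ _ _).
  have N1E : - (3 * f (p 0 0)) *: pd 1 psi p
      = - (3 * (hf f (p 0 0) * f (p 0 0))) *: E2 p.
    by rewrite (X1E p Jp) scalerA; congr (_ *: _); ring.
  split.
    apply: (is_derive_eq (is_derive_rows4 (dpsi 0) (dX 0 0) dE0 dN0)).
    by rewrite Os4_rows V00 scaleNr.
  apply: (is_derive_eq (is_derive_rows4 (dpsi 1) (dX 1 0) dE1 dN1)).
  by rewrite Ot4_rows V10E N1E -(X1E p Jp).
exists e; split=> //.
  by move=> p; rewrite /r4 row_rows4.
move=> p Jp; have hn : hf f (p 0 0) != 0 by rewrite gt_eqF// h0.
have [g00 g01 g11] := prods p Jp; have [nn n0 n1 ny] := nN p Jp.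
have t0 := immersion_tangent 0 oJ im Jp; have t1 := immersion_tangent 1 oJ im Jp.
have ty : [/\ ambient_form eps (pd 0 psi p) (pole eps (psi p)) = 0,
    ambient_form eps (E2 p) (pole eps (psi p)) = 0 &
    ambient_form eps (N p) (pole eps (psi p)) = 0].
  by split=> //; rewrite /E2 ambientZl t1 mulr0.
have on : forall i j, i != 0 -> j != 0 ->
    ambient_form eps (row i (e p)) (row j (e p)) = (i == j)%:R.
  have e22 : ambient_form eps (E2 p) (E2 p) = 1.
    by rewrite /E2 ambientZl ambientZr g11; field.
  have e12 : ambient_form eps (pd 0 psi p) (E2 p) = 0 by rewrite /E2 ambientZr g01 mulr0.
  have ne2 : ambient_form eps (N p) (E2 p) = 0 by rewrite /E2 ambientZr n1 mulr0.
  have [a1 a2 a3] := ty.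
  have R4 := rows4_products (pole_square (sf p Jp)) g00 e22 nn a1 a2 e12 n0 ne2 a3.
  have rE (k : 'I_4) : k != 0 -> row k (e p)
      = row k (rows4 (pole eps (psi p)) (pd 0 psi p) (E2 p) (N p)).
    by rewrite !row_rows4; case: k => [[|[|[|[|//]]]] hk].
  move=> i j i0 j0; rewrite (rE i i0) (rE j j0) R4; case: eqP => // _.
  by case: i i0 => [[|[|[|[|//]]]] hi].
have [a1 a2 a3] := ty; split.
- exact: on.
- move=> en; have := sf p Jp; rewrite /space_form /= (negbTE en) => -[xx _].
  rewrite /pole (negbTE en) in a1 a2 a3.
  rewrite row_rows4; split; first exact: xx.
  move=> i i0; rewrite row_rows4 ambientC.
  by case: i i0 => [[|[|[|[|//]]]] hi].
- move=> e0 i; rewrite mxE; have := sf p Jp; rewrite /space_form /= e0 eqxx => x0.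
  rewrite /pole e0 eqxx !ambient_e0 in a1 a2 a3.
  by case: i => [[|[|[|[|//]]]] hi].
- move=> en; have := sf p Jp; rewrite /space_form /= lt_eqF// => -[_ h].
  by rewrite mxE /=; exact: h.
Qed.

(** * Rigidity *)

(** Linear isometries of the ambient space that map the space form to itself. *)
Definition ambient_isometry {R : realType} {n : nat} (eps : R) (M : 'M[R]_n.+1) : Prop :=
  [/\ forall u v, ambient_form eps (u *m M) (v *m M) = ambient_form eps u v,
      eps = 0 -> forall v : 'rV[R]_n.+1, (v *m M) 0 0 = v 0 0 &
      eps < 0 -> exists2 x, space_form eps x & space_form eps (x *m M)].

Lemma ambient_isometry_inv {R : realType} {n : nat} (eps : R) (M : 'M[R]_n.+1) :
  M \in unitmx -> ambient_isometry eps M -> ambient_isometry eps (invmx M).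
Proof.
move=> uM [h1 h2 h3]; split.
- by move=> u v; rewrite -h1 !mulmxKV.
- by move=> e0 v; rewrite -[LHS](h2 e0) mulmxKV.
- by move=> en; have [x sx sM] := h3 en; exists (x *m M); rewrite ?mulmxK.
Qed.

(** For [eps < 0] the image of [y] stays on the sheet because its scalar product with
    one point that is known to stay there is preserved. *)
Lemma ambient_isometry_space_form {R : realType} {n : nat} (eps : R) (M : 'M[R]_n.+1)
    (k k' y : 'rV[R]_n.+1) : ambient_isometry eps M ->
  (eps = 0 -> k 0 0 = 0 /\ k' 0 0 = 0) -> (eps != 0 -> k = 0 /\ k' = 0) ->
  space_form eps y -> space_form eps ((y - k) *m M + k').
Proof.
move=> [h1 h2 h3] k0 kn; rewrite /space_form /=.
case: (eqVneq eps 0) => [e0|e0] sy.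
  by have [k1 k2] := k0 e0; rewrite mxE (h2 e0) mxE sy add0r k2 mxE k1 oppr0 addr0.
have [-> ->] := kn e0; rewrite subr0 addr0 h1; have [yy y0] := sy; split=> // en.
have [x] := h3 en; rewrite /space_form /= (negbTE e0) => -[xx x0] [xM xM0].
have := same_sheet en xx yy; rewrite mulr_gt0 ?x0 ?y0// => /esym.
have yM : ambient_form eps (y *m M) (y *m M) = eps^-1 by rewrite h1.
by rewrite -h1 -(same_sheet en xM yM) pmulr_rgt0 ?xM0.
Qed.

(** The translations enter only for [eps = 0], when the space form is flat. *)
Lemma rigid_motion {R : realType} {n : nat} (eps : R) (M : 'M[R]_n.+1)
    (k k' : 'rV[R]_n.+1) : M \in unitmx -> ambient_isometry eps M ->
  (eps = 0 -> k 0 0 = 0 /\ k' 0 0 = 0) -> (eps != 0 -> k = 0 /\ k' = 0) ->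
  space_form_isometry eps (fun y => (y - k) *m M + k').
Proof.
move=> uM iM k0 kn; split; last first.
  move=> x y _ _; have [h1 _ _] := iM.
  by rewrite opprD addrACA subrr addr0 -mulmxBl opprB addrA subrK h1.
apply/seteqP; split=> [_ [x sx <-]|y sy].
  exact: ambient_isometry_space_form.
exists ((y - k') *m invmx M + k); last by rewrite addrK mulmxKV// subrK.
apply: (ambient_isometry_space_form (ambient_isometry_inv uM iM)) => //.
  by move=> /k0[].
by move=> /kn[].
Qed.

Lemma ambient_mulmx {R : realType} {n : nat} (eps : R) (u v : 'rV[R]_n.+1) :
  ambient_form eps u v = (u *m Gmx eps *m v^T) 0 0.
Proof. by have := ambient_rows eps u v 0 0; rewrite !row_id. Qed.

(** For [eps = 0] the position is replaced by [e_0], which makes the frame a basis. *)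
Definition pole_frame {R : realType} {n : nat} (eps : R) (E : 'M[R]_n.+1) : 'M[R]_n.+1 :=
  E - shiftmx eps *m E + shiftmx eps.

Lemma row_shift_mul {R : realType} {n : nat} (eps : R) (E : 'M[R]_n.+1) i :
  row i (shiftmx eps *m E) = ((i == 0) && (eps == 0))%:R *: row 0 E.
Proof.
apply/rowP => j; rewrite -scalemxAl !mxE (bigD1 0)//= big1 ?addr0; last first.
  by move=> k k0; rewrite mxE (negbTE k0) andbF mul0r.
by rewrite mxE eqxx andbT mulrA; case: (i == 0); case: (eps == 0); rewrite /= ?mulr1 ?mulr0.
Qed.

Lemma row_pole_frame {R : realType} {n : nat} (eps : R) (E : 'M[R]_n.+1) i :
  row i (pole_frame eps E) = if i == 0 then pole eps (row 0 E) else row i E.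
Proof.
rewrite /pole_frame linearD linearB /= row_shift_mul -[shiftmx eps in X in _ + X]mulmx1.
rewrite row_shift_mul /pole; case: (eqVneq i 0) => [->|_] /=; last first.
  by rewrite !scale0r subr0 addr0.
case: (eps == 0); rewrite ?scale0r ?scale1r ?subr0 ?addr0// subrr add0r.
by rewrite row1.
Qed.

Lemma pole_frame_products {R : realType} {n : nat} (eps : R) (E : 'M[R]_n.+1) :
  onframe eps E -> forall i j,
  ambient_form eps (row i (pole_frame eps E)) (row j (pole_frame eps E))
    = if i == j then (if i == 0 then (if eps == 0 then 1 else eps^-1) else 1) else 0.
Proof.
move=> fr; have [on ox oz _] := fr.
have py k : k != 0 -> ambient_form eps (row k E) (pole eps (row 0 E)) = 0.
  move=> k0; rewrite /pole; case: (eqVneq eps 0) => [e0|e0].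
    by rewrite e0 ambient_e0 mxE oz.
  by rewrite ambientC (ox e0).2.
move=> i j; rewrite !row_pole_frame.
case: (eqVneq i 0) => [->|i0]; case: (eqVneq j 0) => [j0|j0].
- by rewrite pole_square//; exact: onframe_space_form.
- by rewrite ambientC py.
- by rewrite py// j0 (negbTE i0).
by rewrite on//; case: (i == j).
Qed.

(** The change of basis between two frames with the same Gram matrix. *)
Lemma frame_isometry {R : realType} {n : nat} (eps : R) (E E' : 'M[R]_n.+1) :
  onframe eps E -> onframe eps E' ->
  exists M, [/\ M \in unitmx, ambient_isometry eps M &
    (E - shiftmx eps *m E) *m M = E' - shiftmx eps *m E'].
Proof.
move=> fr fr'; set S := shiftmx eps.
have pr := pole_frame_products fr; have pr' := pole_frame_products fr'.
set F := pole_frame eps E in pr; set F' := pole_frame eps E' in pr'.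
have nz (i : 'I_n.+1) : (if i == 0 then (if eps == 0 then 1 else eps^-1) else 1) != 0 :> R.
  by case: (i == 0); [case: (eqVneq eps 0) => [_|e0]; rewrite ?oner_neq0// invr_eq0
    |exact: oner_neq0].
have uF := orthogonal_unitmx pr nz; have uF' := orthogonal_unitmx pr' nz.
have SS : S *m S = S.
  rewrite /S /shiftmx -scalemxAl -scalemxAr scalerA mul_delta_mx.
  by case: (eps == 0); rewrite ?mulr1 ?mulr0.
have SF G : S *m pole_frame eps G = S.
  by rewrite /pole_frame mulmxDr mulmxBr mulmxA SS subrr add0r.
pose M := invmx F *m F'.
have FM : F *m M = F' by rewrite /M mulKVmx.
have SM : S *m M = S by rewrite -[in LHS](SF E) -mulmxA FM SF.
have uM : M \in unitmx by rewrite unitmx_mul unitmx_inv uF.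
clearbody M.
have key : M *m Gmx eps *m M^T = Gmx eps.
  have E1 := orthogonal_gram pr; have E2 := orthogonal_gram pr'.
  have FT : F^T \in unitmx by rewrite unitmx_tr.
  apply: (can_inj (mulKmx uF)); apply: (can_inj (mulmxK FT)).
  have -> : F *m (M *m Gmx eps *m M^T) *m F^T = (F *m M) *m Gmx eps *m (F *m M)^T.
    by rewrite trmx_mul !mulmxA.
  by rewrite FM E1 E2.
have uv (u w : 'rV[R]_n.+1) : ambient_form eps (u *m M) (w *m M) = ambient_form eps u w.
  rewrite !ambient_mulmx trmx_mul.
  have -> : u *m M *m Gmx eps *m (M^T *m w^T) = u *m (M *m Gmx eps *m M^T) *m w^T.
    by rewrite !mulmxA.
  by rewrite key.
exists M; split.
- exact: uM.
- split; first exact: uv.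
  + move=> e0 v.
    have e0M : (delta_mx 0 0 : 'rV[R]_n.+1) *m M = delta_mx 0 0.
      have := congr1 (row 0) SM; rewrite row_mul.
      have -> : row 0 S = delta_mx 0 0.
        by apply/rowP => j; rewrite /S /shiftmx e0 eqxx scale1r !mxE.
      by [].
    by have := uv v (delta_mx 0 0); rewrite e0M e0 !ambient_e0.
  move=> en; exists (row 0 E); first exact: onframe_space_form.
  have en0 : eps == 0 = false by rewrite lt_eqF.
  have := congr1 (row 0) FM; rewrite row_mul /F /F' !row_pole_frame /= /pole en0 => ->.
  exact: onframe_space_form.
have := FM; rewrite /F /F' /pole_frame mulmxDl -/S SM => /addIr.
by [].
Qed.

(** Two solutions of the same structure equations differ by the rigid motion
    that matches their initial frames. *)
Lemma frames_congruent {R : realType} (eps : R) (J : set R) f (s0 : R) e e' :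
  profile eps J f -> is_interval J -> J s0 ->
  solves4 eps J f e -> solves4 eps J f e' ->
  (forall p, strip J p -> onframe eps (e p)) ->
  (forall p, strip J p -> onframe eps (e' p)) ->
  congruent_on eps (strip J) (r4 0 e) (r4 0 e').
Proof.
move=> pf iJ J0 sol sol' fr fr'; have [oJ _ _ _ _] := pf.
set p0 : 'rV[R]_2 := pt s0 0; have Jp0 : strip J p0 by rewrite strip_pt.
have [M [uM iM EM]] := frame_isometry (fr p0 Jp0) (fr' p0 Jp0).
set K := shiftmx eps *m e p0 in EM; set K' := shiftmx eps *m e' p0 in EM.
pose Z p := (e p - K) *m M + K'.
have Z0 : Z p0 = e' p0 by rewrite /Z EM subrK.
have dZ p v (A : 'M[R]_4) : A *m shiftmx eps = 0 ->
    is_derive p v e (A *m e p) -> is_derive p v Z (A *m Z p).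
  move=> AS de.
  have d := is_derive_mulmx (is_deriveB de (is_derive_cst K p v)) (is_derive_cst M p v).
  apply: (is_derive_eq (is_deriveD d (is_derive_cst K' p v))).
  rewrite subr0 mulmx0 !addr0 /Z mulmxDr mulmxA mulmxBr /K /K' !mulmxA AS !mul0mx.
  by rewrite subr0 addr0.
have ZE p : strip J p -> Z p = e' p.
  have along_s s : J s -> Z (pt s 0) = e' (pt s 0).
    apply: (linear_ode_unique (A := fun u => fmx 4 (Os4 eps f) u) (Y := fun u => Z (pt u 0))
      (Z := fun u => e' (pt u 0)) iJ J0 _ _ _ Z0).
    - move=> u i j Ju; apply: smooth1_continuous Ju.
      exact: smooth_fmx oJ (smooth1_Os4 pf) i j.
    - move=> u Ju; have Jpu : strip J (pt u 0) by rewrite strip_pt.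
      have [h _] := sol _ Jpu; rewrite pt0E in h.
      exact: is_derive_line0 (dZ _ _ _ (Os4_shift _ _ _) h).
    - move=> u Ju; have Jpu : strip J (pt u 0) by rewrite strip_pt.
      have [h _] := sol' _ Jpu; rewrite pt0E in h.
      exact: is_derive_line0 h.
  rewrite (ptE p) strip_pt; move: (p 0 0) (p 0 1) => s t Js.
  have iT : is_interval [set: R] by [].
  apply: (linear_ode_unique (A := fun _ => fmx 4 (Ot4 eps f) s) (Y := fun u => Z (pt s u))
    (Z := fun u => e' (pt s u)) (s0 := 0) iT I _ _ _ (along_s s Js) I).
  - by move=> u i j _; exact: cvg_cst.
  - move=> u _; have Jpu : strip J (pt s u) by rewrite strip_pt.
    have [_ h] := sol _ Jpu; rewrite pt0E in h.
    exact: is_derive_line1 (dZ _ _ _ (Ot4_shift _ _ _) h).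
  move=> u _; have Jpu : strip J (pt s u) by rewrite strip_pt.
  have [_ h] := sol' _ Jpu; rewrite pt0E in h.
  exact: is_derive_line1 h.
have Krow (E : 'M[R]_4) : row 0 (shiftmx eps *m E) = (eps == 0)%:R *: row 0 E.
  by rewrite row_shift_mul eqxx.
exists (fun y => (y - row 0 K) *m M + row 0 K'); last first.
  by move=> p Jp; rewrite /r4 -(ZE p Jp) /Z linearD /= row_mul linearB.
apply: rigid_motion => //.
  move=> e0; have [_ _ z _] := fr p0 Jp0; have [_ _ z' _] := fr' p0 Jp0.
  by rewrite /K /K' !Krow !mxE (z e0) (z' e0) !mulr0.
by move=> e0; rewrite /K /K' !Krow (negbTE e0) !scale0r.
Qed.

(** * Existence and uniqueness *)

Lemma profile_restrict {R : realType} (eps : R) (I J : set R) f :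
  J `<=` I -> open J -> profile eps I f -> profile eps J f.
Proof. by move=> JI oJ [_ sf f0 f1 ode]; split=> // [k s|s|s|s] /JI; auto. Qed.

Lemma space_form_surface {R : realType} (eps : R) (I : set R) f :
  profile eps I f -> is_interval I -> I !=set0 ->
  exists psi : 'rV[R]_2 -> 'rV[R]_4,
  [/\ isometric_immersion eps (strip I) (warped_metric f) psi,
      non_CMC_biconservative3 eps (strip I) (warped_metric f) psi,
      (forall psi' : 'rV[R]_2 -> 'rV[R]_4,
         isometric_immersion eps (strip I) (warped_metric f) psi' ->
         non_CMC_biconservative3 eps (strip I) (warped_metric f) psi' ->
         congruent_on eps (strip I) psi psi') &
      forall p, strip I p -> mean_curvature eps (warped_metric f) psi p = f (p 0 0)].
Proof.
move=> pf iI [s0 I0]; have [e [sol se fr]] := space_frame pf iI I0.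
exists (r4 0 e); split.
- apply: (adapted_isometric (profile_warped pf) (space_adapted sol fr)).
    exact: se.
  by move=> p Ip; exact: onframe_space_form (fr p Ip).
- exact: space_non_CMC_biconservative pf sol fr.
- move=> psi' im bc; have [e' [E sol' fr']] := biconservative_frame pf im bc.
  have [F isoF FE] := frames_congruent pf iI I0 sol sol' fr fr'.
  by exists F => // p Ip; rewrite -FE// E.
by move=> p Ip; exact: space_mean_curvature pf sol fr Ip.
Qed.

Theorem theorem3p23 (R : realType) (eps : R) (I : set R) (f : R -> R)
  (I_nonempty : I !=set0) (I_open : open I) (I_interval : is_interval I)
  (f_smooth : forall (k : nat) (s : R), I s -> derivable (derive1n k f) s 1)
  (f_pos : forall s : R, I s -> 0 < f s)
  (f_incr : forall s : R, I s -> 0 < derive1 f s)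
  (f_ode : forall s : R, I s ->
     derive1n 2 f s * f s - 7 / 4 * derive1 f s ^+ 2 + 4 * f s ^+ 4
       - 4 / 3 * eps * f s ^+ 2 = 0) :
  let g := warped_metric f in
  let K := gauss_curvature g in
  (forall J : set R, J `<=` I -> J !=set0 -> open J -> is_interval J ->
     (exists2 m : R, 0 < m & forall s : R, J s -> m <= f s) ->
     exists (a b : R) (phi : R -> 'rV[R]_2 -> 'rV[R]_5),
       [/\ a < b,
           (forall c : R, a < c < b ->
              flat_W_surface eps (strip J) g (phi c) /\
              forall p, strip J p ->
                mean_curvature eps g (phi c) p ^+ 2 = 1 / 3 * (eps - K p)),
           (forall c c' : R, a < c < b -> a < c' < b -> c <> c' ->
              ~ congruent_on eps (strip J) (phi c) (phi c')) &
           (forall (p : 'rV[R]_2) (c : R), strip J p -> a < c < b ->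
              {for c, continuous (fun c' : R => phi c' p)})])
  /\
  (exists psi : 'rV[R]_2 -> 'rV[R]_4,
     [/\ isometric_immersion eps (strip I) g psi,
         non_CMC_biconservative3 eps (strip I) g psi,
         (forall psi' : 'rV[R]_2 -> 'rV[R]_4,
            isometric_immersion eps (strip I) g psi' ->
            non_CMC_biconservative3 eps (strip I) g psi' ->
            congruent_on eps (strip I) psi psi'),
         (forall p, strip I p ->
            mean_curvature eps g psi p ^+ 2 = 1 / 3 * (eps - K p)) &
         (forall (J : set R) (phi : 'rV[R]_2 -> 'rV[R]_5),
            J `<=` I -> flat_W_surface eps (strip J) g phi ->
            forall p, strip J p ->
              mean_curvature eps g psi p ^+ 2
              = mean_curvature eps g phi p ^+ 2)]).
Proof.
move=> g K.
have pf : profile eps I f by [].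
split.
  move=> J JI J0 oJ iJ [m m0 mf].
  exact: family_exists (profile_restrict JI oJ pf) iJ J0 m0 mf.
have [psi [im bc uniq mc]] := space_form_surface pf I_interval I_nonempty.
have mcK p : strip I p -> mean_curvature eps g psi p ^+ 2 = 1 / 3 * (eps - K p).
  by move=> Ip; rewrite mc// /K /g (profile_curvature pf Ip); field.
exists psi; split=> // J phi JI [_ _ _ _ [X1 [X2 [E4 [_ H]]]]] p Jp.
have [_ KE _ _ _] := H p Jp.
rewrite mcK; last exact: JI.
by rewrite /K KE; field.
Qed.
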